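(* Let $M\in\{1,2\}$ and let $F:\mathbb R^2\to\mathbb R^2$, $G=(G_1,\dots,G_M):\mathbb R^2\to\mathbb M_{2\times M}$ satisfy: (1) $F,G$ are of class $\mathcal C^{1,1}$ with all partial derivatives Lipschitz with constant $L$; (2) $F(0)=0$; (3) $\mathrm{rank}[G_i(0),DF(0)G_i(0)]=2$ for $i=1,\dots,M$; (4) $DG(0)=0$. Let $T$ be the minimum time function to reach the origin for $\dot x=F(x)+G(x)u$, $u\in[-1,1]^M$, let $\mathcal T>0$ be as in the context, fix $0<\tau<\mathcal T$ and define $$S=\{x\in\mathcal R_\tau:\ \exists\zeta\in\mathbb S^1\cap N_{\mathcal R_{T(x)}}(x)\text{ with } h(x,\zeta)=0\}.$$ Then $S$ is countably $\mathcal H^1$-rectifiable. Moreover, for every $\bar x\in S$ there exists $\delta>0$ such that $\mathcal H^1(S\cap B(\bar x,\delta))>0$.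
   Context: $\mathcal R_t=\{x: T(x)\le t\}$. Minimized Hamiltonian: $h(x,p)=\langle p,F(x)\rangle-\sum_{i=1}^M|\langle p,G_i(x)\rangle|$. $N_K(x)$ is the proximal normal cone: $v\in N_K(x)$ iff $\exists\sigma\ge0$ with $\langle v,y-x\rangle\le\sigma\|y-x\|^2$ for all $y\in K$. It is known (under (1)–(4)) that there exists $\mathcal T>0$, depending only on $L$, $DF(0)$, $G(0)$, such that for all $0<\tau<\mathcal T$: (a) $\mathcal R_\tau$ is strictly convex and each $x\in\mathrm{bdry}\,\mathcal R_\tau$ has a unique optimal control to the origin, bang-bang with finitely many switchings; (b) every $x\in\mathcal R_\tau$ is an optimal point; (c) $\mathrm{epi}(T)$ has locally positive reach; $\mathcal T$ denotes such a constant. $\mathcal H^1$ is one-dimensional Hausdorff measure. *)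

(* Defs.v *)
From HB Require Import structures.
From mathcomp Require Import all_boot all_order all_algebra.
From mathcomp Require Import all_classical all_reals all_analysis.
Set Implicit Arguments. Unset Strict Implicit. Unset Printing Implicit Defensive.
Import Order.TTheory GRing.Theory Num.Theory.
Import numFieldNormedType.Exports.
Local Open Scope classical_set_scope.
Local Open Scope ring_scope.

Definition dot {R : realType} (p q : R * R) : R := p.1 * q.1 + p.2 * q.2.
Definition vsub {R : realType} (p q : R * R) : R * R := (p.1 - q.1, p.2 - q.2).
Definition vcomb {R : realType} (l : R) (p q : R * R) : R * R :=
  (l * p.1 + (1 - l) * q.1, l * p.2 + (1 - l) * q.2).
Definition enorm {R : realType} (p : R * R) : R := Num.sqrt (dot p p).
Definition edist {R : realType} (p q : R * R) : R := enorm (vsub p q).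
Definition eball {R : realType} (c : R * R) (r : R) : set (R * R) :=
  [set x | edist c x < r].
Definition einterior {R : realType} (K : set (R * R)) : set (R * R) :=
  [set x | exists e : R, 0 < e /\ eball x e `<=` K].
Definition eboundary {R : realType} (K : set (R * R)) : set (R * R) :=
  [set x | forall e : R, 0 < e -> (eball x e `&` K) !=set0 /\ (eball x e `&` ~` K) !=set0].
Definition edist3 {R : realType} (p q : (R * R) * R) : R :=
  Num.sqrt ((p.1.1 - q.1.1) ^+ 2 + (p.1.2 - q.1.2) ^+ 2 + (p.2 - q.2) ^+ 2).

Definition coord {R : realType} (k : 'I_2) (p : R * R) : R :=
  if val k == 0%N then p.1 else p.2.
Definition colv {R : realType} (p : R * R) : 'cV[R]_2 := \col_k coord k p.

Definition partial1 {R : realType} (f : R * R -> R) (x : R * R) : R :=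
  derive1 (fun t => f (t, x.2)) x.1.
Definition partial2 {R : realType} (f : R * R -> R) (x : R * R) : R :=
  derive1 (fun t => f (x.1, t)) x.2.
Definition partialj {R : realType} (j : 'I_2) (f : R * R -> R) (x : R * R) : R :=
  if val j == 0%N then partial1 f x else partial2 f x.
Definition jac {R : realType} (f : R * R -> R * R) (x : R * R) : 'M[R]_2 :=
  \matrix_(k < 2, j < 2) partialj j (fun y => coord k (f y)) x.

Definition lipschitzL {R : realType} (L : R) (g : R * R -> R) : Prop :=
  forall x y, `|g x - g y| <= L * edist x y.
(* f : R^2 -> R is of class C^{1,1}, its partial derivatives existing
   everywhere and being Lipschitz with constant L (hence f is C^1). *)
Definition C11 {R : realType} (L : R) (f : R * R -> R) : Prop :=
  (forall x : R * R, derivable (fun t => f (t, x.2)) x.1 1 /\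
                     derivable (fun t => f (x.1, t)) x.2 1) /\
  lipschitzL L (partial1 f) /\ lipschitzL L (partial2 f).
Definition C11_vec {R : realType} (L : R) (f : R * R -> R * R) : Prop :=
  forall k : 'I_2, C11 L (fun y => coord k (f y)).

Definition field {R : realType} {M : nat} (F : R * R -> R * R)
  (G : 'I_M -> R * R -> R * R) (x : R * R) (v : 'I_M -> R) : R * R :=
  ((F x).1 + \sum_(i < M) v i * (G i x).1, (F x).2 + \sum_(i < M) v i * (G i x).2).

Definition admissible {R : realType} {M : nat} (u : R -> 'I_M -> R) (t : R) : Prop :=
  forall i : 'I_M, measurable_fun `[0, t]%classic (fun s => u s i) /\
                   (forall s, 0 <= s <= t -> `|u s i| <= 1).

Definition trajectory {R : realType} {M : nat} (F : R * R -> R * R)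
  (G : 'I_M -> R * R -> R * R) (x0 : R * R) (u : R -> 'I_M -> R) (t : R)
  (y : R -> R * R) : Prop :=
  y 0 = x0 /\ {within `[0, t]%classic, continuous (fun s : R => (y s).1)} /\
  {within `[0, t]%classic, continuous (fun s : R => (y s).2)} /\
  forall s, 0 <= s <= t ->
    ((y s).1)%:E = (x0.1)%:E +
       (\int[@lebesgue_measure R]_(r in `[0%R, s]%classic) ((field F G (y r) (u r)).1)%:E)%E /\
    ((y s).2)%:E = (x0.2)%:E +
       (\int[@lebesgue_measure R]_(r in `[0%R, s]%classic) ((field F G (y r) (u r)).2)%:E)%E.

Definition steers {R : realType} {M : nat} F G (x0 : R * R) (t : R)
  (u : R -> 'I_M -> R) (y : R -> R * R) : Prop :=
  0 <= t /\ admissible u t /\ trajectory F G x0 u t y /\ y t = (0, 0).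

(* minimum time function T (value +oo if the origin cannot be reached) *)
Definition minT {R : realType} {M : nat} (F : R * R -> R * R)
  (G : 'I_M -> R * R -> R * R) (x0 : R * R) : \bar R :=
  ereal_inf [set (t%:E)%E | t in [set t | exists u y, @steers R M F G x0 t u y]].

Definition reach {R : realType} {M : nat} F G (t : R) : set (R * R) :=
  [set x | (@minT R M F G x <= t%:E)%E].

Definition optimal {R : realType} {M : nat} F G (x0 : R * R)
  (u : R -> 'I_M -> R) (y : R -> R * R) : Prop :=
  (@minT R M F G x0 < +oo)%E /\ steers F G x0 (fine (minT F G x0)) u y.

Definition bang_bang {R : realType} {M : nat} (u : R -> 'I_M -> R) (t : R) : Prop :=
  exists (ts : seq R) (sg : nat -> 'I_M -> R),
    [/\ (2 <= size ts)%N /\ sorted <%R ts, head 0 ts = 0, last 0 ts = t,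
        (forall j i, `|sg j i| = 1) &
        forall j, (j.+1 < size ts)%N -> forall s, nth 0 ts j < s < nth 0 ts j.+1 ->
           forall i, u s i = sg j i].

Definition strictly_convex {R : realType} (K : set (R * R)) : Prop :=
  forall x y l, K x -> K y -> x <> y -> 0 < l < 1 -> einterior K (vcomb l x y).

Definition ham {R : realType} {M : nat} (F : R * R -> R * R)
  (G : 'I_M -> R * R -> R * R) (x p : R * R) : R :=
  dot p (F x) - \sum_(i < M) `|dot p (G i x)|.

Definition prox_normal {R : realType} (K : set (R * R)) (x v : R * R) : Prop :=
  exists sigma : R, 0 <= sigma /\
    forall y, K y -> dot v (vsub y x) <= sigma * (edist y x) ^+ 2.

Definition prop_a {R : realType} {M : nat} F G (tau : R) : Prop :=
  strictly_convex (@reach R M F G tau) /\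
  forall x, eboundary (reach F G tau) x ->
    exists u, (exists y, optimal F G x u y) /\ bang_bang u (fine (minT F G x)) /\
      forall v, (exists y, optimal F G x v y) ->
        {ae @lebesgue_measure R, forall s, 0 <= s <= fine (minT F G x) -> u s = v s}.

Definition optimal_point {R : realType} {M : nat} F G (x : R * R) : Prop :=
  exists z u y t, @optimal R M F G z u y /\ 0 < t <= fine (minT F G z) /\ y t = x.

Definition prop_b {R : realType} {M : nat} F G (tau : R) : Prop :=
  forall x, reach F G tau x -> @optimal_point R M F G x.

Definition epi {R : realType} {M : nat} F G : set ((R * R) * R) :=
  [set a | (@minT R M F G a.1 <= a.2%:E)%E].

Definition locally_positive_reach {R : realType} (A : set ((R * R) * R)) : Prop :=
  forall a, A a -> exists r : R, 0 < r /\
    forall p, edist3 p a < r ->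
      exists! q, A q /\ forall q', A q' -> edist3 p q <= edist3 p q'.

Definition prop_c {R : realType} {M : nat} F G : Prop :=
  locally_positive_reach (@epi R M F G).

Definition ediam {R : realType} (A : set (R * R)) : \bar R :=
  ereal_sup ([set 0%E] `|` [set e | exists x y, A x /\ A y /\ e = (edist x y)%:E]).

Definition H1delta {R : realType} (d : R) (A : set (R * R)) : \bar R :=
  ereal_inf [set s | exists C : nat -> set (R * R),
     A `<=` \bigcup_n C n /\ (forall n, (ediam (C n) <= d%:E)%E) /\
     s = (\sum_(0 <= n <oo) ediam (C n))%E].

Definition H1 {R : realType} (A : set (R * R)) : \bar R :=
  ereal_sup [set H1delta d A | d in [set d : R | 0 < d]].

Definition countably_H1_rectifiable {R : realType} (A : set (R * R)) : Prop :=
  exists (N : set (R * R)) (f : nat -> R -> R * R),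
    H1 N = 0%E /\
    (forall n, exists K : R, forall s t, edist (f n s) (f n t) <= K * `|s - t|) /\
    A `<=` N `|` \bigcup_n range (f n).

(* Main.v *)
Require Import Defs.
From HB Require Import structures.
From mathcomp Require Import all_boot all_order all_algebra.
From mathcomp Require Import all_classical all_reals all_analysis.
From mathcomp Require Import measurable_realfun ring lra.
Import Order.TTheory GRing.Theory Num.Theory.
Import numFieldNormedType.Exports.
Local Open Scope classical_set_scope.
Local Open Scope ring_scope.

(* A point [x <> 0] of [S] carries an abnormal covector [p], and its optimal trajectory is
   bang-bang.  Vanishing of the Hamiltonian makes [p] orthogonal to the current velocity, so
   [p] is, up to sign, the rotated velocity; Liouville's formula shows that the rotated
   velocity stays normal to the shrinking sublevel sets.  Hence the whole trajectory lies in
   [S]: [S] is a union of abnormal arcs issued (in reversed time) from the origin.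

   Two such arcs leaving the origin with the same control coincide as long as both exist: at
   a branching point they are graphs over their common tangent line whose slopes are ordered
   both ways by abnormality, and the time-to-go then fixes the parametrisation.  There are
   finitely many initial controls, so [S] is covered by countably many Lipschitz arcs, and
   near a point [x <> 0] it contains a nontrivial arc, which has positive measure.

   If [0] lies in [S], all [G_i(0)] are parallel.  The bang-bang trajectory whose signs [v_i]
   add up these vectors is then abnormal for small times: measuring how far a competing
   control is from [v] by [U = int sum_i (1 - v_i u_i)], the pairing of its deviation with the
   rotated velocity plus a multiple of [U^2] is a Lyapunov function, the rank condition
   giving the sign of the linear term.  So [S] also contains an arc issued from [0]. *)

(** All estimates concern increments with an error [C * (s' - s) ^+ 2]. Such errors disappear under
    subdivision, so the Gronwall, Picard and Liouville arguments never differentiate a trajectory,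
    and a switching is merely a time where two such estimates meet. Two obstacles shape the rest.
    Liouville's formula yields a normal only up to an error quadratic in the distance to the base
    point; strict convexity of the sublevel sets absorbs it, because shrinking a chord towards its
    base point makes the quadratic term negligible. Secondly, orthogonality to the velocity fixes
    the covector only up to a sign [ep], which might jump at a switching. Pairing with a point
    interior to a sublevel set stays away from zero, so the sign is constant near each time of a
    piece, and the exclusion of cusps shows that it is the same on both sides of a switching. Only
    then do two continuations of an arc leave in the same direction, as needed to compare them as
    graphs over one tangent line. *)

Definition n1 {R : realType} (p : R * R) : R := `|p.1| + `|p.2|.
Definition cross {R : realType} (p q : R * R) : R := p.1 * q.2 - p.2 * q.1.

(** * The l1 norm [n1], for which coordinatewise bounds simply add up, and its comparison with the
    Euclidean norm *)

Section PlaneVectors.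
Context {R : realType}.
Implicit Types (p q x y : R * R) (a b s : R).

Lemma vecP p q : p.1 = q.1 -> p.2 = q.2 -> p = q.
Proof. by case: p q => ? ? [? ?] /= -> ->. Qed.

Lemma n1_ge0 p : 0 <= n1 p. Proof. by rewrite addr_ge0. Qed.

Lemma n10 : n1 (0 : R * R) = 0. Proof. by rewrite /n1 /= normr0 addr0. Qed.

Lemma n1_eq0 p : n1 p <= 0 -> p = 0.
Proof.
case: p => u v; rewrite /n1 /= => h; have hu := normr_ge0 u; have hv := normr_ge0 v.
by congr pair; apply/normr0_eq0; lra.
Qed.

Lemma n1D p q : n1 (p + q) <= n1 p + n1 q.
Proof. have := ler_normD p.1 q.1; have := ler_normD p.2 q.2; rewrite /n1 /=; lra. Qed.

Lemma n1N p : n1 (- p) = n1 p.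
Proof. by rewrite /n1 /= !normrN. Qed.

Lemma n1B p q : n1 (p - q) <= n1 p + n1 q.
Proof. by rewrite (le_trans (n1D _ _)) ?n1N. Qed.

Lemma n1C p q : n1 (p - q) = n1 (q - p).
Proof. by rewrite -opprB n1N. Qed.

Lemma n1_tri p q x : n1 (p - x) <= n1 (p - q) + n1 (q - x).
Proof. by rewrite -[p - x](subrKA q) n1D. Qed.

Lemma n1Z a p : n1 (a *: p) = `|a| * n1 p.
Proof. by rewrite /n1 /= /GRing.scale /= !normrM mulrDr. Qed.

Lemma fst_n1 p : `|p.1| <= n1 p. Proof. by rewrite lerDl. Qed.
Lemma snd_n1 p : `|p.2| <= n1 p. Proof. by rewrite lerDr. Qed.

Lemma n1_dot p q : `|dot p q| <= n1 p * n1 q.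
Proof.
apply: (le_trans (ler_normD _ _)); rewrite !normrM /n1.
have := mulr_ge0 (normr_ge0 p.1) (normr_ge0 q.2).
have := mulr_ge0 (normr_ge0 p.2) (normr_ge0 q.1).
nra.
Qed.

Lemma n1_cross p q : `|cross p q| <= n1 p * n1 q.
Proof.
apply: (le_trans (ler_normB _ _)); rewrite !normrM /n1.
have := mulr_ge0 (normr_ge0 p.1) (normr_ge0 q.1).
have := mulr_ge0 (normr_ge0 p.2) (normr_ge0 q.2).
nra.
Qed.

Lemma dotDr p q x : dot p (q + x) = dot p q + dot p x.
Proof. by rewrite /dot /=; ring. Qed.
Lemma dotBr p q x : dot p (q - x) = dot p q - dot p x.
Proof. by rewrite /dot /=; ring. Qed.
Lemma dotZr a p q : dot p (a *: q) = a * dot p q.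
Proof. by rewrite /dot /= /GRing.scale /=; ring. Qed.
Lemma dotDl p q x : dot (p + q) x = dot p x + dot q x.
Proof. by rewrite /dot /=; ring. Qed.
Lemma dotZl a p q : dot (a *: p) q = a * dot p q.
Proof. by rewrite /dot /= /GRing.scale /=; ring. Qed.
Lemma dotC p q : dot p q = dot q p.
Proof. by rewrite /dot mulrC (mulrC p.2). Qed.

Lemma dot_ge0 p : 0 <= dot p p.
Proof. by rewrite addr_ge0 // -expr2 sqr_ge0. Qed.

Lemma enorm_ge0 p : 0 <= enorm p. Proof. exact: sqrtr_ge0. Qed.

Lemma enorm_le_n1 p : enorm p <= n1 p.
Proof.
rewrite /enorm -[n1 p]ger0_norm ?n1_ge0 // -sqrtr_sqr ler_wsqrtr //.
rewrite /dot /n1 -!expr2 -(real_normK (num_real p.1)) -(real_normK (num_real p.2)).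
have := mulr_ge0 (normr_ge0 p.1) (normr_ge0 p.2); nra.
Qed.

Lemma n1_le_enorm p : n1 p <= 2 * enorm p.
Proof.
have h u v : `|u| <= Num.sqrt (u ^+ 2 + v ^+ 2) :> R.
  by rewrite -sqrtr_sqr ler_wsqrtr // lerDl sqr_ge0.
have := h p.1 p.2; have := h p.2 p.1; rewrite addrC /enorm /dot -!expr2 /n1; lra.
Qed.

Lemma edistE x y : Defs.edist x y = enorm (x - y). Proof. by []. Qed.

Lemma enorm_eq0 p : enorm p = 0 -> p = 0.
Proof. by move=> h; apply: n1_eq0; rewrite (le_trans (n1_le_enorm p)) // h mulr0. Qed.

Lemma enormZ a p : enorm (a *: p) = `|a| * enorm p.
Proof.
by rewrite /enorm dotZl dotZr mulrA -expr2 sqrtrM ?sqr_ge0 // sqrtr_sqr.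
Qed.

Lemma unit_enorm p : p != 0 -> enorm ((enorm p)^-1 *: p) = 1.
Proof.
move=> p0; have h : enorm p != 0 by apply: contra_neq p0; apply: enorm_eq0.
by rewrite enormZ ger0_norm ?invr_ge0 ?enorm_ge0 // mulVf.
Qed.

End PlaneVectors.

(** * Calculus without derivatives: increments with quadratic error *)

Section QuadraticIncrements.
Context {R : realType}.
Implicit Types (f : R -> R) (a b h C E K : R).

Lemma natr_big (x : R) : exists n, x < n%:R.
Proof.
exists (Num.bound `|x|); apply: (le_lt_trans (ler_norm x)); exact: archi_boundP.
Qed.

(** Replaces passages to the limit throughout: a bound along dyadic scales is enough, by the
    archimedean property. *)
Lemma le_of_le_pow2 (x y : R) :
  (forall n, x <= y / 2 ^+ n) -> x <= 0.
Proof.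
move=> h; rewrite leNgt; apply/negP => x0.
have [n hn] := natr_big (y / x).
have h2 : y / x < 2 ^+ n.
  by rewrite (lt_le_trans hn) // -natrX ler_nat ltnW // ltn_expl.
have p2 : 0 < 2 ^+ n :> R by rewrite exprn_gt0.
have := h n; rewrite ler_pdivlMr //; rewrite ltr_pdivrMr // in h2; nra.
Qed.

(* Halving the interval halves the total quadratic error. *)
Lemma incr_quad f a b C : a <= b ->
  (forall s s' : R, a <= s -> s <= s' -> s' <= b -> f s' - f s <= C * (s' - s) ^+ 2) ->
  f b <= f a.
Proof.
move=> ab H; suff h n s s' : a <= s -> s <= s' -> s' <= b ->
    f s' - f s <= C * (s' - s) ^+ 2 / 2 ^+ n.
  rewrite -subr_le0; apply: (@le_of_le_pow2 _ (C * (b - a) ^+ 2)) => n.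
  by apply: h.
elim: n s s' => [|n IH] s s' h1 h2 h3; first by rewrite expr0 divr1; apply: H.
pose m := (s + s') / 2.
have sm : s <= m by rewrite /m; lra.
have ms : m <= s' by rewrite /m; lra.
have i1 := IH s m h1 sm (le_trans ms h3); have i2 := IH m s' (le_trans h1 sm) ms h3.
have -> : C * (s' - s) ^+ 2 / 2 ^+ n.+1 =
  C * (m - s) ^+ 2 / 2 ^+ n + C * (s' - m) ^+ 2 / 2 ^+ n.
  by rewrite /m [2 ^+ n.+1]exprS; field; rewrite expf_neq0.
lra.
Qed.

(** No exponential is involved: since [K * h <= 2^-1], replacing an upper bound [S] by
    [f 0 + (K * S + E) * h] halves its excess over [2 * (f 0 + E * h)]. Iterating from any bound
    gives the claim. *)
Lemma gronwall_quad f h K E C : 0 <= h -> 0 <= K -> 0 <= E -> K * h <= 2^-1 ->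
  (forall s : R, 0 <= s <= h -> 0 <= f s) ->
  (forall s s' : R, 0 <= s -> s <= s' -> s' <= h ->
     f s' - f s <= K * f s * (s' - s) + E * (s' - s) + C * (s' - s) ^+ 2) ->
  forall s : R, 0 <= s <= h -> f s <= 2 * (f 0 + E * h).
Proof.
move=> h0 K0 E0 Kh f0 H.
(* The iteration needs some bound to start from; a single increment from time 0 provides it. *)
pose B := `|K * f 0 * h| + E * h + `|C| * h ^+ 2 + f 0.
have Bf s : 0 <= s <= h -> f s <= B.
  move=> /andP[s0 sh]; have := H 0 s (lexx _) s0 sh; rewrite subr0 => {}H.
  have f00 : 0 <= f 0 by apply: f0; rewrite lexx.
  have : K * f 0 * s <= `|K * f 0 * h|.
    by rewrite (le_trans _ (ler_norm _)) // ler_wpM2l // mulr_ge0.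
  have : E * s <= E * h by apply: ler_wpM2l.
  have : C * s ^+ 2 <= `|C| * h ^+ 2.
    rewrite (le_trans (ler_norm _)) // normrM ler_wpM2l // ger0_norm ?sqr_ge0 //.
    by rewrite lerXn2r // nnegrE.
  rewrite /B; lra.
have step S : 0 <= S -> (forall s : R, 0 <= s <= h -> f s <= S) ->
    forall s : R, 0 <= s <= h -> f s <= f 0 + (K * S + E) * h.
  move=> S0 fS s /andP[s0 sh].
  have : f s - (K * S + E) * s <= f 0 - (K * S + E) * 0.
    apply: (@incr_quad (fun s => f s - (K * S + E) * s) _ _ C) => // a b a0 ab bs.
    have := H a b a0 ab (le_trans bs sh).
    have : K * f a * (b - a) <= K * S * (b - a).
      by rewrite ler_wpM2r ?subr_ge0 // ler_wpM2l // fS // a0 (le_trans ab) // (le_trans bs).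
    nra.
  have : (K * S + E) * s <= (K * S + E) * h by rewrite ler_wpM2l // addr_ge0 // mulr_ge0.
  lra.
have f00 : 0 <= f 0 by apply: f0; rewrite lexx.
have Bge : 0 <= B by rewrite (le_trans f00) // Bf // lexx.
have it n s : 0 <= s <= h -> f s <= 2 * (f 0 + E * h) + B / 2 ^+ n.
  elim: n s => [|n IH] s hs.
    rewrite expr0 divr1 (le_trans (Bf _ hs)) // lerDr mulr_ge0 // addr_ge0 // mulr_ge0 //.
  have Bn : 0 <= B / 2 ^+ n by rewrite divr_ge0 // exprn_ge0.
  have Eh : 0 <= E * h by rewrite mulr_ge0.
  have S0 : 0 <= 2 * (f 0 + E * h) + B / 2 ^+ n by lra.
  have := step _ S0 IH s hs.
  have -> : B / 2 ^+ n.+1 = (B / 2 ^+ n) / 2.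
    by rewrite [2 ^+ n.+1]exprS; field; rewrite expf_neq0.
  set S := (_ + _ / _) in S0 *.
  have : K * h * S <= 2^-1 * S by rewrite ler_wpM2r.
  rewrite /S; nra.
move=> s hs; rewrite -subr_le0; apply: (@le_of_le_pow2 _ B) => n.
by have := it n s hs; lra.
Qed.

End QuadraticIncrements.

(* A pair of row vectors stands for a 2x2 matrix. *)
Definition ap {R : realType} (m : (R * R) * (R * R)) (d : R * R) : R * R :=
  (dot m.1 d, dot m.2 d).

(* [A] is the derivative of [V]; all bounds on the [n1]-ball of radius [r] share
   the constant [K]. *)
Definition nice {R : realType} (V : R * R -> R * R)
    (A : R * R -> (R * R) * (R * R)) (r K : R) : Prop :=
  forall x, n1 x <= r ->
    [/\ n1 (V x) <= K, n1 (A x).1 + n1 (A x).2 <= K &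
     forall y, n1 y <= r -> n1 (V y - V x) <= K * n1 (y - x) /\
       n1 (V y - V x - ap (A x) (y - x)) <= K * n1 (y - x) ^+ 2].

(** * Taylor and Lipschitz bounds for fields of class C^{1,1} on balls *)

Section Fields.
Context {R : realType}.
Implicit Types (f : R * R -> R) (V W : R * R -> R * R) (x y d : R * R).

(** The derivative of a determinant under a linear flow: this is how the trace, hence the
    divergence, enters Liouville's formula. *)
Lemma cross_ap m v d :
  cross (ap m v) d + cross v (ap m d) = (m.1.1 + m.2.2) * cross v d :> R.
Proof. by rewrite /cross /ap /dot /=; ring. Qed.

Lemma mvt_any (g : R -> R) a b : (forall t : R, derivable g t 1) ->
  exists2 c, `|c - a| <= `|b - a| & g b - g a = derive1 g c * (b - a).
Proof.
move=> dg; have cg : continuous g.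
  by move=> t; apply: differentiable_continuous; apply/derivable1_diffP.
have dg' (t : R) : is_derive t (1 : R) g (derive1 g t) by rewrite derive1E; apply/derivableP.
have [ab|ba] := leP a b.
  have [c] := @MVT_segment R g (derive1 g) a b ab (fun t _ => dg' t) (continuous_subspaceT cg).
  rewrite in_itv /= => /andP[ac cb] e; exists c => //.
  by rewrite !ger0_norm ?subr_ge0 // lerD2r.
have [c] := @MVT_segment R g (derive1 g) b a (ltW ba) (fun t _ => dg' t) (continuous_subspaceT cg).
rewrite in_itv /= => /andP[bc ca] e; exists c.
  by rewrite !ler0_norm ?subr_le0 // ?(ltW ba) //; lra.
by rewrite -opprB e -mulrN opprB.
Qed.

Lemma edist_n1 x y : Defs.edist x y <= n1 (x - y).
Proof. by rewrite edistE enorm_le_n1. Qed.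

(** Only partial derivatives are given, so the segment from [x] to [y] is replaced by the two sides
    of the corner [(x.1, y.2)]. The mean value theorem on each side produces a point within
    [n1 (y - x)] of [x]. The constant is [|L|] because [L] carries no sign. *)
Lemma C11_taylor L f x y : C11 L f ->
  `|f y - f x - dot (partial1 f x, partial2 f x) (y - x)| <= `|L| * n1 (y - x) ^+ 2.
Proof.
move=> [df [l1 l2]].
have [c1 h1 e1] := @mvt_any (fun t => f (t, y.2)) x.1 y.1
  (fun t => (df (t, y.2)).1).
have [c2 h2 e2] := @mvt_any (fun t => f (x.1, t)) x.2 y.2
  (fun t => (df (x.1, t)).2).
have lip g : lipschitzL L g -> forall p, n1 (p - x) <= n1 (y - x) ->
    `|g p - g x| <= `|L| * n1 (y - x).
  move=> lg p hp; apply: (le_trans (lg _ _)).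
  apply: (@le_trans _ _ (`|L| * Defs.edist p x)).
    by rewrite ler_wpM2r ?enorm_ge0 // ler_norm.
  by rewrite ler_wpM2l // (le_trans (edist_n1 _ _)).
have k1 := lip _ l1 (c1, y.2) (lerD h1 (lexx _)).
have k2 : `|partial2 f (x.1, c2) - partial2 f x| <= `|L| * n1 (y - x).
  by apply: lip => //; rewrite /n1 /= subrr normr0 lerD.
have -> : f y - f x - dot (partial1 f x, partial2 f x) (y - x) =
  (partial1 f (c1, y.2) - partial1 f x) * (y.1 - x.1) +
  (partial2 f (x.1, c2) - partial2 f x) * (y.2 - x.2).
  rewrite /dot /= !mulrBl [partial1 f (c1, _) * _]mulrBr in e1 e2 *.
  have -> : f y - f x = (f (y.1, y.2) - f (x.1, y.2)) + (f (x.1, y.2) - f (x.1, x.2)).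
    by rewrite addrA subrK -!surjective_pairing.
  rewrite e1 e2 /partial1 /partial2 /=; ring.
apply: (le_trans (ler_normD _ _)); rewrite !normrM expr2.
have -> : `|L| * (n1 (y - x) * n1 (y - x)) =
  `|L| * n1 (y - x) * `|y.1 - x.1| + `|L| * n1 (y - x) * `|y.2 - x.2|.
  by rewrite [n1 (y - x) in X in _ * (_ * X)]/n1 /=; ring.
by apply: lerD; rewrite ler_wpM2r.
Qed.

Definition grad V x : (R * R) * (R * R) :=
  ((partial1 (fun y => (V y).1) x, partial2 (fun y => (V y).1) x),
   (partial1 (fun y => (V y).2) x, partial2 (fun y => (V y).2) x)).

Lemma n1_ap m d : n1 (ap m d) <= (n1 m.1 + n1 m.2) * n1 d :> R.
Proof. by rewrite mulrDl /ap {1}/n1 /= lerD // n1_dot. Qed.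

Lemma C11_nice L V r : 0 <= r -> C11_vec L V -> exists2 K, 0 <= K & nice V (grad V) r K.
Proof.
move=> r0 hV; have h1 : C11 L (fun y => (V y).1) := hV ord0.
have h2 : C11 L (fun y => (V y).2) := hV ord_max.
pose L' := `|L| + `|L|.
have L0 : 0 <= L' by rewrite addr_ge0.
have T x y : n1 (V y - V x - ap (grad V x) (y - x)) <= L' * n1 (y - x) ^+ 2.
  rewrite mulrDl; apply: lerD; [exact: (C11_taylor L _ x y h1)|exact: (C11_taylor L _ x y h2)].
pose A0 := n1 (grad V 0).1 + n1 (grad V 0).2.
have Alip f x : lipschitzL L f -> n1 x <= r -> `|f x| <= `|f 0| + `|L| * r.
  move=> lf hx; have := lf x 0; have := ler_normD (f 0) (f x - f 0).
  rewrite [_ + (_ - _)]addrC subrK => h1' h2'.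
  suff : L * Defs.edist x 0 <= `|L| * r by lra.
  apply: (@le_trans _ _ (`|L| * Defs.edist x 0)).
    by rewrite ler_wpM2r ?enorm_ge0 // ler_norm.
  by rewrite ler_wpM2l // (le_trans (edist_n1 _ _)) // subr0.
pose B := A0 + 4 * (`|L| * r).
have AB x : n1 x <= r -> n1 (grad V x).1 + n1 (grad V x).2 <= B.
  move=> hx; have [_ [a b]] := h1; have [_ [c d]] := h2.
  have := Alip _ _ a hx; have := Alip _ _ b hx; have := Alip _ _ c hx; have := Alip _ _ d hx.
  by rewrite /B /A0 /grad /n1 /=; clear; lra.
have B0 : 0 <= B by rewrite addr_ge0 ?addr_ge0 ?n1_ge0 // mulr_ge0 // mulr_ge0.
pose K1 := B + L' * (2 * r).
have K10 : 0 <= K1 by rewrite addr_ge0 // mulr_ge0 // mulr_ge0.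
have Lip x y : n1 x <= r -> n1 y <= r -> n1 (V y - V x) <= K1 * n1 (y - x).
  move=> hx hy; have := n1D (V y - V x - ap (grad V x) (y - x)) (ap (grad V x) (y - x)).
  rewrite subrK => h; apply: (le_trans h); have := T x y.
  have := n1_ap (grad V x) (y - x); have := AB x hx.
  have := n1B y x; have := n1_ge0 (y - x).
  move: (n1 (y - x)) (n1 (ap _ _)) => t a t0 t1 hB ha hT.
  have : (n1 (grad V x).1 + n1 (grad V x).2) * t <= B * t by rewrite ler_wpM2r.
  have : L' * t ^+ 2 <= L' * (2 * r) * t.
    by rewrite expr2 mulrA ler_wpM2r // ler_wpM2l //; lra.
  rewrite /K1; lra.
pose K := n1 (V 0) + K1 * r + B + K1 + L'.
have V0 := n1_ge0 (V 0).
have K1r : 0 <= K1 * r by rewrite mulr_ge0.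
exists K; first by rewrite /K; lra.
move=> x hx; split.
- have := Lip 0 x; rewrite n10 subr0 => /(_ r0 hx) h.
  have := n1D (V x - V 0) (V 0); rewrite subrK => h'.
  have : K1 * n1 x <= K1 * r by rewrite ler_wpM2l.
  by rewrite /K; lra.
- by rewrite (le_trans (AB x hx)) // /K; lra.
- move=> y hy; split.
    by rewrite (le_trans (Lip x y hx hy)) // ler_wpM2r ?n1_ge0 // /K; lra.
  by rewrite (le_trans (T x y)) // ler_wpM2r ?sqr_ge0 // /K; lra.
Qed.

Lemma nice_le V A r K K' : K <= K' -> nice V A r K -> nice V A r K'.
Proof.
move=> h n x hx; have [a b c] := n x hx; split; try by apply: le_trans h.
move=> y hy; have [d e] := c y hy; split.
  by rewrite (le_trans d) // ler_wpM2r ?n1_ge0.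
by rewrite (le_trans e) // ler_wpM2r ?sqr_ge0.
Qed.

Lemma niceD V W A B r K K' : nice V A r K -> nice W B r K' ->
  nice (fun x => V x + W x) (fun x => A x + B x) r (K + K').
Proof.
move=> nV nW x hx; have [a b c] := nV x hx; have [a' b' c'] := nW x hx; split.
- by rewrite (le_trans (n1D _ _)) // lerD.
- have := n1D (A x).1 (B x).1; have := n1D (A x).2 (B x).2; rewrite /=; lra.
- move=> y hy; have [d e] := c y hy; have [d' e'] := c' y hy; split.
    rewrite mulrDl (_ : _ - _ = (V y - V x) + (W y - W x)); last by rewrite addrACA -opprD.
    by rewrite (le_trans (n1D _ _)) // lerD.
  rewrite mulrDl (_ : _ - _ = (V y - V x - ap (A x) (y - x)) + (W y - W x - ap (B x) (y - x))).
    by rewrite (le_trans (n1D _ _)) // lerD.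
  apply: vecP; rewrite /= /ap !dotDl /=; ring.
Qed.

Lemma niceZ V A r K a : nice V A r K ->
  nice (fun x => a *: V x) (fun x => a *: A x) r (`|a| * K).
Proof.
move=> nV x hx; have [h b c] := nV x hx; split.
- by rewrite n1Z ler_wpM2l.
- by rewrite /= !n1Z -mulrDr ler_wpM2l.
- move=> y hy; have [d e] := c y hy; split.
    by rewrite -scalerBr n1Z -mulrA ler_wpM2l.
  rewrite (_ : _ - _ = a *: (V y - V x - ap (A x) (y - x))); first by rewrite n1Z -mulrA ler_wpM2l.
  apply: vecP; rewrite /= /ap !dotZl /= /GRing.scale /=; ring.
Qed.

End Fields.

(** * Primitives and their increments *)

Definition primit {R : realType} (f : R -> R) (s : R) : R :=
  \int[@lebesgue_measure R]_(x in `[0, s]%classic) f x.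

Section Primitives.
Context {R : realType}.
Notation mu := (@lebesgue_measure R).
Implicit Types (f g : R -> R) (a b h v e K : R).

Lemma within_epsP f a b :
  {within `[a, b]%classic, continuous f} <->
  forall x : R, a <= x <= b -> forall e : R, 0 < e -> exists2 d : R, 0 < d &
    forall y : R, a <= y <= b -> `|y - x| < d -> `|f y - f x| < e.
Proof.
split.
- move=> /subspace_continuousP cf x xab e e0.
  have /cvgrPdist_lt /(_ e e0) := cf x xab.
  move=> -[d /= d0 H]; exists d => // y yab yx.
  by rewrite distrC; apply: H => //=; rewrite distrC.
- move=> H; apply/subspace_continuousP => x xab; apply/cvgrPdist_lt => e e0.
  have [d d0 Hd] := H x xab e e0; exists d => //= y yx yab.
  by rewrite distrC; apply: Hd => //; rewrite distrC.
Qed.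

Lemma lip_within f a b K :
  (forall s s' : R, a <= s <= b -> a <= s' <= b -> `|f s' - f s| <= K * `|s' - s|) ->
  {within `[a, b]%classic, continuous f}.
Proof.
move=> H; apply/within_epsP => x xab e e0; have K0 : 0 < `|K| + 1 by rewrite ltr_wpDl.
exists (e / (`|K| + 1)); first by rewrite divr_gt0.
move=> y yab; rewrite ltr_pdivlMr // => yx; apply: le_lt_trans (H x y xab yab) _.
apply: le_lt_trans yx; rewrite [X in _ <= X]mulrC ler_wpM2r //.
by rewrite (le_trans (ler_norm K)) // lerDl.
Qed.

Lemma integrable_cont f h : {within `[0, h]%classic, continuous f} ->
  mu.-integrable `[0, h]%classic (EFin \o f).
Proof. by move=> cf; apply: continuous_compact_integrable => //; exact: segment_compact. Qed.

Lemma integrable_sub f a b c d : c <= a -> b <= d ->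
  mu.-integrable `[c, d]%classic (EFin \o f) -> mu.-integrable `[a, b]%classic (EFin \o f).
Proof.
move=> ca bd; apply: integrableS => //= x /=; rewrite !in_itv /= => /andP[h1 h2].
by rewrite (le_trans ca) // (le_trans h2).
Qed.

Lemma integrable_oo f h a b : mu.-integrable `[0, h]%classic (EFin \o f) ->
  0 <= a -> b <= h -> mu.-integrable `]a, b[%classic (EFin \o f).
Proof.
move=> itf a0 bh; apply: integrableS itf => //= x /=; rewrite !in_itv /= => /andP[h1 h2].
by rewrite (le_trans a0 (ltW h1)) (le_trans (ltW h2)).
Qed.

Lemma primit_incr f h a b : mu.-integrable `[0, h]%classic (EFin \o f) ->
  0 <= a -> a <= b -> b <= h ->
  primit f b - primit f a = \int[mu]_(x in `]a, b[%classic) f x.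
Proof.
move=> itf a0 ab bh; rewrite /primit Rintegral_itvB //; last exact: integrable_sub itf.
by rewrite -Rintegral_itv_bndo_bndc //; exact: integrable_oo itf _ _.
Qed.

Lemma integrable_cst_oo a b v : mu.-integrable `]a, b[%classic (EFin \o (fun=> v)).
Proof.
have -> : EFin \o (fun=> v) = (cst v%:E : R -> \bar R) by [].
apply/integrableP; split; first exact: measurable_cst.
rewrite integral_cst //= lebesgue_measure_itv /=; case: ifP => _.
  by rewrite -EFinB -EFinM ltey.
by rewrite mule0.
Qed.

Lemma int_cst_oo a b v : a <= b -> \int[mu]_(x in `]a, b[%classic) v = v * (b - a).
Proof.
move=> ab; rewrite Rintegral_cst //= lebesgue_measure_itv /= lte_fin.
case: ltP => //= ba; have -> : a = b by apply/le_anti; rewrite ab.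
by rewrite subrr.
Qed.

(** The open interval matters: a bang-bang control is prescribed strictly between switching times
    and arbitrary at them. *)
Lemma primit_bound_oo f h a b v e : mu.-integrable `[0, h]%classic (EFin \o f) ->
  0 <= a -> a <= b -> b <= h -> (forall x : R, a < x < b -> `|f x - v| <= e) ->
  `|primit f b - primit f a - v * (b - a)| <= e * (b - a).
Proof.
move=> itf a0 ab bh H; rewrite (primit_incr _ h) // -!int_cst_oo //.
have i1 := integrable_oo _ _ _ _ itf a0 bh; have i2 := integrable_cst_oo a b v.
rewrite -RintegralB //.
have i3 : mu.-integrable `]a, b[%classic (EFin \o (fun x => f x - v)).
  by rewrite (_ : _ \o _ = (fun x => (EFin \o f) x - (EFin \o (fun=> v)) x)%E) //; apply: integrableB.
apply: le_trans (le_normr_Rintegral _ _) _ => //.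
apply: le_Rintegral => //.
- have := integrable_abse i3; by apply: eq_integrable => // x _ /=.
- exact: integrable_cst_oo.
Qed.

Lemma primit_bound f h a b v e : mu.-integrable `[0, h]%classic (EFin \o f) ->
  0 <= a -> a <= b -> b <= h -> (forall x : R, a <= x <= b -> `|f x - v| <= e) ->
  `|primit f b - primit f a - v * (b - a)| <= e * (b - a).
Proof.
move=> itf a0 ab bh H; apply: primit_bound_oo itf a0 ab bh _ => x /andP[h1 h2].
by apply: H; rewrite !ltW.
Qed.

Lemma primit0 f : primit f 0 = 0.
Proof. by rewrite /primit set_itv1 Rintegral_set1. Qed.

Lemma primitE f h s : mu.-integrable `[0, h]%classic (EFin \o f) -> 0 <= s <= h ->
  (\int[mu]_(x in `[0%R, s]%classic) (f x)%:E)%E = (primit f s)%:E.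
Proof.
move=> itf /andP[s0 sh]; rewrite /primit /Rintegral fineK //.
apply: integrable_fin_num => //; exact: integrable_sub itf.
Qed.

End Primitives.

(* The differential equation c' = V(c) on [a, b], in a form free of derivatives. *)
Definition follows {R : realType} (V : R * R -> R * R) (c : R -> R * R) (a b C : R) : Prop :=
  forall s s' : R, a <= s <= b -> a <= s' <= b ->
    n1 (c s' - c s - (s' - s) *: V (c s)) <= C * (s' - s) ^+ 2.

(** * Existence of solutions by Picard iteration *)

Section Picard.
Context {R : realType}.
Notation mu := (@lebesgue_measure R).

(** The intervals from [lo n] to [up n] are nested, and the supremum of their left ends lies in all
    of them. *)
Lemma geometric_limit (u : nat -> R) D : 0 <= D ->
  (forall n, `|u n.+1 - u n| <= D / 2 ^+ n) ->
  exists l, forall n, `|u n - l| <= 2 * D / 2 ^+ n.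
Proof.
move=> D0 H; pose lo n := u n - 2 * D / 2 ^+ n; pose up n := u n + 2 * D / 2 ^+ n.
have h2 n : 2 * D / 2 ^+ n.+1 = D / 2 ^+ n.
  by rewrite exprS; field; rewrite expf_neq0.
have P n : 0 <= D / 2 ^+ n by rewrite divr_ge0 // exprn_ge0.
have H' n := ler_normlW (H n).
have H'' n : u n - u n.+1 <= D / 2 ^+ n by have := H n; rewrite distrC => /ler_normlW.
have E n : 2 * D / 2 ^+ n = D / 2 ^+ n + D / 2 ^+ n by rewrite -mulrA; lra.
have l1 n m : lo n <= lo (n + m)%N.
  elim: m => [|m IH]; rewrite ?addn0 // addnS (le_trans IH) // /lo h2 E.
  by have := H'' (n + m)%N; lra.
have u1 n m : up (n + m)%N <= up n.
  elim: m => [|m IH]; rewrite ?addn0 // addnS (le_trans _ IH) // /up h2 E.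
  by have := H' (n + m)%N; lra.
have lu n m : lo n <= up m.
  rewrite (le_trans (l1 n m)) // (le_trans _ (u1 m n)) // addnC /lo /up E.
  by have := P (m + n)%N; lra.
have hs : has_sup (range lo).
  split; first by exists (lo 0%N), 0%N.
  by exists (up 0%N) => _ [n _ <-].
exists (sup (range lo)) => n; rewrite ler_norml.
have : lo n <= sup (range lo) by apply: sup_upper_bound => //; exists n.
have : sup (range lo) <= up n.
  by apply: ge_sup => [|_ [m _ <-]//]; exists (lo 0%N), 0%N.
rewrite /lo /up; lra.
Qed.

Variables (V : R * R -> R * R) (A : R * R -> (R * R) * (R * R)) (r K r0 h : R) (z : R * R).
Hypotheses (nV : nice V A r K) (K0 : 0 <= K) (h0 : 0 <= h) (hz : n1 z <= r0)
  (hr : r0 + 2 * K * h <= r) (hK : 4 * K * h <= 1).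

Let good (c : R -> R * R) := (forall s : R, 0 <= s <= h -> n1 (c s) <= r) /\
  (forall s s' : R, 0 <= s <= h -> 0 <= s' <= h -> n1 (c s' - c s) <= 2 * K * `|s' - s|).

Let step (c : R -> R * R) (s : R) : R * R :=
  z + (primit (fun x => (V (c x)).1) s, primit (fun x => (V (c x)).2) s).

Let good_int c : good c ->
  mu.-integrable `[0, h]%classic (EFin \o (fun x => (V (c x)).1)) /\
  mu.-integrable `[0, h]%classic (EFin \o (fun x => (V (c x)).2)).
Proof.
move=> [g1 g2].
have L s s' : 0 <= s <= h -> 0 <= s' <= h -> n1 (V (c s') - V (c s)) <= K * (2 * K) * `|s' - s|.
  move=> hs hs'; have [_ _ /(_ _ (g1 _ hs'))[l _]] := nV _ (g1 _ hs).
  by rewrite (le_trans l) // -mulrA ler_wpM2l // g2.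
split; apply/integrable_cont/(@lip_within _ _ _ _ (K * (2 * K))) => s s' hs hs';
  apply: le_trans (L _ _ hs hs').
  exact: (fst_n1 (V (c s') - V (c s))).
exact: (snd_n1 (V (c s') - V (c s))).
Qed.

Let step_bound c a b w e : good c -> 0 <= a -> a <= b -> b <= h ->
  (forall x : R, a <= x <= b -> n1 (V (c x) - w) <= e) ->
  n1 (step c b - step c a - (b - a) *: w) <= 2 * e * (b - a).
Proof.
move=> gc a0 ab bh H; have [i1 i2] := good_int _ gc.
have j1 := primit_bound _ _ _ _ w.1 e i1 a0 ab bh (fun x hx => le_trans (fst_n1 _) (H x hx)).
have j2 := primit_bound _ _ _ _ w.2 e i2 a0 ab bh (fun x hx => le_trans (snd_n1 _) (H x hx)).
have -> : step c b - step c a - (b - a) *: w =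
  (primit (fun x => (V (c x)).1) b - primit (fun x => (V (c x)).1) a - w.1 * (b - a),
   primit (fun x => (V (c x)).2) b - primit (fun x => (V (c x)).2) a - w.2 * (b - a)).
  by apply: vecP; rewrite /= /GRing.scale /=; ring.
rewrite /n1 /=; lra.
Qed.

Let step0 c : step c 0 = z.
Proof. by rewrite /step !primit0; apply: vecP; rewrite /= addr0. Qed.

Let good_step c : good c -> good (step c).
Proof.
move=> gc; have [g1 g2] := gc.
have B a b : 0 <= a -> a <= b -> b <= h -> n1 (step c b - step c a) <= 2 * K * (b - a).
  move=> a0 ab bh; have := step_bound _ a b 0 K gc a0 ab bh.
  rewrite scaler0 subr0; apply=> x /andP[ax xb]; rewrite subr0.
  by have [] := nV (c x) (g1 x _); rewrite ?(le_trans a0) // (le_trans xb).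
split=> [s /andP[s0 sh]|s s' /andP[s0 sh] /andP[s0' sh']].
  have := B 0 s (lexx _) s0 sh; rewrite step0 subr0 => {}B.
  have := n1D (step c s - z) z; rewrite subrK => D.
  have E : 2 * K * s <= 2 * K * h by rewrite ler_wpM2l // mulr_ge0.
  by rewrite (le_trans D) // (le_trans _ hr) // addrC lerD // (le_trans B).
have [ss|ss] := leP s s'; first by rewrite ger0_norm ?subr_ge0 // B.
by rewrite n1C distrC ger0_norm ?subr_ge0 ?(ltW ss) // B // ltW.
Qed.

Let contract c d D : good c -> good d -> 0 <= D ->
  (forall s : R, 0 <= s <= h -> n1 (c s - d s) <= D) ->
  forall s : R, 0 <= s <= h -> n1 (step c s - step d s) <= D / 2.
Proof.
move=> gc gd D0 H s /andP[s0 sh].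
have [i1 i2] := good_int _ gc; have [j1 j2] := good_int _ gd.
have B x : 0 <= x <= h -> n1 (V (c x) - V (d x)) <= K * D.
  move=> hx; have [_ _ /(_ _ (gc.1 _ hx))[l _]] := nV _ (gd.1 _ hx).
  by rewrite (le_trans l) // ler_wpM2l // H.
have P f g : mu.-integrable `[0, h]%classic (EFin \o f) ->
    mu.-integrable `[0, h]%classic (EFin \o g) ->
    (forall x : R, 0 <= x <= h -> `|f x - g x| <= K * D) ->
    `|primit f s - primit g s| <= K * D * s.
  move=> f1 g1 fg.
  have i : mu.-integrable `[0, h]%classic (EFin \o (fun x => f x - g x)).
    by rewrite (_ : _ \o _ = (fun x => (EFin \o f) x - (EFin \o g) x)%E) //; apply: integrableB.
  have -> : primit f s - primit g s = primit (fun x => f x - g x) s.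
    rewrite /primit RintegralB //; [exact: integrable_sub f1|exact: integrable_sub g1].
  have := primit_bound _ _ 0 s 0 (K * D) i (lexx _) s0 sh.
  rewrite primit0 mul0r !subr0; apply => x /andP[x0 xs]; rewrite subr0; apply: fg.
  by rewrite x0 (le_trans xs).
have := P _ _ i1 j1 (fun x hx => le_trans (fst_n1 _) (B x hx)).
have := P _ _ i2 j2 (fun x hx => le_trans (snd_n1 _) (B x hx)).
have -> : step c s - step d s =
  (primit (fun x => (V (c x)).1) s - primit (fun x => (V (d x)).1) s,
   primit (fun x => (V (c x)).2) s - primit (fun x => (V (d x)).2) s).
  by apply: vecP; rewrite /=; ring.
have [hK' [K0' h0']] := conj hK (conj K0 h0).
rewrite /n1 /= => h1 h2.
have : K * D * s <= K * D * h by rewrite ler_wpM2l // mulr_ge0.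
have : 4 * K * h * D <= 1 * D by rewrite ler_wpM2r.
nra.
Qed.

(** By [hr] the iterates are [2 * K]-Lipschitz curves inside the ball of radius [r], and by [hK] one
    integration halves their distance; the extra factor 2 pays for treating the coordinates
    separately. The limit is a fixed point of [step], and [step_bound] then gives the constant
    [4 * K ^+ 2]. *)
Lemma picard : exists c, [/\ c 0 = z, (forall s : R, 0 <= s <= h -> n1 (c s) <= r) &
  follows V c 0 h (4 * K ^+ 2)].
Proof.
have [hr' [hz' [K0' [h0' hK']]]] := conj hr (conj hz (conj K0 (conj h0 hK))).
have r00 : r0 <= r by have := mulr_ge0 (mulr_ge0 (ler0n R 2) K0) h0; lra.
pose c n := iter n step (fun=> z).
have gc n : good (c n).
  elim: n => [|n IH] /=; last exact: good_step.
  split=> [s _|s s' _ _]; first by rewrite (le_trans hz).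
  by rewrite subrr n10 mulr_ge0 // mulr_ge0.
pose D := 2 * r + 1.
have rz : 0 <= r by rewrite (le_trans _ r00) // (le_trans (n1_ge0 z)).
have D0 : 0 <= D by rewrite /D; lra.
have cD n s : 0 <= s <= h -> n1 (c n.+1 s - c n s) <= D / 2 ^+ n.
  elim: n s => [|n IH] s hs.
    rewrite expr0 divr1; have := n1B (c 1%N s) (c 0%N s).
    by have := (gc 1%N).1 s hs; have := (gc 0%N).1 s hs; rewrite /D; lra.
  have -> : D / 2 ^+ n.+1 = (D / 2 ^+ n) / 2 by rewrite exprS; field; rewrite expf_neq0.
  by apply: (contract (c n.+1) (c n)) => //; rewrite divr_ge0 // exprn_ge0.
have lim1 s : exists l, 0 <= s <= h -> forall n, `|(c n s).1 - l| <= 2 * D / 2 ^+ n.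
  have [hs|_] := boolP (0 <= s <= h); last by exists 0.
  have [l hl] := geometric_limit (fun n => (c n s).1) D D0
    (fun n => le_trans (fst_n1 _) (cD n s hs)); by exists l.
have lim2 s : exists l, 0 <= s <= h -> forall n, `|(c n s).2 - l| <= 2 * D / 2 ^+ n.
  have [hs|_] := boolP (0 <= s <= h); last by exists 0.
  have [l hl] := geometric_limit (fun n => (c n s).2) D D0
    (fun n => le_trans (snd_n1 _) (cD n s hs)); by exists l.
have [l1 L1] := choice lim1; have [l2 L2] := choice lim2.
pose g s := (l1 s, l2 s).
have G n s : 0 <= s <= h -> n1 (c n s - g s) <= 4 * D / 2 ^+ n.
  move=> hs; have := L1 s hs n; have := L2 s hs n; rewrite /n1 /=; lra.
have gg : good g.
  split=> [s hs|s s' hs hs'].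
    rewrite -subr_le0; apply: (@le_of_le_pow2 _ _ (4 * D)) => n.
    have := n1B (c n s) (c n s - g s); rewrite subKr => h1.
    have := G n s hs; have := (gc n).1 s hs; lra.
  rewrite -subr_le0; apply: (@le_of_le_pow2 _ _ (8 * D)) => n.
  have := n1_tri (g s') (c n s') (g s); have := n1_tri (c n s') (c n s) (g s).
  rewrite (n1C (g s') (c n s')); have := G n s hs; have := G n s' hs'; have := (gc n).2 _ _ hs hs'.
  lra.
have fix_ s : 0 <= s <= h -> step g s = g s.
  move=> hs; apply/eqP; rewrite -subr_eq0; apply/eqP/n1_eq0.
  apply: (@le_of_le_pow2 _ _ (6 * D)) => n.
  have := n1_tri (step g s) (c n.+1 s) (g s); have := G n.+1 s hs.
  have : n1 (step g s - c n.+1 s) <= (4 * D / 2 ^+ n) / 2.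
    apply: (contract g (c n)) => //; first by rewrite divr_ge0 ?exprn_ge0 // mulr_ge0.
    by move=> x hx; rewrite n1C G.
  have -> : 4 * D / 2 ^+ n.+1 = (4 * D / 2 ^+ n) / 2 by rewrite exprS; field; rewrite expf_neq0.
  have P : 0 <= D / 2 ^+ n by rewrite divr_ge0 // exprn_ge0.
  lra.
exists g; split; [by rewrite -fix_ ?lexx // step0|exact: gg.1|].
(* The velocity is frozen at an arbitrary point [x] of the interval, so that the case [s' < s] of
   [follows] is the same estimate with [x] at the right end. *)
have fw s s' x : 0 <= s <= h -> 0 <= s' <= h -> s <= s' -> s <= x <= s' -> 
    n1 (g s' - g s - (s' - s) *: V (g x)) <= 4 * K ^+ 2 * (s' - s) ^+ 2.
  move=> hs hs' ss /andP[sx xs].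
  have /andP[s0 sh] := hs; have /andP[s0' sh'] := hs'.
  have hx : 0 <= x <= h by rewrite (le_trans s0) // (le_trans xs).
  rewrite -(fix_ s) // -(fix_ s') //.
  have -> : 4 * K ^+ 2 * (s' - s) ^+ 2 = 2 * (K * (2 * K * (s' - s))) * (s' - s) by ring.
  apply: step_bound => // t /andP[st ts].
  have ht : 0 <= t <= h by rewrite (le_trans s0) // (le_trans ts).
  have [_ _ /(_ _ (gg.1 _ ht))[l _]] := nV _ (gg.1 _ hx).
  rewrite (le_trans l) // ler_wpM2l // (le_trans (gg.2 _ _ hx ht)) //.
  by rewrite ler_wpM2l ?mulr_ge0 // ler_norml; apply/andP; split; lra.
move=> s s' hs hs'; have [ss|ss] := leP s s'; first by apply: fw => //; rewrite lexx.
rewrite -n1N (_ : - _ = g s - g s' - (s - s') *: V (g s)); last first.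
  by apply: vecP; rewrite /= /GRing.scale /=; ring.
by rewrite -[(s' - s) ^+ 2]sqrrN opprB; apply: fw => //; rewrite ?(ltW ss) ?lexx.
Qed.

End Picard.

(** * The controlled field, with bounds uniform in the control value *)

Section ControlField.
Context {R : realType} {M : nat}.
Variables (F : R * R -> R * R) (G : 'I_M -> R * R -> R * R).

Definition fieldD (w : 'I_M -> R) (x : R * R) : (R * R) * (R * R) :=
  grad F x + \sum_(i < M) w i *: grad (G i) x.

Lemma fst_sum {I : Type} (s : seq I) (f : I -> R * R) :
  (\sum_(i <- s) f i).1 = \sum_(i <- s) (f i).1.
Proof. by elim: s => [|a s IH]; rewrite ?big_nil // !big_cons /= IH. Qed.

Lemma snd_sum {I : Type} (s : seq I) (f : I -> R * R) :
  (\sum_(i <- s) f i).2 = \sum_(i <- s) (f i).2.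
Proof. by elim: s => [|a s IH]; rewrite ?big_nil // !big_cons /= IH. Qed.

Lemma field_sum x w : Defs.field F G x w = F x + \sum_(i < M) w i *: G i x.
Proof. by apply: vecP; rewrite /= ?fst_sum ?snd_sum. Qed.

Lemma dot_field p x w :
  dot p (Defs.field F G x w) = dot p (F x) + \sum_(i < M) w i * dot p (G i x).
Proof.
rewrite field_sum dotDr; congr (_ + _).
rewrite (big_morph (dot p) (dotDr p) (_ : dot p 0 = 0)); last by rewrite /dot /= !mulr0 addr0.
by apply: eq_bigr => i _; rewrite dotZr.
Qed.

Lemma nice_sum (w : 'I_M -> R) (r : R) (K : 'I_M -> R) (s : seq 'I_M) :
  (forall i, `|w i| <= 1) -> (forall i, 0 <= K i) ->
  (forall i, nice (G i) (grad (G i)) r (K i)) ->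
  nice (fun x => \sum_(i <- s) w i *: G i x) (fun x => \sum_(i <- s) w i *: grad (G i) x) r
    (\sum_(i <- s) K i).
Proof.
move=> w1 K0 nG; elim: s => [|a s IH].
  rewrite big_nil => x hx; rewrite !big_nil; split; rewrite ?n10 ?addr0 //.
  move=> y hy; rewrite !big_nil !subr0 n10 !mul0r; split => //.
  by rewrite sub0r n1N (_ : ap 0 _ = 0) ?n10 //; apply: vecP; rewrite /ap /dot /= !mul0r addr0.
rewrite big_cons.
have -> : (fun x => \sum_(i <- a :: s) w i *: G i x) =
    (fun x => w a *: G a x + \sum_(i <- s) w i *: G i x) by apply/funext => x; rewrite big_cons.
have -> : (fun x => \sum_(i <- a :: s) w i *: grad (G i) x) =
    (fun x => w a *: grad (G a) x + \sum_(i <- s) w i *: grad (G i) x).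
  by apply/funext => x; rewrite big_cons.
apply: niceD IH; apply: nice_le (niceZ _ _ _ _ (w a) (nG a)).
by rewrite -[X in _ <= X]mul1r ler_wpM2r.
Qed.

(** [K] is chosen before [w]: all switching values and all competing controls then share the same
    admissible step lengths. *)
Lemma field_nice L r : 0 <= r -> C11_vec L F -> (forall i, C11_vec L (G i)) ->
  exists2 K : R, 0 <= K & forall w : 'I_M -> R, (forall i, `|w i| <= 1) ->
    nice (fun x => Defs.field F G x w) (fieldD w) r K.
Proof.
move=> r0 hF hG; have [KF KF0 nF] := C11_nice L F r r0 hF.
have /choice [KG hKG] : forall i, exists K : R, 0 <= K /\ nice (G i) (grad (G i)) r K.
  by move=> i; have [K K0 nK] := C11_nice L (G i) r r0 (hG i); exists K.
have KG0 i : 0 <= KG i by have [] := hKG i.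
have nG i : nice (G i) (grad (G i)) r (KG i) by have [] := hKG i.
exists (KF + \sum_(i < M) KG i); first by rewrite addr_ge0 // sumr_ge0.
move=> w w1; have -> : (fun x => Defs.field F G x w) = (fun x => F x + \sum_(i < M) w i *: G i x).
  by apply/funext => x; rewrite field_sum.
by apply: niceD nF _; apply: nice_sum.
Qed.

Lemma within_bounded (f : R -> R) (t : R) : {within `[0, t]%classic, continuous f} ->
  exists B : R, forall s : R, 0 <= s <= t -> `|f s| <= B.
Proof.
move=> cf; have [t0|t0] := leP 0 t; last first.
  by exists 0 => s /andP[s0 st]; move: (lt_le_trans t0 s0); rewrite ltNge st.
have cn : {within `[0, t]%classic, continuous (fun s => `|f s|)}.
  apply/within_epsP => x hx e e0; have [d d0 H] := (within_epsP f 0 t).1 cf x hx e e0.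
  by exists d => // y hy yx; rewrite (le_lt_trans (ler_dist_dist _ _)) // H.
have [c _ hc] := EVT_max t0 cn; exists `|f c| => s hs; apply: hc; rewrite in_itv /=.
exact: hs.
Qed.

Lemma path_bounded (y : R -> R * R) (t : R) :
  {within `[0, t]%classic, continuous (fun s => (y s).1)} ->
  {within `[0, t]%classic, continuous (fun s => (y s).2)} ->
  exists2 r : R, 0 <= r & forall s : R, 0 <= s <= t -> n1 (y s) <= r.
Proof.
move=> /within_bounded [B1 H1] /within_bounded [B2 H2].
exists (`|B1| + `|B2|); first by rewrite addr_ge0.
move=> s hs; rewrite /n1; have := H1 s hs; have := H2 s hs.
have := ler_norm B1; have := ler_norm B2; lra.
Qed.

Lemma comp_continuous (V : R * R -> R * R) A (y : R -> R * R) (t r K : R) :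
  nice V A r K -> (forall s : R, 0 <= s <= t -> n1 (y s) <= r) ->
  {within `[0, t]%classic, continuous (fun s => (y s).1)} ->
  {within `[0, t]%classic, continuous (fun s => (y s).2)} ->
  {within `[0, t]%classic, continuous (fun s => (V (y s)).1)} /\
  {within `[0, t]%classic, continuous (fun s => (V (y s)).2)}.
Proof.
move=> nV yr c1 c2.
have K0 : 0 < `|K| + 1 by rewrite ltr_wpDl.
have key (x : R) : 0 <= x <= t -> forall e : R, 0 < e -> exists2 d : R, 0 < d &
    forall z : R, 0 <= z <= t -> `|z - x| < d -> n1 (V (y z) - V (y x)) < e.
  move=> hx e e0; pose e' := e / (`|K| + 1) / 2.
  have e'0 : 0 < e' by rewrite !divr_gt0.
  have [d1 d10 h1] := (within_epsP _ 0 t).1 c1 x hx e' e'0.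
  have [d2 d20 h2] := (within_epsP _ 0 t).1 c2 x hx e' e'0.
  exists (Num.min d1 d2); first by rewrite lt_min d10.
  move=> z hz; rewrite lt_min => /andP[z1 z2].
  have [_ _ /(_ _ (yr _ hz))[l _]] := nV _ (yr _ hx).
  apply: le_lt_trans l _; apply: (@le_lt_trans _ _ ((`|K| + 1) * n1 (y z - y x))).
    by rewrite ler_wpM2r ?n1_ge0 // (le_trans (ler_norm K)) // lerDl.
  rewrite mulrC -ltr_pdivlMr //; have := h1 z hz z1; have := h2 z hz z2.
  by rewrite /n1 /e' /=; lra.
split; apply/within_epsP => x hx e e0; have [d d0 H] := key x hx e e0; exists d => // z hz zx.
  exact: le_lt_trans (fst_n1 (V (y z) - V (y x))) (H z hz zx).
exact: le_lt_trans (snd_n1 (V (y z) - V (y x))) (H z hz zx).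
Qed.

End ControlField.

(** * Trajectories and the minimum time function *)

Section Trajectories.
Context {R : realType} {M : nat}.
Variables (F : R * R -> R * R) (G : 'I_M -> R * R -> R * R) (L : R).
Hypotheses (hF : C11_vec L F) (hG : forall i, C11_vec L (G i)).
Notation mu := (@lebesgue_measure R).

Lemma integrable_bounded (f : R -> R) (t B : R) : measurable_fun `[0, t]%classic f ->
  (forall s : R, 0 <= s <= t -> `|f s| <= B) ->
  mu.-integrable `[0, t]%classic (EFin \o f).
Proof.
move=> mf fB; apply: measurable_bounded_integrable => //=.
- by rewrite lebesgue_measure_itv /=; case: ifP => // _; rewrite -EFinB ltey.
- exists B; split; first exact: num_real.
  by move=> z Bz s /= hs; rewrite (le_trans (fB s hs)) // ltW.
Qed.

Lemma integrable_ctrl (f : R -> R) (g : 'I_M -> R -> R) (u : R -> 'I_M -> R) (t : R) :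
  {within `[0, t]%classic, continuous f} ->
  (forall i, {within `[0, t]%classic, continuous (g i)}) ->
  admissible u t ->
  mu.-integrable `[0, t]%classic (EFin \o (fun s => f s + \sum_(i < M) u s i * g i s)).
Proof.
move=> cf cg adm.
have -> : EFin \o (fun s => f s + \sum_(i < M) u s i * g i s) =
  (fun s => (EFin \o f) s + \sum_(i < M) (EFin \o (fun s => u s i * g i s)%R) s)%E.
  by apply/funext => s /=; rewrite EFinD sumEFin.
apply: integrableD => //; first exact: integrable_cont.
apply: integrable_sum => // i _; have [mu_ ub] := adm i.
have [B hB] := within_bounded _ _ (cg i).
apply: (integrable_bounded _ _ B).
  apply: measurable_funM; first exact: mu_.
  by apply: subspace_continuous_measurable_fun; [exact: measurable_itv|exact: cg].
move=> s hs; rewrite normrM -[B]mul1r; apply: ler_pM => //; [exact: ub|exact: hB].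
Qed.

Lemma traj_integrable (u : R -> 'I_M -> R) (y : R -> R * R) (t : R) :
  admissible u t ->
  {within `[0, t]%classic, continuous (fun s => (y s).1)} ->
  {within `[0, t]%classic, continuous (fun s => (y s).2)} ->
  mu.-integrable `[0, t]%classic (EFin \o (fun s => (Defs.field F G (y s) (u s)).1)) /\
  mu.-integrable `[0, t]%classic (EFin \o (fun s => (Defs.field F G (y s) (u s)).2)).
Proof.
move=> adm c1 c2; have [r r0 yr] := path_bounded _ _ c1 c2.
have [KF _ nF] := C11_nice L F r r0 hF.
have [f1 f2] := comp_continuous _ _ _ _ _ _ nF yr c1 c2.
have cG i := let: ex_intro2 K _ nK := C11_nice L (G i) r r0 (hG i) in
  comp_continuous _ _ _ _ _ _ nK yr c1 c2.
split; apply: integrable_ctrl => // i; by have [] := cG i.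
Qed.

Lemma traj_primit (u : R -> 'I_M -> R) (y : R -> R * R) (t : R) (x0 : R * R) :
  admissible u t -> trajectory F G x0 u t y ->
  [/\ mu.-integrable `[0, t]%classic (EFin \o (fun s => (Defs.field F G (y s) (u s)).1)),
   mu.-integrable `[0, t]%classic (EFin \o (fun s => (Defs.field F G (y s) (u s)).2)) &
   forall s : R, 0 <= s <= t ->
    y s = x0 + (primit (fun s => (Defs.field F G (y s) (u s)).1) s,
                primit (fun s => (Defs.field F G (y s) (u s)).2) s)].
Proof.
move=> adm [y0 [c1 [c2 H]]]; have [i1 i2] := traj_integrable _ _ _ adm c1 c2.
split=> // s hs; have [h1 h2] := H s hs; apply: vecP => /=.
  by move: h1; rewrite (primitE _ t) // -EFinD => -[].
by move: h2; rewrite (primitE _ t) // -EFinD => -[].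
Qed.

Lemma primit_traj (u : R -> 'I_M -> R) (y : R -> R * R) (t : R) (x0 : R * R) : 0 <= t ->
  admissible u t ->
  {within `[0, t]%classic, continuous (fun s => (y s).1)} ->
  {within `[0, t]%classic, continuous (fun s => (y s).2)} ->
  (forall s : R, 0 <= s <= t ->
    y s = x0 + (primit (fun s => (Defs.field F G (y s) (u s)).1) s,
                primit (fun s => (Defs.field F G (y s) (u s)).2) s)) ->
  trajectory F G x0 u t y.
Proof.
move=> t0 adm c1 c2 H; have [i1 i2] := traj_integrable _ _ _ adm c1 c2.
split; first by rewrite H ?lexx // !primit0; apply: vecP; rewrite /= addr0.
split=> //; split=> // s hs; rewrite !(primitE _ t) // -!EFinD.
by split; rewrite [in LHS](H s hs).
Qed.

Lemma traj_incr (u : R -> 'I_M -> R) (y : R -> R * R) (t a b e : R) (x0 w : R * R) :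
  admissible u t -> trajectory F G x0 u t y -> 0 <= a -> a <= b -> b <= t ->
  (forall x : R, a < x < b -> n1 (Defs.field F G (y x) (u x) - w) <= e) ->
  n1 (y b - y a - (b - a) *: w) <= 2 * e * (b - a).
Proof.
move=> adm tr a0 ab bt H; have [i1 i2 E] := traj_primit _ _ _ _ adm tr.
have j1 := primit_bound_oo _ _ _ _ w.1 e i1 a0 ab bt (fun x hx => le_trans (fst_n1 _) (H x hx)).
have j2 := primit_bound_oo _ _ _ _ w.2 e i2 a0 ab bt (fun x hx => le_trans (snd_n1 _) (H x hx)).
rewrite (E b) ?(le_trans a0 ab) // (E a) ?a0 ?(le_trans ab) //.
move: j1 j2; set p := primit _; set q := primit _ => j1 j2.
have -> : x0 + (p b, q b) - (x0 + (p a, q a)) - (b - a) *: w =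
    (p b - p a - w.1 * (b - a), q b - q a - w.2 * (b - a)).
  by apply: vecP; rewrite /= /GRing.scale /=; ring.
by rewrite /n1 /=; lra.
Qed.

End Trajectories.

(** * Translation in time, concatenation, dynamic programming *)

Section Shift.
Context {R : realType}.
Notation mu := (@lebesgue_measure R).

Definition shiftr (e : R) : measurableTypeR R -> measurableTypeR R := fun x => x - e.

Lemma measurable_shiftr e : measurable_fun [set: measurableTypeR R] (shiftr e).
Proof.
apply: (@measurable_funB _ _ R [set: measurableTypeR R] id (cst e)); [exact: measurable_id|exact: measurable_cst].
Qed.

HB.instance Definition _ e := isMeasurableFun.Build _ _ _ _ (shiftr e) (measurable_shiftr e).

(** The image measure agrees with [mu] on half-open intervals, and these determine it. *)
Lemma lebesgue_measure_shift e (A : set (measurableTypeR R)) : measurable A ->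
  pushforward mu (shiftr e) A = mu A.
Proof.
move=> mA; apply/esym/lebesgue_measure_unique => //= _ [[a b]] _ <-.
rewrite /pushforward /=.
have -> : shiftr e @^-1` `]a, b] = `](a + e), (b + e)]%classic.
  by apply/seteqP; split => x /=; rewrite /shiftr !in_itv /= ltrBrDr lerBlDr.
rewrite !lebesgue_measure_itv /= !lte_fin ltrD2r; case: ifP => // _.
by rewrite -!EFinB; congr EFin; ring.
Qed.

Lemma primit_shift (f g : R -> R) (e t s : R) :
  mu.-integrable `[0, t]%classic (EFin \o g) ->
  mu.-integrable `[0, e + t]%classic (EFin \o f) -> 0 <= e -> 0 <= s -> s <= t ->
  (forall x : R, e < x < e + t -> f x = g (x - e)) ->
  primit f (e + s) - primit f e = primit g s.
Proof.
move=> ig if_ e0 s0 st fg.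
rewrite (primit_incr _ (e + t)) // ?lerDl ?lerD2l //.
rewrite -[RHS]subr0 -(primit0 g) (primit_incr _ t) //.
(* Extension by zero makes the integrand measurable on the whole line, as the change of variables
   requires. *)
pose g' := (EFin \o g) \_ (`[0, t]%classic : set R).
have mg' : measurable_fun [set: measurableTypeR R] g'.
  have mg : measurable_fun `[0, t]%classic (EFin \o g) by case/integrableP: ig.
  exact: ((measurable_restrictT (EFin \o g) (measurable_itv `[0, t])).1 mg).
have pre : shiftr e @^-1` `]0, s[%classic = `]e, (e + s)[%classic.
  apply/seteqP; split => x /=; rewrite /shiftr !in_itv /= subr_gt0 ltrBlDr addrC //.
have sub (x : R) : 0 < x < s -> 0 <= x <= t.
  by move=> /andP[h1 h2]; rewrite (ltW h1) (le_trans (ltW h2)).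
have E1 : (\int[mu]_(x in `]0%R, s[%classic) (g x)%:E =
           \int[mu]_(x in `]0%R, s[%classic) g' x)%E.
  apply: eq_integral => x; rewrite inE /= in_itv /= => hx.
  by rewrite /g' /patch mem_set //= in_itv /= sub.
have E2 : (\int[mu]_(x in `]e, (e + s)%R[%classic) (f x)%:E =
           \int[mu]_(x in `]e, (e + s)%R[%classic) (g' \o shiftr e) x)%E.
  apply: eq_integral => x; rewrite inE /= in_itv /= => /andP[h1 h2].
  rewrite /g' /patch /shiftr mem_set /=; last first.
    by rewrite in_itv /= sub // subr_gt0 h1 ltrBlDr addrC.
  by rewrite fg // h1 (lt_le_trans h2) // lerD2l.
rewrite /Rintegral E1 E2 -pre -integral_pushforward //=.
- by congr fine; apply: eq_measure_integral => A mA _; exact: lebesgue_measure_shift.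
- rewrite pre; apply: eq_integrable (integrable_oo _ _ e (e + s) if_ e0 _) => //=; last by rewrite lerD2l.
  move=> x; rewrite inE /= in_itv /= => /andP[h1 h2].
  rewrite /g' /patch /shiftr mem_set /=; last first.
    by rewrite in_itv /= sub // subr_gt0 h1 ltrBlDr addrC.
  by rewrite fg // h1 (lt_le_trans h2) // lerD2l.
Qed.

End Shift.

Section Concatenation.
Context {R : realType}.
Notation mu := (@lebesgue_measure R).

Lemma glue_continuous (f g : R -> R) (e t : R) : 0 <= e -> 0 <= t ->
  {within `[0, e]%classic, continuous f} -> {within `[0, t]%classic, continuous g} ->
  f e = g 0 ->
  {within `[0, e + t]%classic, continuous (fun s => if s <= e then f s else g (s - e))}.
Proof.
move=> e0 t0 /within_epsP cf /within_epsP cg fg; apply/within_epsP => x /andP[x0 xet] h h0.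
have [xe|xe|xe] := ltgtP x e.
- have [d d0 H] := cf x (ltac:(by rewrite x0 ltW)) h h0.
  exists (Num.min d (e - x)); first by rewrite lt_min d0 subr_gt0.
  move=> y /andP[y0 yet]; rewrite lt_min => /andP[yd yx].
  have ye : y <= e by have := ler_norm (y - x); lra.
  by rewrite ye; apply: H => //; rewrite y0.
- have [d d0 H] := cg (x - e) (ltac:(apply/andP; split; lra)) h h0.
  exists (Num.min d (x - e)); first by rewrite lt_min d0 subr_gt0.
  move=> y /andP[y0 yet]; rewrite lt_min => /andP[yd yx].
  have ye : e < y by have := ler_norm (x - y); rewrite distrC; lra.
  rewrite leNgt ye /=; apply: H; first by apply/andP; split; lra.
  by rewrite opprB addrA subrK.
- rewrite {}xe in x0 xet *.
  have [d1 d10 H1] := cf e (ltac:(by rewrite e0 lexx)) h h0.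
  have [d2 d20 H2] := cg 0 (ltac:(by rewrite lexx t0)) h h0.
  exists (Num.min d1 d2); first by rewrite lt_min d10.
  move=> y /andP[y0 yet]; rewrite lt_min => /andP[yd1 yd2].
  case: (leP y e) => ye; first by apply: H1 => //; rewrite y0.
  by rewrite fg; apply: H2; rewrite ?subr0 //; apply/andP; split; lra.
Qed.

Lemma follows_lip V A (r K C e : R) (c : R -> R * R) : nice V A r K ->
  (forall s : R, 0 <= s <= e -> n1 (c s) <= r) -> follows V c 0 e C ->
  forall s s' : R, 0 <= s <= e -> 0 <= s' <= e -> n1 (c s' - c s) <= (K + `|C| * e) * `|s' - s|.
Proof.
move=> nV cr fc s s' hs hs'; have [V1 _ _] := nV _ (cr _ hs).
have := n1D (c s' - c s - (s' - s) *: V (c s)) ((s' - s) *: V (c s)).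
rewrite subrK n1Z => h; apply: (le_trans h); rewrite mulrDl addrC lerD //.
  by rewrite mulrC ler_wpM2r.
apply: (le_trans (fc s s' hs hs')); rewrite -mulrA -(real_normK (num_real (s' - s))) expr2.
apply: (@le_trans _ _ (`|C| * (`|s' - s| * `|s' - s|))).
  by rewrite ler_wpM2r ?mulr_ge0 // ler_norm.
rewrite ler_wpM2l // ler_wpM2r // ler_norml; move: hs hs' => /andP[? ?] /andP[? ?].
by apply/andP; split; lra.
Qed.

(** Both sides have the same increments up to a quadratic error, so by [incr_quad] their difference
    neither increases nor decreases. *)
Lemma follows_primit V A (r K C e : R) (c : R -> R * R) : nice V A r K -> 0 <= K -> 0 <= e ->
  (forall s : R, 0 <= s <= e -> n1 (c s) <= r) -> follows V c 0 e C ->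
  [/\ {within `[0, e]%classic, continuous (fun s => (c s).1)},
      {within `[0, e]%classic, continuous (fun s => (c s).2)} &
   forall s : R, 0 <= s <= e ->
    c s = c 0 + (primit (fun s => (V (c s)).1) s, primit (fun s => (V (c s)).2) s)].
Proof.
move=> nV K0 e0 cr fc; have lip := follows_lip _ _ _ _ _ _ _ nV cr fc.
pose B := K + `|C| * e; have B0 : 0 <= B by rewrite addr_ge0 // mulr_ge0.
have c1 : {within `[0, e]%classic, continuous (fun s => (c s).1)}.
  by apply: (@lip_within _ _ _ _ B) => s s' hs hs'; apply: le_trans (lip s s' hs hs'); exact: (fst_n1 (c s' - c s)).
have c2 : {within `[0, e]%classic, continuous (fun s => (c s).2)}.
  by apply: (@lip_within _ _ _ _ B) => s s' hs hs'; apply: le_trans (lip s s' hs hs'); exact: (snd_n1 (c s' - c s)).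
split=> // s hs; have [v1 v2] := comp_continuous _ _ _ _ _ _ nV cr c1 c2.
(* [p] stands for either coordinate projection. *)
have key (p : R * R -> R) : (forall a, `|p a| <= n1 a) ->
    (forall a b, p (a - b) = p a - p b) -> (forall k a, p (k *: a) = p a * k) ->
    {within `[0, e]%classic, continuous (fun s => p (V (c s)))} ->
    p (c s) = p (c 0) + primit (fun s => p (V (c s))) s.
  move=> pn pB pZ pc; have ip := integrable_cont _ _ pc.
  have D (a b : R) : 0 <= a -> a <= b -> b <= e ->
      `|(p (c b) - primit (fun s => p (V (c s))) b) - (p (c a) - primit (fun s => p (V (c s))) a)|
      <= (`|C| + K * B) * (b - a) ^+ 2.
    move=> a0 ab be.
    have ha : 0 <= a <= e by rewrite a0 (le_trans ab).
    have hb : 0 <= b <= e by rewrite (le_trans a0).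
    have h1 := primit_bound _ _ a b (p (V (c a))) (K * (B * (b - a))) ip a0 ab be.
    have {}h1 : `|primit (fun s => p (V (c s))) b - primit (fun s => p (V (c s))) a -
        p (V (c a)) * (b - a)| <= K * (B * (b - a)) * (b - a).
      apply: h1 => x /andP[ax xb]; rewrite -pB (le_trans (pn _)) //.
      have hx : 0 <= x <= e by rewrite (le_trans a0) // (le_trans xb).
      have [_ _ /(_ _ (cr _ hx))[l _]] := nV _ (cr _ ha).
      rewrite (le_trans l) // ler_wpM2l // (le_trans (lip _ _ ha hx)) //.
      by rewrite ler_wpM2l // ger0_norm ?subr_ge0 // lerD2r.
    have h2 : `|p (c b) - p (c a) - p (V (c a)) * (b - a)| <= `|C| * (b - a) ^+ 2.
      rewrite -pB -pZ -pB (le_trans (pn _)) // (le_trans (fc _ _ ha hb)) //.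
      by rewrite ler_wpM2r ?sqr_ge0 // ler_norm.
    move: h1 h2; set P := primit _ => h1 h2.
    have -> : p (c b) - P b - (p (c a) - P a) = (p (c b) - p (c a) - p (V (c a)) * (b - a)) -
      (P b - P a - p (V (c a)) * (b - a)) by ring.
    by rewrite (le_trans (ler_normB _ _)) // mulrDl lerD // (le_trans h1) //; nra.
  have /andP[s0 se] := hs; set P := primit _ in D *.
  have l1 : p (c s) - P s <= p (c 0) - P 0.
    apply: (@incr_quad _ (fun s => p (c s) - P s) 0 s (`|C| + K * B)) => // a b a0 ab bs.
    by rewrite (le_trans (ler_norm _)) // D // (le_trans bs).
  have l2 : P s - p (c s) <= P 0 - p (c 0).
    apply: (@incr_quad _ (fun s => P s - p (c s)) 0 s (`|C| + K * B)) => // a b a0 ab bs.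
    have -> : P b - p (c b) - (P a - p (c a)) = - (p (c b) - P b - (p (c a) - P a)) by ring.
    by rewrite (le_trans (ler_norm _)) // normrN D // (le_trans bs).
  have P0 : P 0 = 0 by apply: primit0.
  by move: l1 l2; rewrite P0; lra.
by apply: vecP => /=; apply: key => //; move=> *; rewrite /= ?fst_n1 ?snd_n1 // /GRing.scale /= mulrC.
Qed.

End Concatenation.

Section DynamicProgramming.
Context {R : realType} {M : nat}.
Variables (F : R * R -> R * R) (G : 'I_M -> R * R -> R * R) (L : R).
Hypotheses (hF : C11_vec L F) (hG : forall i, C11_vec L (G i)).
Notation mu := (@lebesgue_measure R).
Notation X w := (fun x => Defs.field F G x w).

Lemma steers_concat (w : 'I_M -> R) (c : R -> R * R) (e C t r : R) u y :
  (forall i, `|w i| <= 1) -> 0 <= e -> 0 <= r ->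
  (forall s : R, 0 <= s <= e -> n1 (c s) <= r) -> follows (X w) c 0 e C ->
  steers F G (c e) t u y -> exists u' y', steers F G (c 0) (e + t) u' y'.
Proof.
move=> w1 e0 r0 cr fc [t0 [adm [tr yt]]].
have [K K0 nK] := field_nice F G L r r0 hF hG.
have [cc1 cc2 cE] := follows_primit _ _ _ _ _ _ _ (nK w w1) K0 e0 cr fc.
have [y0 [yc1 [yc2 _]]] := tr.
have [g1 g2 yE] := traj_primit F G L hF hG _ _ _ _ adm tr.
pose u' s := if s <= e then w else u (s - e).
pose y' s := if s <= e then c s else y (s - e).
have adm' : admissible u' (e + t).
  move=> i; have [mu_ ub] := adm i; split=> [|s /andP[s0 st]].
    have -> : (fun s => u' s i) = (fun s => if s <= e then w i else u (s - e) i).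
      by apply/funext => s; rewrite /u'; case: ifP.
    apply: measurable_fun_if; first exact: measurable_itv.
    - by apply: measurable_fun_ler; [exact: measurable_id|exact: measurable_cst].
    - exact: measurable_cst.
    - apply: (@measurable_comp _ _ _ _ _ _ `[0, t]%classic (fun s => u s i) _ (shiftr e)) => //.
        move=> z [s [h1 h2] <-]; move: h1 h2.
        rewrite /shiftr /= !in_itv /= => /andP[s0 st] /negbT; rewrite -ltNge => es.
        by apply/andP; split; lra.
      apply: measurable_funS (measurable_shiftr e) => //.
  rewrite /u'; case: (leP s e) => se //; apply: ub; apply/andP; split; lra.
have c1 : {within `[0, e + t]%classic, continuous (fun s => (y' s).1)}.
  have -> : (fun s => (y' s).1) = (fun s => if s <= e then (c s).1 else (y (s - e)).1).
    by apply/funext => s; rewrite /y'; case: ifP.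
  by apply: (glue_continuous (fun s => (c s).1) (fun s => (y s).1)); rewrite ?y0.
have c2 : {within `[0, e + t]%classic, continuous (fun s => (y' s).2)}.
  have -> : (fun s => (y' s).2) = (fun s => if s <= e then (c s).2 else (y (s - e)).2).
    by apply/funext => s; rewrite /y'; case: ifP.
  by apply: (glue_continuous (fun s => (c s).2) (fun s => (y s).2)); rewrite ?y0.
exists u', y'; split; first by rewrite addr_ge0.
split=> //; split; last first.
  rewrite /y'; case: (leP (e + t) e) => h; last by rewrite addrC addKr.
  (* The final time can lie on the first piece only if the second one is reduced to a point. *)
  have t00 : t = 0 by lra.
  by rewrite -yt t00 addr0 y0.
apply: (primit_traj F G L) => //; first by rewrite addr_ge0.
have [f1 f2] := traj_integrable F G L hF hG _ _ _ adm' c1 c2.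
have lo (p : R * R -> R) (s : R) : s <= e -> primit (fun s => p (Defs.field F G (y' s) (u' s))) s =
    primit (fun s => p (Defs.field F G (c s) w)) s.
  move=> se; apply: eq_Rintegral => x; rewrite inE /= in_itv /= => /andP[x0 xs].
  by rewrite /y' /u' (le_trans xs se).
have hi (p : R * R -> R) (s : R) :
    mu.-integrable `[0, t]%classic (EFin \o (fun s => p (Defs.field F G (y s) (u s)))) ->
    mu.-integrable `[0, e + t]%classic (EFin \o (fun s => p (Defs.field F G (y' s) (u' s)))) ->
    e < s -> s <= e + t -> primit (fun s => p (Defs.field F G (y' s) (u' s))) s =
    primit (fun s => p (Defs.field F G (c s) w)) e +
    primit (fun s => p (Defs.field F G (y s) (u s))) (s - e).
  move=> i1 i2 es st; rewrite -(lo p e) //.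
  have s0 : 0 <= s - e by lra.
  have s1 : s - e <= t by lra.
  have H : forall x : R, e < x < e + t ->
      p (Defs.field F G (y' x) (u' x)) = p (Defs.field F G (y (x - e)) (u (x - e))).
    by move=> x /andP[ex _]; rewrite /y' /u' leNgt ex.
  by rewrite -(primit_shift _ _ _ _ _ i1 i2 e0 s0 s1 H) [e + (s - e)]addrC subrK [RHS]addrC subrK.
move=> s /andP[s0 st]; case: (leP s e) => se.
  have -> : y' s = c s by rewrite /y' se.
  by rewrite (lo fst) // (lo snd) // cE // s0.
have -> : y' s = y (s - e) by rewrite /y' leNgt se.
rewrite (hi fst) // (hi snd) // yE; last by apply/andP; split; lra.
by rewrite {1}(cE e) ?lexx ?e0 //; apply: vecP; rewrite /= addrA.
Qed.

Lemma minT_ge0 x : (0 <= minT F G x)%E.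
Proof.
apply: le_ereal_inf_tmp => _ [t [u [y [t0 _]]] <-]; by rewrite lee_fin.
Qed.

Lemma minT_le x t u y : steers F G x t u y -> (minT F G x <= t%:E)%E.
Proof. by move=> h; apply: ereal_inf_lbound; exists t => //; exists u, y. Qed.

Lemma minT_dp (w : 'I_M -> R) (c : R -> R * R) (e C r : R) :
  (forall i, `|w i| <= 1) -> 0 <= e -> 0 <= r ->
  (forall s : R, 0 <= s <= e -> n1 (c s) <= r) -> follows (X w) c 0 e C ->
  (minT F G (c 0%R) <= e%:E + minT F G (c e))%E.
Proof.
move=> w1 e0 r0 cr fc; rewrite -leeBlDl //.
apply: le_ereal_inf_tmp => _ [t [u [y st]] <-]; rewrite leeBlDl //.
have [u' [y' st']] := steers_concat _ _ _ _ _ _ _ _ w1 e0 r0 cr fc st.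
by rewrite -EFinD; apply: minT_le st'.
Qed.

Lemma minT0 : minT F G (0, 0) = 0%E.
Proof.
apply/le_anti; rewrite minT_ge0 andbT.
apply: (@minT_le _ 0 (fun _ _ => 0) (fun=> (0, 0))); split=> //.
have adm : @admissible R M (fun _ _ => 0) 0.
  by move=> i; split=> [|s _]; [exact: measurable_cst|rewrite normr0].
split=> //; split=> //; apply: (primit_traj F G L) => //.
- by apply: continuous_subspaceT => x; exact: cst_continuous.
- by apply: continuous_subspaceT => x; exact: cst_continuous.
- move=> s; rewrite -eq_le => /eqP <-; rewrite !primit0; apply: vecP; rewrite /= addr0 //.
Qed.

End DynamicProgramming.

(** * Piecewise constant controls and short trajectories *)

Section Subdivisions.
Context {R : realType}.

(** Serves twice: to chain the dynamic programming inequality and to carry abnormality across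
    switchings. *)
Lemma chain_pieces (D : R -> R -> Prop) (a : R) (l : seq R) :
  (forall s1 s2 s3 : R, s1 <= s2 -> s2 <= s3 -> D s1 s2 -> D s2 s3 -> D s1 s3) -> l != [::] ->
  path <%R a l ->
  (forall j, (j < size l)%N -> forall s s' : R, nth 0 (a :: l) j <= s -> s <= s' ->
     s' <= nth 0 (a :: l) j.+1 -> D s s') ->
  forall s s' : R, a <= s -> s <= s' -> s' <= last a l -> D s s'.
Proof.
move=> tr; elim: l a => [//|b l IH] a _ /= /andP[ab pl] H s s' as_ ss sl.
have [sb|bs] := leP s' b; first exact: (H 0%N).
have ln : l != [::] by case: (l) sl bs => //=; rewrite leNgt => /negbTE ->.
have IH' := IH b ln pl (fun j hj => H j.+1 hj).
have [bs1|sb] := leP b s; first exact: IH'.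
apply: (tr s b s'); try exact: ltW.
  by apply: (H 0%N) => //; exact: ltW.
by apply: IH' => //; exact: ltW.
Qed.

Lemma piece_right (a : R) (l : seq R) (s : R) : a <= s -> s < last a l ->
  exists2 j, (j < size l)%N & nth 0 (a :: l) j <= s < nth 0 (a :: l) j.+1.
Proof.
elim: l a => [|b l IH] a as_ /= sl; first by move: (le_lt_trans as_ sl); rewrite ltxx.
have [bs|sb] := leP b s; last by exists 0%N => //=; rewrite as_.
by have [j hj h] := IH b bs sl; exists j.+1.
Qed.

Lemma piece_left (a : R) (l : seq R) (s : R) : a < s -> s <= last a l ->
  exists2 j, (j < size l)%N & nth 0 (a :: l) j < s <= nth 0 (a :: l) j.+1.
Proof.
elim: l a => [|b l IH] a as_ /= sl; first by move: (lt_le_trans as_ sl); rewrite ltxx.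
have [bs|sb] := ltP b s; last by exists 0%N => //=; rewrite as_.
by have [j hj h] := IH b bs sl; exists j.+1.
Qed.

Lemma path_bounds (a : R) (l : seq R) j : path <%R a l -> (j <= size l)%N ->
  a <= nth 0 (a :: l) j <= last a l.
Proof.
elim: l a j => [|b l IH] a [|j] //=; rewrite ?lexx // => /andP[ab pl] hj.
  have := IH b 0%N pl isT; rewrite /= => /andP[_ h]; by rewrite (le_trans (ltW ab)).
by have /andP[h1 h2] := IH b j pl hj; rewrite h2 andbT (le_trans (ltW ab)).
Qed.

End Subdivisions.

Section OptimalArcs.
Context {R : realType} {M : nat}.
Variables (F : R * R -> R * R) (G : 'I_M -> R * R -> R * R) (L : R).
Hypotheses (hF : C11_vec L F) (hG : forall i, C11_vec L (G i)).
Notation X w := (fun x => Defs.field F G x w).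

Lemma n1_continuous (y : R -> R * R) (t : R) :
  {within `[0, t]%classic, continuous (fun s => (y s).1)} ->
  {within `[0, t]%classic, continuous (fun s => (y s).2)} ->
  forall x : R, 0 <= x <= t -> forall e : R, 0 < e -> exists2 d : R, 0 < d &
    forall z : R, 0 <= z <= t -> `|z - x| < d -> n1 (y z - y x) < e.
Proof.
move=> c1 c2 x hx e e0.
have e20 : 0 < e / 2 by rewrite divr_gt0.
have [d1 d10 h1] := (within_epsP _ 0 t).1 c1 x hx _ e20.
have [d2 d20 h2] := (within_epsP _ 0 t).1 c2 x hx _ e20.
exists (Num.min d1 d2); first by rewrite lt_min d10.
move=> z hz; rewrite lt_min => /andP[z1 z2].
by have := h1 z hz z1; have := h2 z hz z2; rewrite /n1 /=; lra.
Qed.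

(** The velocity is bounded by [K] only on the unit ball, so one must first see that a short
    trajectory ending at 0 never leaves it. At the last time [a] where it is not inside, the
    remaining motion is at most [2 * K * (t - a) < 1], and continuity gives a contradiction. *)
Lemma small_time : exists B t0 : R, [/\ 0 <= B, 0 < t0 &
  forall x t u y, t <= t0 -> steers F G x t u y ->
  forall s : R, 0 <= s <= t -> n1 (y s) <= B * (t - s) /\ n1 (y s) <= 1].
Proof.
have [K K0 nK] := field_nice F G L 1 ler01 hF hG.
exists (2 * K), (2 * (2 * K + 1))^-1.
have K1 : 0 < 2 * K + 1 by lra.
have P : 0 < 2 * (2 * K + 1) by lra.
split; [by rewrite mulr_ge0|by rewrite invr_gt0|].
move=> x t u y tt0 [t0 [adm [tr yt]]].
have [y0 [c1 [c2 _]]] := tr.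
have Kt : 2 * K * t < 1.
  have : t * (2 * (2 * K + 1)) <= 1 by rewrite -ler_pdivlMr // div1r.
  nra.
have bound (a : R) : 0 <= a -> a <= t -> (forall s : R, a < s <= t -> n1 (y s) <= 1) ->
    n1 (y a) <= 2 * K * (t - a).
  move=> a0 at_ H; have := traj_incr F G L hF hG _ _ _ a t K _ 0 adm tr a0 at_ (lexx _).
  rewrite scaler0 subr0 yt sub0r n1N; apply => s /andP[as_ st]; rewrite subr0.
  have hs : 0 <= s <= t by rewrite (le_trans a0 (ltW as_)) ltW.
  have [] := nK (u s) _ (y s); rewrite ?H ?as_ ?(ltW st) //.
  by move=> i; have [_ ub] := adm i; exact: ub.
suff in1 (s : R) : 0 <= s <= t -> n1 (y s) <= 1.
  move=> s hs; split; last exact: in1.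
  have /andP[s0 st] := hs; apply: bound => // z /andP[sz zt]; apply: in1.
  by rewrite (le_trans s0 (ltW sz)).
move=> hs; rewrite leNgt; apply/negP => bad.
pose E := [set z : R | 0 <= z <= t /\ 1 <= n1 (y z)].
have hE : has_sup E.
  split; first by exists s; split=> //; exact: ltW.
  by exists t => z [/andP[_ zt] _].
set a := sup E.
have sa : s <= a by apply: sup_upper_bound => //; split=> //; exact: ltW.
have at_ : a <= t by apply: ge_sup => [|z [/andP[_ zt] _]//]; exact: hE.1.
have a0 : 0 <= a by case/andP: hs => s0 _; exact: le_trans sa.
have after (z : R) : a < z <= t -> n1 (y z) < 1.
  move=> /andP[az zt]; rewrite ltNge; apply/negP => h.
  have : z <= a by apply: sup_upper_bound => //; split=> //; rewrite zt (le_trans a0 (ltW az)).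
  by rewrite leNgt az.
have : n1 (y a) <= 2 * K * (t - a) by apply: bound => // z hz; apply/ltW/after.
have Ka : 2 * K * (t - a) <= 2 * K * t by rewrite ler_wpM2l ?mulr_ge0 // gerBl.
move=> ya; have ya1 : n1 (y a) < 1 by lra.
have [d d0 H] := n1_continuous y t c1 c2 a (ltac:(by rewrite a0)) (1 - n1 (y a)) (ltac:(by rewrite subr_gt0)).
have [z [hz z1] zd] := sup_adherent d0 hE.
have za : z <= a by apply: sup_upper_bound.
have := H z hz; rewrite -/a in zd; rewrite distrC ger0_norm ?subr_ge0 // => /(_ ltac:(lra)).
by have := n1D (y z - y a) (y a); rewrite subrK; lra.
Qed.

(** The infimum need not be attained, so [small_time] is applied to steering times that tend to
    0. *)
Lemma minT_eq0 x : (minT F G x <= 0)%E -> x = (0, 0).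
Proof.
move=> T0; have [B [t0 [B0 t00 H]]] := small_time.
apply: n1_eq0; apply: (@le_of_le_pow2 _ _ (B * t0)) => n.
have e0 : 0 < t0 / 2 ^+ n by rewrite divr_gt0 // exprn_gt0.
have : (minT F G x < (t0 / 2 ^+ n)%:E)%E by rewrite (le_lt_trans T0) // lte_fin.
move=> /ereal_inf_lt [_ [t [u [y st]] <-]]; rewrite lte_fin => tn.
have tt0 : t <= t0.
  rewrite (le_trans (ltW tn)) // ler_pdivrMr ?exprn_gt0 // ler_peMr ?(ltW t00) //.
  by rewrite exprn_ege1 // ler1n.
have [th [_ [[y0 _] _]]] := st.
have := (H x t u y tt0 st 0 (ltac:(by rewrite lexx))).1.
rewrite y0 subr0 -mulrA => h; by rewrite (le_trans h) // ler_wpM2l // ltW.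
Qed.

Lemma traj_lip u y t x0 : admissible u t -> trajectory F G x0 u t y ->
  exists r K : R, [/\ 0 <= r, 0 <= K, forall s : R, 0 <= s <= t -> n1 (y s) <= r,
    forall w : 'I_M -> R, (forall i, `|w i| <= 1) -> nice (X w) (fieldD F G w) r K &
    forall s s' : R, 0 <= s <= t -> 0 <= s' <= t -> n1 (y s' - y s) <= 2 * K * `|s' - s|].
Proof.
move=> adm tr; have [y0 [c1 [c2 _]]] := tr.
have [r r0 yr] := path_bounded _ _ c1 c2.
have [K K0 nK] := field_nice F G L r r0 hF hG.
have lip (a b : R) : 0 <= a -> a <= b -> b <= t -> n1 (y b - y a) <= 2 * K * (b - a).
  move=> a0 ab bt; have := traj_incr F G L hF hG _ _ _ a b K _ 0 adm tr a0 ab bt.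
  rewrite scaler0 subr0; apply => s /andP[as_ sb]; rewrite subr0.
  have hs : 0 <= s <= t by rewrite (le_trans a0 (ltW as_)) (le_trans (ltW sb)).
  have [] := nK (u s) _ (y s) (yr s hs) => //.
  by move=> i; have [_ ub] := adm i; exact: ub.
exists r, K; split=> // s s' /andP[s0 st] /andP[s0' st'].
have [ss|ss] := leP s s'; first by rewrite ger0_norm ?subr_ge0 // lip.
by rewrite n1C distrC ger0_norm ?subr_ge0 ?(ltW ss) // lip // ltW.
Qed.

Lemma bang_follows u y t x0 (r K a b : R) (v : 'I_M -> R) :
  admissible u t -> trajectory F G x0 u t y -> 0 <= K ->
  (forall s : R, 0 <= s <= t -> n1 (y s) <= r) ->
  nice (X v) (fieldD F G v) r K ->
  (forall s s' : R, 0 <= s <= t -> 0 <= s' <= t -> n1 (y s' - y s) <= 2 * K * `|s' - s|) ->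
  0 <= a -> b <= t -> (forall s : R, a < s < b -> forall i, u s i = v i) ->
  follows (X v) y a b (4 * K ^+ 2).
Proof.
move=> adm tr K0 yr nv lip a0 bt uv.
have fw (s s' x : R) : a <= s -> s <= s' -> s' <= b -> s <= x -> x <= s' ->
    n1 (y s' - y s - (s' - s) *: Defs.field F G (y x) v) <= 4 * K ^+ 2 * (s' - s) ^+ 2.
  move=> as_ ss sb sx xs.
  have -> : 4 * K ^+ 2 * (s' - s) ^+ 2 = 2 * (K * (2 * K * (s' - s))) * (s' - s) by ring.
  have s0 : 0 <= s by rewrite (le_trans a0).
  have st : s' <= t by rewrite (le_trans sb).
  have hx : 0 <= x <= t by rewrite (le_trans s0) // (le_trans xs).
  apply: (traj_incr F G L hF hG _ _ _ s s' _ _ _ adm tr) => // z /andP[sz zs].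
  have -> : u z = v.
    by apply/funext => i; apply: uv; rewrite (le_lt_trans as_) // (lt_le_trans zs).
  have hz : 0 <= z <= t by rewrite (le_trans s0 (ltW sz)) (le_trans (ltW zs)).
  have [_ _ /(_ _ (yr _ hz))[l _]] := nv _ (yr _ hx).
  rewrite (le_trans l) // ler_wpM2l // (le_trans (lip _ _ hx hz)) //.
  by rewrite ler_wpM2l ?mulr_ge0 // ler_norml; apply/andP; split; lra.
move=> s s' /andP[as_ sb] /andP[as' sb'].
have [ss|ss] := leP s s'; first exact: fw.
rewrite -n1N (_ : - _ = y s - y s' - (s - s') *: Defs.field F G (y s) v); last first.
  by apply: vecP; rewrite /= /GRing.scale /=; ring.
by rewrite -[(s' - s) ^+ 2]sqrrN opprB; apply: fw; rewrite // ltW.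
Qed.

End OptimalArcs.

(** The normal cone of convex analysis, that is [prox_normal] with [sigma = 0]. *)
Definition normal {R : realType} (K : set (R * R)) (x p : R * R) : Prop :=
  forall z, K z -> dot p (z - x) <= 0.

(** * Normals and their propagation along abnormal arcs *)

Section Normals.
Context {R : realType}.
Implicit Types (K : set (R * R)) (x z p : R * R).

Lemma strictly_convex_segment K x z (l : R) : strictly_convex K -> K x -> K z ->
  0 <= l <= 1 -> K (x + l *: (z - x)).
Proof.
move=> sc Kx Kz /andP[l0 l1].
have [->|xz] := eqVneq z x; first by rewrite subrr scaler0 addr0.
have [->|ln0] := eqVneq l 0; first by rewrite scale0r addr0.
have [->|ln1] := eqVneq l 1; first by rewrite scale1r addrC subrK.
have /(_ ltac:(by rewrite !lt_neqAle eq_sym ln0 l0 ln1 l1)) := sc z x l Kz Kx (elimN eqP xz).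
move=> [e [e0 H]]; have -> : x + l *: (z - x) = vcomb l z x.
  by apply: vecP; rewrite /= /GRing.scale /=; ring.
by apply: H; rewrite /eball /= edistE subrr /enorm /dot /= mulr0 addr0 sqrtr0.
Qed.

(** On the chord point [x + l *: (z - x)], which strict convexity keeps in [K], the pairing is of
    order [l] and the error of order [l ^+ 2]. Dividing by [l] and letting it tend to 0 removes both
    the error and the restriction to a neighbourhood. *)
Lemma local_normal K x p (rho C : R) : strictly_convex K -> K x -> 0 < rho ->
  (forall z, K z -> n1 (z - x) <= rho -> dot p (z - x) <= C * n1 (z - x) ^+ 2) ->
  normal K x p.
Proof.
move=> sc Kx rho0 H z Kz.
pose q := n1 (z - x) + 1; have q0 : 0 < q by rewrite ltr_wpDl ?n1_ge0.
pose l0 := Num.min 1 (rho / q).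
have l00 : 0 < l0 by rewrite lt_min ltr01 divr_gt0.
apply: (@le_of_le_pow2 _ _ (`|C| * l0 * n1 (z - x) ^+ 2)) => n.
pose l := l0 / 2 ^+ n; have p2 : 0 < 2 ^+ n :> R by rewrite exprn_gt0.
have lp : 0 < l by rewrite divr_gt0.
have ll0 : l <= l0 by rewrite ler_pdivrMr // ler_peMr ?(ltW l00) // exprn_ege1 // ler1n.
have l1 : l <= 1 by rewrite (le_trans ll0) // ge_min lexx.
have lr : l * n1 (z - x) <= rho.
  have : l * q <= rho by rewrite -ler_pdivlMr // (le_trans ll0) // ge_min lexx orbT.
  by rewrite /q; nra.
have hl : 0 <= l <= 1 by rewrite (ltW lp).
have := H (x + l *: (z - x)) (strictly_convex_segment _ _ _ _ sc Kx Kz hl).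
rewrite [x + _]addrC addrK n1Z dotZr (ger0_norm (ltW lp)) => /(_ lr).
rewrite exprMn => h.
have h' : l * dot p (z - x) <= l * (`|C| * l * n1 (z - x) ^+ 2).
  rewrite (le_trans h) //; have -> : l * (`|C| * l * n1 (z - x) ^+ 2) = `|C| * (l ^+ 2 * n1 (z - x) ^+ 2) by ring.
  by apply: ler_wpM2r; [exact: mulr_ge0 (sqr_ge0 _) (sqr_ge0 _)|exact: ler_norm].
have -> : `|C| * l0 * n1 (z - x) ^+ 2 / 2 ^+ n = `|C| * l * n1 (z - x) ^+ 2 by rewrite /l; ring.
by rewrite -(ler_pM2l lp).
Qed.

Lemma prox_normal_normal K x p : strictly_convex K -> K x -> prox_normal K x p -> normal K x p.
Proof.
move=> sc Kx [sg [sg0 H]]; apply: (local_normal _ _ _ 1 sg) => // z Kz _.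
rewrite (le_trans (H z Kz)) // ler_wpM2l // lerXn2r ?nnegrE ?enorm_ge0 ?n1_ge0 //.
exact: edist_n1.
Qed.

Lemma normal_prox K x p : normal K x p -> prox_normal K x p.
Proof. by move=> H; exists 0; split=> // z Kz; rewrite mul0r; exact: H. Qed.

Lemma normalZ K x p (k : R) : 0 <= k -> normal K x p -> normal K x (k *: p).
Proof. by move=> k0 H z Kz; rewrite dotZl mulr_ge0_le0 // H. Qed.

Definition rot90 (p : R * R) : R * R := (- p.2, p.1).

Lemma dot_rot p z : dot (rot90 p) z = cross p z.
Proof. by rewrite /dot /rot90 /cross /=; ring. Qed.

Lemma sqr_dot_eq0 p : p != 0 -> 0 < dot p p.
Proof.
move=> p0; rewrite lt_neqAle dot_ge0 andbT eq_sym; apply: contra_neq p0 => h.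
by apply: enorm_eq0; rewrite /enorm h sqrtr0.
Qed.

(** Expansion of [p] in the orthogonal basis [v], [rot90 v]; this is where dimension two enters. *)
Lemma perp_rot p v : v != 0 -> dot p v = 0 -> p = (cross v p / dot v v) *: rot90 v.
Proof.
move=> v0 pv; have vv := lt0r_neq0 (sqr_dot_eq0 _ v0).
have E : v.1 * v.1 + v.2 * v.2 != 0 by [].
apply: vecP; rewrite /rot90 /= /GRing.scale /= mulrAC; apply/(canRL (mulfK vv));
  rewrite /cross /dot; rewrite /dot in pv.
  have -> : p.1 * (v.1 * v.1 + v.2 * v.2) =
    (v.1 * p.2 - v.2 * p.1) * - v.2 + v.1 * (p.1 * v.1 + p.2 * v.2) by ring.
  by rewrite pv mulr0 addr0.
have -> : p.2 * (v.1 * v.1 + v.2 * v.2) =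
  (v.1 * p.2 - v.2 * p.1) * v.1 + v.2 * (p.1 * v.1 + p.2 * v.2) by ring.
by rewrite pv mulr0 addr0.
Qed.

Lemma cross_addl x z p : cross (x + z) p = cross x p + cross z p.
Proof. by rewrite /cross /=; ring. Qed.
Lemma cross_addr x z p : cross p (x + z) = cross p x + cross p z.
Proof. by rewrite /cross /=; ring. Qed.
Lemma cross_zr (k : R) x p : cross p (k *: x) = k * cross p x.
Proof. by rewrite /cross /= /GRing.scale /=; ring. Qed.

(* Liouville's formula: the area spanned by the velocity and a displacement grows at
   the rate given by the divergence, up to a quadratic error. *)
Lemma cross_incr V A (r K C1 C2 D : R) c c' o o' : nice V A r K -> 0 <= K ->
  0 <= C1 -> 0 <= C2 -> 0 <= D -> D <= 1 ->
  n1 c <= r -> n1 c' <= r -> n1 o <= r -> n1 o' <= r ->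
  n1 (c' - c - D *: V c) <= C1 * D ^+ 2 -> n1 (o' - o - D *: V o) <= C2 * D ^+ 2 ->
  `|cross (V c') (o' - c') - cross (V c) (o - c)
     - ((A c).1.1 + (A c).2.2) * cross (V c) (o - c) * D| <=
  K ^+ 2 * n1 (o - c) ^+ 2 * D +
  ((K * (K + C1) ^+ 2 + K * C1) * (2 * r) + K * (C1 + C2)
     + K * (K + C1) * (2 * K + C1 + C2)) * D ^+ 2.
Proof.
move=> nV K0 C10 C20 D0 D1 hc hc' ho ho' fc fo.
have [Vc Ac /(_ _ hc')[Lc Tc]] := nV c hc; have [_ _ /(_ _ ho)[Lo To]] := nV c hc.
have [Vo _ _] := nV o ho.
have D2 : D ^+ 2 <= D by rewrite expr2 ler_piMl.
have dist p q C : 0 <= C -> n1 (V p) <= K -> n1 (q - p - D *: V p) <= C * D ^+ 2 ->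
    n1 (q - p) <= (K + C) * D.
  move=> C0 Vp h; have := n1D (q - p - D *: V p) (D *: V p).
  rewrite subrK n1Z ger0_norm // => h'.
  have : D * n1 (V p) <= D * K by rewrite ler_wpM2l.
  have : C * D ^+ 2 <= C * D by rewrite ler_wpM2l.
  lra.
have dc := dist c c' C1 C10 Vc fc; have do_ := dist o o' C2 C20 Vo fo.
(* [T1] is the defect of the velocity in the variational equation, and [T2] below that of the
   displacement. Only [T2] contains the Taylor remainder, which is quadratic in [n1 d] but linear in
   [D]. *)
pose T1 := V c' - V c - D *: ap (A c) (V c).
have hT1 : n1 T1 <= (K * (K + C1) ^+ 2 + K * C1) * D ^+ 2.
  have -> : T1 = (V c' - V c - ap (A c) (c' - c)) + ap (A c) (c' - c - D *: V c).
    have -> : ap (A c) (c' - c - D *: V c) = ap (A c) (c' - c) - D *: ap (A c) (V c).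
      by apply: vecP; rewrite /ap /dot /= /GRing.scale /=; ring.
    by rewrite /T1 addrA subrK.
  rewrite (le_trans (n1D _ _)) // mulrDl lerD //.
    rewrite (le_trans Tc) // -mulrA -exprMn ler_wpM2l // lerXn2r ?nnegrE ?n1_ge0 //.
    by rewrite mulr_ge0 // addr_ge0.
  by rewrite (le_trans (n1_ap _ _)) // -mulrA ler_pM ?addr_ge0 ?n1_ge0.
pose d := o - c; pose d' := o' - c'.
pose T2 := d' - d - D *: ap (A c) d.
have hT2 : n1 T2 <= (C1 + C2) * D ^+ 2 + D * (K * n1 d ^+ 2).
  have -> : T2 = (o' - o - D *: V o) - (c' - c - D *: V c) + D *: (V o - V c - ap (A c) d).
    by rewrite /T2 /d /d'; apply: vecP; rewrite /= /GRing.scale /=; ring.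
  rewrite (le_trans (n1D _ _)) // n1Z (ger0_norm D0) lerD //.
    by rewrite (le_trans (n1B _ _)) // addrC mulrDl lerD.
  by rewrite ler_wpM2l.
have hd : n1 d <= 2 * r by rewrite (le_trans (n1B _ _)) // mulr2n mulrDl mul1r lerD.
have hdd : n1 (d' - d) <= (2 * K + C1 + C2) * D.
  have -> : d' - d = (o' - o) - (c' - c) by rewrite /d /d'; apply: vecP; rewrite /=; ring.
  by rewrite (le_trans (n1B _ _)) // (le_trans (lerD do_ dc)) //; lra.
have hS : n1 (V c' - V c) <= K * (K + C1) * D.
  by rewrite (le_trans Lc) // -mulrA ler_wpM2l.
(* The first-order terms combine into the trace by [cross_ap]; what remains is linear in the defects
   or a product of two small increments. *)
have -> : cross (V c') d' - cross (V c) d - ((A c).1.1 + (A c).2.2) * cross (V c) d * D =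
   cross T1 d + cross (V c) T2 + cross (V c' - V c) (d' - d).
  rewrite -cross_ap /T1 /T2; move: (ap (A c) (V c)) (ap (A c) d) => a1 a2.
  by rewrite /cross /= /GRing.scale /=; ring.
have r0 : 0 <= r by rewrite (le_trans (n1_ge0 c)).
have b1 : `|cross T1 d| <= (K * (K + C1) ^+ 2 + K * C1) * D ^+ 2 * (2 * r).
  by rewrite (le_trans (n1_cross _ _)) // ler_pM ?n1_ge0.
have b2 : `|cross (V c) T2| <= K * ((C1 + C2) * D ^+ 2 + D * (K * n1 d ^+ 2)).
  by rewrite (le_trans (n1_cross _ _)) // ler_pM ?n1_ge0.
have b3 : `|cross (V c' - V c) (d' - d)| <= K * (K + C1) * D * ((2 * K + C1 + C2) * D).
  by rewrite (le_trans (n1_cross _ _)) // ler_pM ?n1_ge0.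
have h1 := ler_normD (cross T1 d + cross (V c) T2) (cross (V c' - V c) (d' - d)).
have h2 := ler_normD (cross T1 d) (cross (V c) T2).
rewrite (le_trans h1) // (le_trans (lerD h2 (lexx _))) // (le_trans (lerD (lerD b1 b2) b3)) //.
by rewrite le_eqVlt; apply/orP; left; apply/eqP; ring.
Qed.

Lemma follows_shift V c (a b C s : R) : follows V c a b C ->
  follows V (fun q : R => c (s + q)) (a - s) (b - s) C.
Proof.
move=> fc x y /andP[h1 h2] /andP[h3 h4].
have := fc (s + x) (s + y) (ltac:(apply/andP; split; lra)) (ltac:(apply/andP; split; lra)).
by rewrite (_ : s + y - (s + x) = y - x) //; ring.
Qed.

Lemma follows_rev V c (a b C s : R) : follows V c a b C ->
  follows (fun x => - V x) (fun q : R => c (s - q)) (s - b) (s - a) C.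
Proof.
move=> fc x y /andP[h1 h2] /andP[h3 h4].
have := fc (s - x) (s - y) (ltac:(apply/andP; split; lra)) (ltac:(apply/andP; split; lra)).
rewrite (_ : s - y - (s - x) = - (y - x)); last by ring.
by rewrite sqrrN scaleNr scalerN.
Qed.

Lemma follows_sub V c (a b a' b' C : R) : a <= a' -> b' <= b -> follows V c a b C ->
  follows V c a' b' C.
Proof.
move=> aa bb fc x y /andP[h1 h2] /andP[h3 h4]; apply: fc; apply/andP; split; lra.
Qed.

Lemma nice_opp V A (r K : R) : nice V A r K -> nice (fun x => - V x) (fun x => - A x) r K.
Proof.
move=> n; have := niceZ V A r K (-1) n; rewrite normrN1 mul1r.
congr (nice _ _ _ _); apply/funext => x; rewrite scaleN1r //.
Qed.

(** Gronwall's lemma started from zero. It serves to exclude zeros of the velocity on optimal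
    pieces, where the time-to-go changes strictly. *)
Lemma stationary V A (r K C h : R) c : nice V A r K -> 0 <= K -> 0 <= h -> K * h <= 2^-1 ->
  (forall s : R, 0 <= s <= h -> n1 (c s) <= r) -> follows V c 0 h C ->
  V (c 0) = 0 -> forall s : R, 0 <= s <= h -> c s = c 0.
Proof.
move=> nV K0 h0 Kh cr fc V0 s hs.
have := @gronwall_quad _ (fun s => n1 (c s - c 0)) h K 0 C h0 K0 (lexx _) Kh _ _ s hs.
rewrite subrr n10 mul0r addr0 mulr0 => H; apply/eqP; rewrite -subr_eq0; apply/eqP/n1_eq0.
apply: H => [z _|a b a0 ab bh]; first exact: n1_ge0.
have ha : 0 <= a <= h by rewrite a0 (le_trans ab).
have hb : 0 <= b <= h by rewrite (le_trans a0).
have h00 : 0 <= (0 : R) <= h by rewrite lexx.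
have [_ _ /(_ _ (cr _ ha))[l _]] := nV _ (cr _ h00).
have f := fc a b ha hb.
have := n1_tri (c b) (c a) (c 0).
have := n1D (c b - c a - (b - a) *: V (c a)) ((b - a) *: V (c a)).
rewrite subrK n1Z ger0_norm ?subr_ge0 // => i1 i2.
have : (b - a) * n1 (V (c a)) <= (b - a) * (K * n1 (c a - c 0)).
  by rewrite ler_wpM2l ?subr_ge0 //; move: l; rewrite V0 subr0.
rewrite mul0r addr0; lra.
Qed.

End Normals.

(* [lra] on the comparisons of the context only: it is slow in large contexts. *)
Ltac flra :=
  repeat match goal with
  | H : ?T |- _ => lazymatch T with
      | is_true _ => fail
      | _ = _ => fail
      | C11_vec _ _ => fail
      | forall _, C11_vec _ _ => fail
      | forall _, _ -> prop_a _ _ _ => fail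
      | _ => let s := type of T in constr_eq s Prop; clear H
      end
  end; lra.

Section Propagation.
Context {R : realType} {M : nat}.
Variables (F : R * R -> R * R) (G : 'I_M -> R * R -> R * R) (L : R).
Hypotheses (hF : C11_vec L F) (hG : forall i, C11_vec L (G i)).
Notation X w := (fun x => Defs.field F G x w).

(** Source of competitors: following a constant control backwards from a point of a sublevel set
    leads into a larger sublevel set, where the normal is already known. *)
Lemma backward_solution (w : 'I_M -> R) (r K h : R) z : (forall i, `|w i| <= 1) ->
  nice (X w) (fieldD F G w) (r + 1) K -> 0 <= K -> 0 <= r -> 0 <= h -> 4 * K * h <= 1 ->
  n1 z <= r + 2^-1 ->
  exists o, [/\ o h = z, forall s : R, 0 <= s <= h -> n1 (o s) <= r + 1,
    follows (X w) o 0 h (4 * K ^+ 2) & (minT F G (o 0%R) <= h%:E + minT F G z)%E].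
Proof.
move=> w1 nw K0 r0 h0 Kh hz.
have hr : r + 2^-1 + 2 * K * h <= r + 1 by flra.
have [ o [ o0 ob fo]] := picard _ _ _ _ _ _ _ (nice_opp _ _ _ _ nw) K0 h0 hz hr Kh.
pose o' (s : R) := o (h - s).
have ob' (s : R) : 0 <= s <= h -> n1 (o' s) <= r + 1.
  by move=> /andP[s0 sh]; apply: ob; apply/andP; split; flra.
have fo' : follows (X w) o' 0 h (4 * K ^+ 2).
  have := follows_rev _ _ _ _ _ h fo; rewrite subrr subr0 => f s s' hs hs'.
  by have := f s s' hs hs'; rewrite opprK.
exists o'; split=> //; first by rewrite /o' subrr.
rewrite (_ : z = o' h); last by rewrite /o' subrr o0.
exact: (minT_dp F G L hF hG w o' h _ (r + 1) w1 h0 (addr_ge0 r0 ler01) ob' fo').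
Qed.

(* The covector is orthogonal to the velocity, hence a multiple of [rot90 (X v _)], whose
   pairing with displacements obeys Liouville's formula: no adjoint equation is needed. *)
Lemma propagate_normal (v : 'I_M -> R) (c : R -> R * R) (h C r K T0 k : R) :
  (forall i, `|v i| <= 1) -> nice (X v) (fieldD F G v) (r + 1) K ->
  0 <= K -> 0 <= C -> 0 <= r -> 0 <= h -> h <= 1 -> 4 * K * h <= 1 ->
  (forall s : R, 0 <= s <= h -> n1 (c s) <= r) -> follows (X v) c 0 h C ->
  strictly_convex (reach F G (T0 - h)) -> reach F G (T0 - h) (c h) ->
  normal (reach F G T0) (c 0) (k *: rot90 (X v (c 0))) ->
  normal (reach F G (T0 - h)) (c h) (k *: rot90 (X v (c h))).
Proof.
move=> v1 nv K0 C0 r0 h0 h1 Kh cr fc sc rc N0.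
set V := (fun x : R * R => _) in nv fc N0 *.
(* The 4 is the square of the factor in [hd]; the 2 below is the one of [gronwall_quad]. *)
pose E0 := `|k| * (K ^+ 2 * 4).
apply: (local_normal _ _ _ 2^-1 (2 * (E0 * h))) => // z rz hz.
have hz1 : n1 z <= r + 2^-1.
  have := n1D (z - c h) (c h); rewrite subrK => hh.
  have := cr h (ltac:(by rewrite h0 lexx)); flra.
have [ o [ oh ob fo To]] := backward_solution v r K h z v1 nv K0 r0 h0 Kh hz1.
rewrite -/V in fo.
have cb (s : R) : 0 <= s <= h -> n1 (c s) <= r + 1 by move=> /cr; flra.
have Kh2 : K * h <= 2^-1 by flra.
have ro : reach F G T0 (o 0).
  rewrite /reach /=; apply: (le_trans To).
  have -> : T0%:E = (h%:E + (T0 - h)%:E)%E by rewrite -EFinD addrC subrK.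
  by rewrite leeD2l.
have D0 : k * cross (V (c 0)) (o 0 - c 0) <= 0.
  by have := N0 _ ro; rewrite dotZl dot_rot.
pose d s := o s - c s.
(* Run backwards in time: the displacement is controlled by its value at the end [h], whereas the
   sign of its pairing is known at 0. *)
have hd (s : R) : 0 <= s <= h -> n1 (d s) <= 2 * n1 (z - c h).
  move=> /andP[s0 sh]; pose f q := n1 (d (h - q)).
  have := @gronwall_quad _ f h K 0 (4 * K ^+ 2 + C) h0 K0 (lexx _) Kh2 _ _ (h - s)
     (ltac:(apply/andP; split; flra)).
  rewrite /f mul0r addr0 subr0 subKr /d oh; apply => [q _|a b a0 ab bh]; first exact: n1_ge0.
  rewrite mul0r addr0.
  have ha : 0 <= h - a <= h by apply/andP; split; flra.
  have hb : 0 <= h - b <= h by apply/andP; split; flra.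
  have i1 := fo _ _ ha hb; have i2 := fc _ _ ha hb.
  have e1 : h - b - (h - a) = - (b - a) by ring.
  rewrite e1 sqrrN scaleNr opprK in i1; rewrite e1 sqrrN scaleNr opprK in i2.
  have [_ _ /(_ _ (ob _ ha))[l _]] := nv _ (cb _ ha).
  have -> : o (h - b) - c (h - b) = (o (h - b) - o (h - a) + (b - a) *: V (o (h - a)))
     - (c (h - b) - c (h - a) + (b - a) *: V (c (h - a))) + (o (h - a) - c (h - a))
     - (b - a) *: (V (o (h - a)) - V (c (h - a))).
    by apply: vecP; rewrite /= /GRing.scale /=; ring.
  have j1 := n1B (o (h - b) - o (h - a) + (b - a) *: V (o (h - a))
     - (c (h - b) - c (h - a) + (b - a) *: V (c (h - a))) + (o (h - a) - c (h - a)))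
     ((b - a) *: (V (o (h - a)) - V (c (h - a)))).
  have j2 := n1D (o (h - b) - o (h - a) + (b - a) *: V (o (h - a))
     - (c (h - b) - c (h - a) + (b - a) *: V (c (h - a)))) (o (h - a) - c (h - a)).
  have j3 := n1B (o (h - b) - o (h - a) + (b - a) *: V (o (h - a)))
     (c (h - b) - c (h - a) + (b - a) *: V (c (h - a))).
  rewrite n1Z (ger0_norm (_ : 0 <= b - a)) ?subr_ge0 // in j1.
  have j4 : (b - a) * n1 (V (o (h - a)) - V (c (h - a))) <= (b - a) * (K * n1 (o (h - a) - c (h - a))).
    by rewrite ler_wpM2l ?subr_ge0.
  flra.
pose Df s := k * cross (V (c s)) (d s).
(* Only positive values of the pairing are harmful, and Gronwall's lemma asks for a nonnegative
   function. *)
pose f s := Num.max (Df s) 0.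
pose E := E0 * n1 (z - c h) ^+ 2.
have E0' : 0 <= E0 by rewrite mulr_ge0 // mulr_ge0 // sqr_ge0.
have Ege : 0 <= E by rewrite mulr_ge0 // sqr_ge0.
have f0 : f 0 = 0 by rewrite /f max_r.
pose C3 := (K * (K + C) ^+ 2 + K * C) * (2 * (r + 1)) + K * (C + 4 * K ^+ 2)
     + K * (K + C) * (2 * K + C + 4 * K ^+ 2).
have C30 : 0 <= 4 * K ^+ 2 by rewrite mulr_ge0 // sqr_ge0.
suff : f h <= 2 * (f 0 + E * h).
  rewrite f0 add0r => fh; rewrite dotZl dot_rot -[Defs.field F G (c h) v]/(V (c h)).
  have : Df h <= f h by rewrite /f le_max lexx.
  by move: fh; rewrite /E /Df /d oh; flra.
apply: (@gronwall_quad _ f h K E (`|k| * C3)) => //; last by rewrite h0 lexx.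
  by move=> s _; rewrite /f le_max lexx orbT.
move=> a b a0 ab bh.
have ha : 0 <= a <= h by rewrite a0 (le_trans ab).
have hb : 0 <= b <= h by rewrite (le_trans a0).
have ba0 : 0 <= b - a by flra.
have ba1 : b - a <= 1 by flra.
have := @cross_incr _ V _ (r + 1) K C (4 * K ^+ 2) (b - a) (c a) (c b) (o a) (o b) nv K0 C0 C30 ba0 ba1
  (cb _ ha) (cb _ hb) (ob _ ha) (ob _ hb) (fc _ _ ha hb) (fo _ _ ha hb).
rewrite -/C3 -/(d a) -/(d b); set tr := ((fieldD F G v (c a)).1.1 + _) => I.
have trK : `|tr| <= K.
  have [_ AK _] := nv _ (cb _ ha); apply: le_trans AK; apply: le_trans (ler_normD _ _) _.
  by apply: lerD; [exact: fst_n1|exact: snd_n1].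
have I2 : `|Df b - Df a - tr * Df a * (b - a)| <= E * (b - a) + `|k| * C3 * (b - a) ^+ 2.
  have -> : Df b - Df a - tr * Df a * (b - a) =
    k * (cross (V (c b)) (d b) - cross (V (c a)) (d a) - tr * cross (V (c a)) (d a) * (b - a)).
    by rewrite /Df; ring.
  rewrite normrM (le_trans (ler_wpM2l (normr_ge0 k) I)) // mulrDr -[`|k| * C3 * _]mulrA lerD2r.
  have q : n1 (d a) ^+ 2 <= 4 * n1 (z - c h) ^+ 2.
    have -> : 4 * n1 (z - c h) ^+ 2 = (2 * n1 (z - c h)) ^+ 2 by ring.
    by rewrite lerXn2r ?nnegrE ?n1_ge0 ?hd // mulr_ge0 // n1_ge0.
  have -> : E * (b - a) = `|k| * (K ^+ 2 * (4 * n1 (z - c h) ^+ 2) * (b - a)) by rewrite /E /E0; ring.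
  by apply: ler_wpM2l => //; apply: ler_wpM2r => //; apply: ler_wpM2l q; exact: sqr_ge0.
have I3 := ler_normlW I2.
have Eb : 0 <= E * (b - a) by rewrite mulr_ge0.
have kb : 0 <= `|k| * C3 * (b - a) ^+ 2.
  by have := le_trans (normr_ge0 _) I2; have : E * (b-a) <= E * (b - a) by []; rewrite mulr_ge0 ?sqr_ge0 //;
   rewrite mulr_ge0 // /C3 !addr_ge0 ?mulr_ge0 ?addr_ge0 ?mulr_ge0 ?sqr_ge0 ?addr_ge0.
rewrite lerBlDl {1}/f ge_max; apply/andP; split.
  have [Da|Da] := leP 0 (Df a).
    have -> : f a = Df a by rewrite /f max_l.
    have : tr * Df a * (b - a) <= K * Df a * (b - a).
      by rewrite !ler_wpM2r // (le_trans (ler_norm tr)).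
    flra.
  have -> : f a = 0 by rewrite /f max_r // ltW.
  (* Linear growth cannot carry a negative value across zero, because [K * h <= 2^-1] keeps the
     factor positive. *)
  have : (1 + tr * (b - a)) * Df a <= 0.
    rewrite mulr_ge0_le0 ?(ltW Da) //.
    have : `|tr * (b - a)| <= K * (b - a) by rewrite normrM (ger0_norm ba0) ler_wpM2r.
    have : K * (b - a) <= K * h by rewrite ler_wpM2l //; flra.
    have := ler_norm (- (tr * (b - a))); rewrite normrN; flra.
  flra.
have : 0 <= f a by rewrite /f le_max lexx orbT.
have : 0 <= K * f a * (b - a) by rewrite !mulr_ge0 // /f le_max lexx orbT.
flra.
Qed.

End Propagation.

(* Abnormal in the sense of Pontryagin's principle: the velocity of an optimal
   trajectory points into the sublevel set, which forces [ham F G x p = 0]. *)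
Definition abnormal {R : realType} {M : nat} (F : R * R -> R * R)
    (G : 'I_M -> R * R -> R * R) (t : R) (x p : R * R) : Prop :=
  [/\ p != 0, normal (reach F G t) x p &
    forall w : 'I_M -> R, (forall i, `|w i| <= 1) -> 0 <= dot p (Defs.field F G x w)].

(** * Abnormal covectors along optimal trajectories *)

Section Abnormal.
Context {R : realType}.

Lemma forward_le (V : R * R -> R * R) (c : R -> R * R) (h C : R) p : 0 < h -> 0 <= C ->
  follows V c 0 h C -> (forall s : R, 0 < s <= h -> dot p (c s - c 0) <= 0) ->
  dot p (V (c 0)) <= 0.
Proof.
move=> h0 C0 fc H; apply: (@le_of_le_pow2 _ _ (n1 p * C * h)) => n.
pose e := h / 2 ^+ n; have p2 : 0 < 2 ^+ n :> R by rewrite exprn_gt0.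
have e0 : 0 < e by rewrite divr_gt0.
have eh : e <= h by rewrite ler_pdivrMr // ler_peMr ?(ltW h0) // exprn_ege1 // ler1n.
have h00 : 0 <= (0 : R) <= h by rewrite lexx ltW.
have he : 0 <= e <= h by rewrite (ltW e0).
have := fc 0 e h00 he; rewrite subr0 => f1.
have := H e (ltac:(by rewrite e0)) => f2.
have := le_trans (n1_dot p _) (ler_wpM2l (n1_ge0 p) f1) => f3.
have := ler_norm (- dot p (c e - c 0 - e *: V (c 0))); rewrite normrN => f4.
have f5 : dot p (c e - c 0 - e *: V (c 0)) = dot p (c e - c 0) - e * dot p (V (c 0)).
  by rewrite [LHS]dotBr dotZr.
have f6 : e * dot p (V (c 0)) <= e * (n1 p * C * e) by nra.
have -> : n1 p * C * h / 2 ^+ n = n1 p * C * e by rewrite /e; ring.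
by rewrite -(ler_pM2l e0).
Qed.

Lemma rot90_neq0 (v : R * R) : v != 0 -> rot90 v != 0.
Proof.
move=> v0; apply: contra_neq v0 => h; apply: vecP.
  by have := congr1 snd h.
by have := congr1 fst h => /= /eqP; rewrite oppr_eq0 => /eqP.
Qed.

Context {M : nat}.
Variables (F : R * R -> R * R) (G : 'I_M -> R * R -> R * R) (L : R).
Hypotheses (hF : C11_vec L F) (hG : forall i, C11_vec L (G i)).
Notation X w := (fun x => Defs.field F G x w).

Lemma ham_abnormal x p : ham F G x p = 0 ->
  forall w : 'I_M -> R, (forall i, `|w i| <= 1) -> 0 <= dot p (Defs.field F G x w).
Proof.
move=> h0 w w1; apply: (@le_trans _ _ (ham F G x p)); first by rewrite h0.
rewrite dot_field /ham lerD2l -sumrN; apply: ler_sum => i _.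
rewrite lerNl (le_trans (ler_norm _)) // normrN normrM.
by rewrite -[leRHS]mul1r ler_wpM2r.
Qed.

Lemma abnormal_ham t x p (v : 'I_M -> R) : abnormal F G t x p -> (forall i, `|v i| <= 1) ->
  dot p (Defs.field F G x v) <= 0 -> ham F G x p = 0.
Proof.
move=> [_ _ H] v1 hv; apply/le_anti/andP; split.
  apply: le_trans hv; rewrite dot_field /ham lerD2l -sumrN; apply: ler_sum => i _.
  rewrite lerNl (le_trans (ler_norm _)) // normrN normrM.
  by rewrite -[leRHS]mul1r ler_wpM2r.
(* The control that attains the minimum in [ham]. *)
pose w i := - Num.sg (dot p (G i x)).
have := H w; rewrite dot_field /ham.
have -> : \sum_(i < M) w i * dot p (G i x) = - \sum_(i < M) `|dot p (G i x)|.
  by rewrite -sumrN; apply: eq_bigr => i _; rewrite /w mulNr normrEsg.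
by apply => i; rewrite /w normrN normr_sg; case: eqVneq => _ //=; rewrite ?lexx ?ler01.
Qed.

(** The velocity cannot vanish, since a stationary piece would not lower the time-to-go. Being also
    orthogonal to [p] at time 0, it makes [propagate_normal] applicable up to every [s <= h].
    Normality alone is not yet abnormality at time [h]: the inequality for every control is
    recovered from the normals just before [h]. *)
Lemma abnormal_step (v : 'I_M -> R) (c : R -> R * R) (h C r K T0 : R) p :
  (forall i, `|v i| <= 1) ->
  (forall w : 'I_M -> R, (forall i, `|w i| <= 1) -> nice (X w) (fieldD F G w) (r + 1) K) ->
  0 <= K -> 0 <= C -> 0 <= r -> 0 < h -> h <= 1 -> 4 * K * h <= 1 ->
  (forall s : R, 0 <= s <= h -> n1 (c s) <= r) -> follows (X v) c 0 h C ->
  (forall s : R, 0 <= s <= h -> minT F G (c s) = (T0 - s)%:E) ->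
  (forall s : R, 0 <= s <= h -> strictly_convex (reach F G (T0 - s))) ->
  abnormal F G T0 (c 0) p ->
  [/\ Defs.field F G (c 0) v != 0, Defs.field F G (c h) v != 0 &
    exists p', abnormal F G (T0 - h) (c h) p'].
Proof.
move=> v1 nw K0 C0 r0 h0 h1 Kh cr fc Tc sc [p0 Np Hp].
have nv := nw v v1; set V := (fun x : R * R => _) in nv fc.
have h00 : 0 <= (0 : R) <= h by rewrite lexx ltW.
have hh : 0 <= h <= h by rewrite lexx ltW.
have cb (s : R) : 0 <= s <= h -> n1 (c s) <= r + 1 by move=> /cr; flra.
have Kh2 : K * h <= 2^-1 by flra.
have neq : c 0 <> c h.
  move=> e; have := Tc 0 h00; rewrite subr0 e Tc // => -[]; flra.
have V0 : V (c 0) != 0.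
  apply/eqP => e; apply: neq.
  by rewrite (stationary V _ _ _ _ _ _ nv K0 (ltW h0) Kh2 cb fc e h hh).
have Vh : V (c h) != 0.
  apply/eqP => e; apply: neq; pose c' (s : R) := c (h - s).
  have fc' : follows (fun x => - V x) c' 0 h C.
    by have := follows_rev _ _ _ _ _ h fc; rewrite subrr subr0.
  have cb' (s : R) : 0 <= s <= h -> n1 (c' s) <= r + 1.
    by move=> /andP[s0 sh]; apply: cb; apply/andP; split; flra.
  have e' : - V (c' 0) = 0 by rewrite /c' subr0 e oppr0.
  have := stationary _ _ _ _ _ _ _ (nice_opp _ _ _ _ nv) K0 (ltW h0) Kh2 cb' fc' e' h hh.
  by rewrite /c' subrr subr0.
split=> //.
have pV : dot p (V (c 0)) = 0.
  apply/le_anti/andP; split; last exact: Hp.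
  apply: (forward_le _ _ h C) => // s /andP[s0 sh]; apply: Np.
  by rewrite /reach /= Tc ?(ltW s0) // lee_fin; flra.
have pE := perp_rot _ _ V0 pV; set k := (_ / _) in pE.
have k0 : k != 0 by apply: contra_neq p0 => e; rewrite pE e scale0r.
have N (s : R) : 0 <= s <= h -> normal (reach F G (T0 - s)) (c s) (k *: rot90 (V (c s))).
  move=> /andP[s0 sh]; have hs : 0 <= s <= h by rewrite s0.
  apply: (propagate_normal F G L hF hG v c s C r K T0 k) => //.
  - by rewrite (le_trans sh).
  - by rewrite (le_trans _ Kh) // ler_wpM2l // mulr_ge0.
  - by move=> q /andP[q0 qs]; apply: cr; rewrite q0 (le_trans qs).
  - exact: follows_sub fc.
  - exact: sc.
  - by rewrite /reach /= Tc.
  - by rewrite -[Defs.field F G (c 0) v]/(V (c 0)) -pE.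
exists (k *: rot90 (V (c h))); split.
- by rewrite scaler_eq0 negb_or k0 rot90_neq0.
- exact: N.
move=> w w1; set W := Defs.field F G (c h) w.
rewrite dotZl dot_rot -oppr_le0.
have VhK : n1 (V (c h)) <= K by have [] := nv _ (cb h hh).
pose B := `|k| * (K * (C + 4 * K ^+ 2) + K * (K + C) * (2 * K + C + 4 * K ^+ 2)).
apply: (@le_of_le_pow2 _ _ (B * h)) => n.
pose e := h / 2 ^+ n; have p2 : 0 < 2 ^+ n :> R by rewrite exprn_gt0.
have e0 : 0 < e by rewrite divr_gt0.
have eh : e <= h by rewrite ler_pdivrMr // ler_peMr ?(ltW h0) // exprn_ege1 // ler1n.
have e1 : e <= 1 by rewrite (le_trans eh).
have Ke : 4 * K * e <= 1 by rewrite (le_trans _ Kh) // ler_wpM2l // mulr_ge0.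
have chr : n1 (c h) <= r + 2^-1 by have := cr h hh; flra.
(* Stepping back from [c h] with the control [w] for a time [e] gives a point of the sublevel set at
   [c (h - e)]. Its displacement from there is [e] times the difference of the two velocities up to
   [e ^+ 2], so the normal inequality divided by [e] yields the sign of the pairing with [W]. *)
have [ o [oh ob fo To]] := backward_solution F G L hF hG w r K e (c h) w1 (nw w w1) K0 r0 (ltW e0) Ke chr.
have hs : 0 <= h - e <= h by apply/andP; split; flra.
have ro : reach F G (T0 - (h - e)) (o 0).
  rewrite /reach /= (le_trans To) // Tc // -EFinD lee_fin; flra.
have := N _ hs _ ro; rewrite dotZl dot_rot => I0.
have e00 : 0 <= (0 : R) <= e by rewrite lexx ltW.
have ee : 0 <= e <= e by rewrite lexx ltW.
have := fo e 0 ee e00; rewrite oh sub0r sqrrN scaleNr opprK -/W => f1.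
have := fc h (h - e) hh hs.
rewrite (_ : h - e - h = - e); last by ring.
rewrite sqrrN scaleNr opprK => f2.
have [_ _ /(_ _ (cb _ hs))[l _]] := nv _ (cb h hh).
have WK : n1 W <= K by have [] := nw w w1 _ (cb h hh).
have CE : C * e ^+ 2 <= C * e by rewrite ler_wpM2l // expr2 ler_piMl // ltW.
have KE : 4 * K ^+ 2 * e ^+ 2 <= 4 * K ^+ 2 * e.
  by rewrite ler_wpM2l ?mulr_ge0 ?sqr_ge0 // expr2 ler_piMl // ltW.
set c1 := c (h - e) in I0 f2 l *.
have dc : n1 (c1 - c h) <= (K + C) * e.
  have := n1B (c1 - c h + e *: V (c h)) (e *: V (c h)); rewrite addrK n1Z (gtr0_norm e0).
  have : e * n1 (V (c h)) <= e * K by rewrite ler_wpM2l // ltW.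
  flra.
have do_ : n1 (o 0 - c h) <= (K + 4 * K ^+ 2) * e.
  have := n1B (o 0 - c h + e *: W) (e *: W); rewrite addrK n1Z (gtr0_norm e0).
  have : e * n1 W <= e * K by rewrite ler_wpM2l // ltW.
  flra.
have S : n1 (V c1 - V (c h)) <= K * (K + C) * e.
  by rewrite (le_trans l) // -mulrA ler_wpM2l.
have dd : n1 (o 0 - c1) <= (2 * K + C + 4 * K ^+ 2) * e.
  by have := n1_tri (o 0) (c h) c1; rewrite (n1C (c h) c1); flra.
have b1 := le_trans (n1_cross (V c1 - V (c h)) (o 0 - c1)) (ler_pM (n1_ge0 _) (n1_ge0 _) S dd).
pose T := (o 0 - c h + e *: W) - (c1 - c h + e *: V (c h)).
have hT : n1 T <= (C + 4 * K ^+ 2) * e ^+ 2 by rewrite (le_trans (n1B _ _)) //; flra.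
have b2 := le_trans (n1_cross (V (c h)) T) (ler_pM (n1_ge0 _) (n1_ge0 _) VhK hT).
have EQ : cross (V c1) (o 0 - c1) =
  - e * cross (V (c h)) W + cross (V (c h)) T + cross (V c1 - V (c h)) (o 0 - c1).
  by rewrite /T /cross /= /GRing.scale /=; ring.
have b3 : `|k * (cross (V (c h)) T + cross (V c1 - V (c h)) (o 0 - c1))| <= B * e ^+ 2.
  rewrite normrM /B -mulrA ler_wpM2l // (le_trans (ler_normD _ _)) //.
  rewrite (le_trans (lerD b2 b1)) //; nra.
have b4 := ler_norm (- (k * (cross (V (c h)) T + cross (V c1 - V (c h)) (o 0 - c1)))).
rewrite normrN in b4.
have -> : B * h / 2 ^+ n = B * e by rewrite /e; ring.
rewrite -(ler_pM2l e0); move: I0; rewrite EQ -addrA mulrDr; nra.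
Qed.

End Abnormal.

(* Time runs backwards along [Y]: the time-to-go at [Y s] is [s]. *)
Record abnormal_arc {R : realType} {M : nat} (F : R * R -> R * R)
    (G : 'I_M -> R * R -> R * R) (t : R) (Y : R -> R * R) : Prop := AbnormalArc {
  arc_lip : exists B : R, forall s s' : R, 0 <= s <= t -> 0 <= s' <= t ->
    n1 (Y s' - Y s) <= B * `|s' - s|;
  arc_time : forall s : R, 0 <= s <= t -> minT F G (Y s) = s%:E;
  arc_right : forall s : R, 0 <= s < t -> exists (v : 'I_M -> R) (h C : R),
    [/\ (forall i, `|v i| = 1), 0 < h, 0 <= C, s + h <= t &
     follows (fun x => - Defs.field F G x v) Y s (s + h) C];
  arc_left : forall s : R, 0 < s <= t -> exists (v : 'I_M -> R) (h C : R),
    [/\ (forall i, `|v i| = 1), 0 < h, 0 <= C, h <= s &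
     follows (fun x => - Defs.field F G x v) Y (s - h) s C];
  arc_abnormal : forall s : R, 0 < s <= t -> exists p, abnormal F G s (Y s) p }.

Section Arcs.
Context {R : realType} {M : nat}.
Variables (F : R * R -> R * R) (G : 'I_M -> R * R -> R * R) (L : R).
Hypotheses (hF : C11_vec L F) (hG : forall i, C11_vec L (G i)).
Variable calT : R.
Hypothesis ha : forall t, 0 < t < calT -> prop_a F G t.
Notation X w := (fun x => Defs.field F G x w).

(** Gives access to the bang-bang part of [prop_a], which concerns boundary points: a small step
    along the normal leaves the set. *)
Lemma normal_boundary (K : set (R * R)) x p : K x -> p != 0 -> normal K x p -> eboundary K x.
Proof.
move=> Kx p0 N e e0; split.
  by exists x; split=> //; rewrite /eball /= edistE subrr /enorm /dot /= mulr0 addr0 sqrtr0.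
have pp := sqr_dot_eq0 _ p0.
pose k := e / 2 / (n1 p + 1); have q0 : 0 < n1 p + 1 by rewrite ltr_wpDl ?n1_ge0.
have k0 : 0 < k by rewrite !divr_gt0.
exists (x + k *: p); split; last first.
  move=> /N; rewrite [x + _]addrC addrK dotZr => h.
  by have := mulr_gt0 k0 pp; rewrite ltNge h.
rewrite /eball /=; apply: le_lt_trans (edist_n1 _ _) _.
rewrite n1C [x + _]addrC addrK n1Z (gtr0_norm k0) /k.
have -> : e / 2 / (n1 p + 1) * n1 p = e / 2 * (n1 p / (n1 p + 1)) by ring.
have : n1 p / (n1 p + 1) <= 1 by rewrite ler_pdivrMr // mul1r lerDl.
have : 0 <= n1 p / (n1 p + 1) by rewrite divr_ge0 ?n1_ge0 // ltW.
nra.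
Qed.

Lemma abnormal_has_arc x t p : 0 < t < calT -> minT F G x = t%:E -> abnormal F G t x p ->
  exists Y, [/\ abnormal_arc F G t Y, Y 0 = (0, 0) & Y t = x].
Proof.
move=> htc Tx ab; have /andP[t0 tc] := htc; have [sc bd] := ha _ htc.
have hasc (s : R) : 0 < s -> s <= t -> strictly_convex (reach F G s).
  by move=> s0 st; have [] := ha s (ltac:(by rewrite s0 (le_lt_trans st))).
have xb : eboundary (reach F G t) x.
  have [p0 Np _] := ab; apply: normal_boundary p0 Np.
  by rewrite /reach /= Tx.
have [u [[y [_ st]] [bb _]]] := bd x xb.
rewrite Tx /= in st bb; have [_ [adm [tr yt]]] := st.
have y0 : y 0 = x by case: tr.
have [r [K [r0 K0 yr nK lip]]] := traj_lip F G L hF hG _ _ _ _ adm tr.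
have [K1 K10 nK1] := field_nice F G L (r + 1) (addr_ge0 r0 ler01) hF hG.
have [ts [sg [[sz srt] hd lst sg1 us]]] := bb.
case: ts sz srt hd lst us => // tz l sz srt /= a0 lst us; rewrite {}a0 in srt lst us.
have ln : l != [::] by case: (l) sz.
have sgle j i : `|sg j i| <= 1 by rewrite sg1.
pose tj j := nth 0 (0 :: l) j.
have tb j : (j < size l)%N -> 0 <= tj j /\ tj j.+1 <= t.
  move=> hj; have /andP[h1 _] := path_bounds 0 l j srt (ltnW hj).
  by have /andP[_ h2] := path_bounds 0 l j.+1 srt hj; rewrite -lst.
pose C := 4 * K ^+ 2; have C0 : 0 <= C by rewrite mulr_ge0 // sqr_ge0.
have fy j : (j < size l)%N -> follows (X (sg j)) y (tj j) (tj j.+1) C.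
  move=> hj; have [h1 h2] := tb j hj.
  apply: (bang_follows F G L hF hG _ _ _ _ r K _ _ _ adm tr) => //; first exact: nK.
  by move=> s hs i; apply: us.
have fpiece j (s s' : R) : (j < size l)%N -> tj j <= s -> s <= s' -> s' <= tj j.+1 ->
    [/\ 0 <= s' - s, follows (X (sg j)) (fun q => y (s + q)) 0 (s' - s) C &
    forall q : R, 0 <= q <= s' - s -> n1 (y (s + q)) <= r].
  move=> hj h1 h2 h3; have [h4 h5] := tb j hj; split; first by rewrite subr_ge0.
    have := follows_shift _ _ _ _ _ s (fy j hj).
    by apply: follows_sub; flra.
  by move=> q /andP[q0 qs]; apply: yr; apply/andP; split; flra.
(* Dynamic programming is available for constant controls, hence piece by piece. *)
have DP (s s' : R) : 0 <= s -> s <= s' -> s' <= t ->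
    (minT F G (y s) <= (s' - s)%:E + minT F G (y s'))%E.
  move=> s0 ss st'.
  apply: (chain_pieces (fun s s' => (minT F G (y s) <= (s' - s)%:E + minT F G (y s'))%E) 0 l) => //; last 1 first.
  - by rewrite lst.
  - move=> s1 s2 s3 s12 s23 d1 d2; apply: (le_trans d1).
    have -> : (s3 - s1)%:E = ((s2 - s1)%:E + (s3 - s2)%:E)%E by rewrite -EFinD; congr EFin; ring.
    by rewrite -addeA leeD2l.
  - move=> j hj q q' h1 h2 h3; have [g1 g2 g3] := fpiece j q q' hj h1 h2 h3.
    have := minT_dp F G L hF hG (sg j) (fun z => y (q + z)) (q' - q) C r (sgle j) g1 r0 g3 g2.
    by rewrite addr0 [q + _]addrC subrK.
(* [DP] from [s] to the end bounds the time-to-go above, and [DP] from the start to [s] bounds it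
   below because the whole trajectory is optimal. *)
have Ty (s : R) : 0 <= s <= t -> minT F G (y s) = (t - s)%:E.
  move=> /andP[s0 st']; apply/le_anti/andP; split.
    have := DP s t s0 st' (lexx _); rewrite yt (minT0 F G L hF hG) adde0 //.
  have := DP 0 s (lexx _) s0 st'; rewrite y0 Tx subr0 => h.
  by rewrite EFinB leeBlDl.
(* A step length admissible for [abnormal_step] anywhere on the trajectory, so that finitely many
   steps exhaust a piece. *)
pose eps := Num.min 1 (4 * K1 + 1)^-1.
have K14 : 0 < 4 * K1 + 1 by flra.
have eps0 : 0 < eps by rewrite lt_min ltr01 invr_gt0.
have epsK (h : R) : 0 <= h -> h <= eps -> h <= 1 /\ 4 * K1 * h <= 1.
  rewrite le_min => h0 /andP[h1 h2]; split=> //.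
  have : h * (4 * K1 + 1) <= 1 by rewrite -ler_pdivlMr // div1r.
  nra.
pose N (s : R) := exists p, abnormal F G (t - s) (y s) p.
(* The final time is excluded: strict convexity is known only for sublevel sets of positive time. *)
have step n : forall j (s s' : R), (j < size l)%N -> tj j <= s -> s <= s' -> s' <= tj j.+1 ->
    s' < t -> s' - s <= n%:R * eps -> N s -> N s'.
  elim: n => [|n IH] j s s' hj h1 h2 h3 st' hn Ns.
    by have -> : s' = s by apply/le_anti; rewrite h2 -subr_le0 (le_trans hn) // mul0r.
  have single (a b : R) : tj j <= a -> a < b -> b <= tj j.+1 -> b < t -> b - a <= eps -> N a -> N b.
    move=> a1 a2 a3 bt ae [q ext]; have [h4 h5] := tb j hj.
    have [g1 g2 g3] := fpiece j a b hj a1 (ltW a2) a3.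
    have [e1 e2] := epsK (b - a) g1 ae.
    have [] := @abnormal_step R M F G L hF hG (sg j) (fun q => y (a + q)) (b - a) C r K1 (t - a) q
      (sgle j) nK1 K10 C0 r0 _ e1 e2 g3 g2.
    - by rewrite subr_gt0.
    - by move=> z /andP[z0 z1]; rewrite Ty ?opprD ?addrA //; apply/andP; split; flra.
    - by move=> z /andP[z0 z1]; apply: hasc; flra.
    - by rewrite addr0.
    - move=> _ _ [p' h]; exists p'; move: h; rewrite [a + _]addrC subrK.
      by rewrite (_ : t - a - (b - a) = t - b) //; ring.
  have [se|se] := leP (s' - s) eps.
    have [ss|ss] := eqVneq s s'; first by rewrite -ss.
    by apply: single h1 _ h3 _ se Ns => //; rewrite lt_neqAle ss.
  have Nm : N (s + eps) by apply: single Ns => //; flra.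
  by apply: (IH j (s + eps) s') => //; flra.
have Nall (s : R) : 0 <= s < t -> N s.
  move=> /andP[s0 st'].
  apply: (chain_pieces (fun s s' => s' < t -> N s -> N s') 0 l _ ln srt _ 0 s) => //.
  - by move=> s1 s2 s3 s12 s23 d1 d2 h3 n1; apply: d2 => //; apply: d1 => //; exact: le_lt_trans h3.
  - move=> j hj q q' h1 h2 h3 qt; have [n hn] := natr_big ((q' - q) / eps).
    by apply: (step n j) => //; rewrite -ler_pdivrMr // ltW.
  - by rewrite lst ltW.
  - by exists p; rewrite subr0 y0.
exists (fun s => y (t - s)); split; last 2 first.
- by rewrite subr0.
- by rewrite subrr.
split.
- exists (2 * K) => s s' /andP[s0 s1] /andP[s2 s3].
  have := lip (t - s) (t - s') (ltac:(apply/andP; split; flra)) (ltac:(apply/andP; split; flra)).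
  by rewrite (_ : t - s' - (t - s) = s - s') 1?[`|s' - s|]distrC //; ring.
- by move=> s /andP[s0 s1]; rewrite Ty ?subKr //; apply/andP; split; flra.
- move=> s /andP[s0 s1].
  (* Time is reversed: what lies to the right of [s] on the arc is the piece to the left of
     [t - s]. *)
  have [|j hj /andP[h1 h2]] := piece_left 0 l (t - s) (ltac:(flra)).
    by rewrite lst; flra.
  exists (sg j), (t - s - tj j), C; split=> //; first by rewrite subr_gt0.
    by have [h4 h5] := tb j hj; flra.
  by have := follows_rev _ _ _ _ _ t (fy j hj); apply: follows_sub; rewrite /tj in h1 h2 *; flra.
- move=> s /andP[s0 s1].
  have [||j hj /andP[h1 h2]] := piece_right 0 l (t - s); try flra.
  exists (sg j), (tj j.+1 - (t - s)), C; split=> //; first by rewrite subr_gt0.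
    by have [h4 h5] := tb j hj; flra.
  by have := follows_rev _ _ _ _ _ t (fy j hj); apply: follows_sub; rewrite /tj in h1 h2 *; flra.
- move=> s /andP[s0 s1]; have [|q hq] := Nall (t - s); first by apply/andP; split; flra.
  by exists q; rewrite subKr in hq.
Qed.

End Arcs.

(** The derivative of the ordinate [dot P] with respect to the abscissa [dot e] along an integral
    curve of [V]. *)
Definition slope {R : realType} (e P : R * R) (V : R * R -> R * R) (x : R * R) : R :=
  dot P (V x) / dot e (V x).

(** * Uniqueness of abnormal arcs *)

Section Graphs.
Context {R : realType}.
Implicit Types (e P x z : R * R) (V : R * R -> R * R) (c : R -> R * R).

Lemma slope_lip e P V A (r K mu : R) x z : nice V A r K -> 0 <= K -> 0 < mu ->
  n1 x <= r -> n1 z <= r -> mu <= `|dot e (V x)| -> mu <= `|dot e (V z)| ->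
  `|slope e P V x - slope e P V z| <= (n1 P * K / mu + n1 P * K * n1 e * K / mu ^+ 2) * n1 (x - z).
Proof.
move=> nV K0 mu0 hx hz ex ez.
have ex0 : dot e (V x) != 0 by rewrite -normr_gt0 (lt_le_trans mu0).
have ez0 : dot e (V z) != 0 by rewrite -normr_gt0 (lt_le_trans mu0).
have [_ _ /(_ _ hx)[l _]] := nV z hz; have [Vz _ _] := nV z hz.
have -> : slope e P V x - slope e P V z =
   dot P (V x - V z) / dot e (V x) - dot P (V z) * dot e (V x - V z) / (dot e (V x) * dot e (V z)).
  by rewrite /slope !dotBr; field; rewrite ex0 ez0.
have d1 q : `|dot q (V x - V z)| <= n1 q * (K * n1 (x - z)).
  by rewrite (le_trans (n1_dot _ _)) // ler_wpM2l ?n1_ge0.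
have d2 : `|dot P (V z)| <= n1 P * K by rewrite (le_trans (n1_dot _ _)) // ler_wpM2l ?n1_ge0.
apply: le_trans (ler_normB _ _) _; rewrite [leRHS]mulrDl.
apply: lerD; rewrite !normrM !normfV ?normrM.
  have -> : n1 P * K / mu * n1 (x - z) = n1 P * (K * n1 (x - z)) * mu^-1 by ring.
  by apply: ler_pM; rewrite ?invr_ge0 // lef_pV2 ?posrE // (lt_le_trans mu0).
have -> : n1 P * K * n1 e * K / mu ^+ 2 * n1 (x - z) =
  (n1 P * K) * (n1 e * (K * n1 (x - z))) * (mu ^+ 2)^-1 by ring.
apply: ler_pM; rewrite ?mulr_ge0 ?invr_ge0 ?mulr_ge0 //; first by apply: ler_pM.
have p : 0 < `|dot e (V x)| * `|dot e (V z)| by rewrite mulr_gt0 // (lt_le_trans mu0).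
by rewrite lef_pV2 ?posrE ?exprn_gt0 // expr2 ler_pM // ltW.
Qed.

(** While [dot e (V x) >= mu], the abscissa increases at rate at least [mu / 2] and can replace time
    as parameter; [sg] is its inverse, obtained from the intermediate value theorem. Eliminating
    [s' - s] between the increments of abscissa and ordinate gives the slope equation, again with
    quadratic error. *)
Lemma graph e P V A (r K C h mu rho : R) c : nice V A r K -> 0 <= K -> 0 <= C -> 0 < h ->
  0 < mu -> 0 < rho ->
  (forall s : R, 0 <= s <= h -> n1 (c s) <= r) -> follows V c 0 h C ->
  (forall x, n1 x <= r -> n1 (x - c 0) <= rho -> mu <= dot e (V x)) ->
  exists (h0 h1 C' : R) (sg : R -> R),
    [/\ 0 < h0, 0 < h1 <= h, 0 <= C',
     (forall a : R, 0 <= a <= h0 -> [/\ 0 <= sg a <= h1, (0 < a -> 0 < sg a),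
        n1 (c (sg a) - c 0) <= rho & dot e (c (sg a) - c 0) = a]) /\
     (forall s : R, 0 <= s <= h1 -> 0 <= dot e (c s - c 0) <= h0 /\ sg (dot e (c s - c 0)) = s) &
     forall a a' : R, 0 <= a <= h0 -> 0 <= a' <= h0 ->
      `|dot P (c (sg a') - c 0) - dot P (c (sg a) - c 0) - slope e P V (c (sg a)) * (a' - a)|
      <= C' * (a' - a) ^+ 2].
Proof.
move=> nV K0 C0 h00 mu0 rho0 cr fc Hmu.
pose B := K + `|C| * h; have B0 : 0 <= B by rewrite addr_ge0 // mulr_ge0 // ltW.
have Bp : 0 < B + 1 by rewrite ltr_wpDl.
have lip := follows_lip _ _ _ _ _ _ _ nV cr fc.
pose D := n1 e * C + 1; have Dp : 0 < D by rewrite ltr_wpDl // mulr_ge0 ?n1_ge0.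
(* The second bound keeps the curve within [rho] of its start, the third makes the quadratic error
   at most half of the linear growth of the abscissa. *)
pose h1 := Num.min h (Num.min (rho / (B + 1)) (mu / 2 / D)).
have h1p : 0 < h1 by rewrite !lt_min h00 !divr_gt0.
have h1h : h1 <= h by rewrite ge_min lexx.
have h1r : h1 * (B + 1) <= rho by rewrite -ler_pdivlMr // !ge_min lexx !orbT.
have h1D : h1 * D <= mu / 2 by rewrite -ler_pdivlMr // !ge_min lexx !orbT.
have sub (s : R) : 0 <= s <= h1 -> 0 <= s <= h by move=> /andP[-> s1]; rewrite (le_trans s1).
have z0 : 0 <= (0 : R) <= h1 by rewrite lexx ltW.
have near0 (s : R) : 0 <= s <= h1 -> n1 (c s - c 0) <= rho.
  move=> hs; have /andP[s0 s1] := hs; rewrite (le_trans (lip _ _ (sub _ z0) (sub _ hs))) //.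
  rewrite subr0 (ger0_norm s0) -/B (le_trans _ h1r) //.
  have Bs : B * s <= B * h1 by rewrite ler_wpM2l.
  flra.
have muc (s : R) : 0 <= s <= h1 -> mu <= dot e (V (c s)).
  by move=> hs; apply: Hmu; [apply/cr/sub|exact: near0].
pose al s := dot e (c s - c 0); pose be s := dot P (c s - c 0).
have dal p (s s' : R) : 0 <= s <= h1 -> 0 <= s' <= h1 ->
    `|dot p (c s' - c 0) - dot p (c s - c 0) - dot p (V (c s)) * (s' - s)| <= n1 p * C * (s' - s) ^+ 2.
  move=> hs hs'; have f := fc s s' (sub _ hs) (sub _ hs').
  have -> : dot p (c s' - c 0) - dot p (c s - c 0) - dot p (V (c s)) * (s' - s) =
      dot p (c s' - c s - (s' - s) *: V (c s)) by rewrite /dot /= /GRing.scale /=; ring.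
  by rewrite (le_trans (n1_dot _ _)) // -mulrA ler_wpM2l ?n1_ge0.
have inc (s s' : R) : 0 <= s <= h1 -> 0 <= s' <= h1 -> s <= s' -> mu / 2 * (s' - s) <= al s' - al s.
  move=> hs hs' ss; have := dal e s s' hs hs'; rewrite -/(al s) -/(al s') => d.
  have := ler_norm (- (al s' - al s - dot e (V (c s)) * (s' - s))); rewrite normrN => d2.
  have m : mu * (s' - s) <= dot e (V (c s)) * (s' - s) by rewrite ler_wpM2r ?subr_ge0 // muc.
  have q : n1 e * C * (s' - s) ^+ 2 <= mu / 2 * (s' - s).
    rewrite expr2 mulrA ler_wpM2r ?subr_ge0 // (le_trans _ h1D) // mulrC.
    apply: ler_pM; rewrite ?subr_ge0 ?mulr_ge0 ?n1_ge0 //; last by rewrite lerDl.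
    by move: hs hs' => /andP[? ?] /andP[? ?]; flra.
  flra.
have al0 : al 0 = 0 by rewrite /al subrr /dot /= !mulr0 addr0.
have cal : {within `[0, h1]%classic, continuous al}.
  apply: (@lip_within _ _ _ _ (n1 e * B)) => s s' hs hs'.
  rewrite /al -dotBr (_ : c s' - c 0 - (c s - c 0) = c s' - c s); last by apply: vecP; rewrite /=; ring.
  rewrite (le_trans (n1_dot _ _)) // -mulrA ler_wpM2l ?n1_ge0 //.
  exact: lip (sub _ hs) (sub _ hs').
have hh1 : 0 <= h1 <= h1 by rewrite lexx ltW.
pose h0 := al h1.
have h0p : 0 < h0.
  by have := inc 0 h1 z0 hh1 (ltW h1p); rewrite al0 !subr0; apply: lt_le_trans; rewrite mulr_gt0 // divr_gt0.
have /choice [sg Hsg] : forall a : R, exists s : R, 0 <= a <= h0 -> 0 <= s <= h1 /\ al s = a.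
  move=> a; have [ha|_] := boolP (0 <= a <= h0); last by exists 0.
  have [|s] := @IVT R al 0 h1 a (ltW h1p) cal.
    by rewrite al0 min_l ?max_r ?(ltW h0p).
  by rewrite in_itv /= => hs sa; exists s.
have inj (s s' : R) : 0 <= s <= h1 -> 0 <= s' <= h1 -> al s = al s' -> s = s'.
  have m2 : 0 < mu / 2 by rewrite divr_gt0.
  move=> hs hs' E; have [ss|ss] := leP s s'.
    have := inc s s' hs hs' ss; rewrite E subrr pmulr_rle0 // subr_le0 => ?; by apply/le_anti/andP.
  have := inc s' s hs' hs (ltW ss); rewrite E subrr pmulr_rle0 // subr_le0 => ?.
  by apply/le_anti; rewrite (ltW ss) andbT.
have Q0 : 0 <= n1 P * C + n1 P * K / mu * (n1 e * C).
  apply: addr_ge0; first by rewrite mulr_ge0 ?n1_ge0.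
  by rewrite mulr_ge0 ?mulr_ge0 ?n1_ge0 ?invr_ge0 // ltW.
pose C' := (n1 P * C + n1 P * K / mu * (n1 e * C)) * (2 / mu) ^+ 2.
exists h0, h1, C', sg; split=> //.
- by rewrite h1p.
- exact: mulr_ge0 Q0 (sqr_ge0 _).
- split=> [a ha|s hs].
    have [s1 sa] := Hsg a ha; split=> //; last exact: near0.
    move=> a0; have /andP[s0 _] := s1; rewrite lt_neqAle s0 andbT eq_sym.
    by apply: contraTneq a0 => E; rewrite -sa E al0 ltxx.
  have as_ : 0 <= al s <= h0.
    have /andP[s0 s1] := hs; have m2 : 0 <= mu / 2 by rewrite divr_ge0 // ltW.
    have i1 := inc 0 s z0 hs s0; have i2 := inc s h1 hs hh1 s1.
    have j1 : 0 <= mu / 2 * (s - 0) by rewrite mulr_ge0 // subr0.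
    have j2 : 0 <= mu / 2 * (h1 - s) by rewrite mulr_ge0 // subr_ge0.
    by rewrite al0 in i1; apply/andP; split; rewrite /h0; flra.
  by split=> //; apply: inj => //; [case: (Hsg _ as_)|case: (Hsg _ as_)].
move=> a a' ha ha'; have [s1 sa] := Hsg a ha; have [s1' sa'] := Hsg a' ha'.
move: (sg a) (sg a') s1 s1' sa sa' => s s' hs hs' sa sa'.
rewrite -sa -sa'; set m := slope _ _ _ _; set N := (_ ^+ 2).
have ev := muc s hs; have ev0 : 0 < dot e (V (c s)) by exact: lt_le_trans ev.
have mE : m * dot e (V (c s)) = dot P (V (c s)) by rewrite /m /slope divfK // gt_eqF.
have mb : `|m| <= n1 P * K / mu.
  rewrite /m /slope normrM normfV (gtr0_norm ev0) ler_pM ?invr_ge0 ?(ltW ev0) //.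
    have [Vs _ _] := nV _ (cr _ (sub _ hs)).
    by rewrite (le_trans (n1_dot _ _)) // ler_wpM2l ?n1_ge0.
  by rewrite lef_pV2 ?posrE.
have -> : dot P (c s' - c 0) - dot P (c s - c 0) - m * (al s' - al s) =
   (dot P (c s' - c 0) - dot P (c s - c 0) - dot P (V (c s)) * (s' - s)) -
   m * (al s' - al s - dot e (V (c s)) * (s' - s)).
  by rewrite -mE; ring.
have ds : (s' - s) ^+ 2 <= (2 / mu) ^+ 2 * N.
  rewrite /N -exprMn -[leLHS](real_normK (num_real _)) -[leRHS](real_normK (num_real _)).
  rewrite lerXn2r ?nnegrE // normrM (gtr0_norm (_ : 0 < 2 / mu)) ?divr_gt0 //.
  have m2 : 0 < mu / 2 by rewrite divr_gt0.
  rewrite -(ler_pM2l m2) mulrA (_ : mu / 2 * (2 / mu) = 1); last by field; rewrite gt_eqF.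
  rewrite mul1r; have [ss|ss] := leP s s'.
    rewrite (ger0_norm (_ : 0 <= s' - s)) ?subr_ge0 // (le_trans (inc s s' hs hs' ss)) //.
    exact: ler_norm.
  rewrite distrC (ger0_norm (_ : 0 <= s - s')) ?subr_ge0 ?(ltW ss) //.
  by rewrite (le_trans (inc s' s hs' hs (ltW ss))) // distrC ler_norm.
rewrite (le_trans (ler_normB _ _)) // normrM.
have q1 := dal P s s' hs hs'; have q2 := dal e s s' hs hs'.
have q3 := ler_pM (normr_ge0 m) (normr_ge0 _) mb q2.
rewrite (le_trans (lerD q1 q3)) // /C' -mulrA -[leRHS]mulrA.
have -> : n1 P * (C * (s' - s) ^+ 2) + n1 P * K / mu * (n1 e * C * (s' - s) ^+ 2) =
  (n1 P * C + n1 P * K / mu * (n1 e * C)) * (s' - s) ^+ 2 by ring.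
by rewrite ler_wpM2l.
Qed.

End Graphs.

Section Comparison.
Context {R : realType}.
Implicit Types (e P x z y : R * R) (U : R * R -> R * R).

(** Orthogonal vectors of equal norm in the plane differ by a right angle in one direction or the
    other; each case is a computation. *)
Lemma frame_decomp e P z (N : R) : dot e P = 0 -> dot e e = N -> dot P P = N -> N != 0 ->
  z = (dot e z / N) *: e + (dot P z / N) *: P.
Proof.
move=> eP ee PP N0.
have key : (P.1 = - e.2 /\ P.2 = e.1) \/ (P.1 = e.2 /\ P.2 = - e.1).
  have h1 : (P.1 - e.2) * (P.1 + e.2) = 0.
    have : P.1 ^+ 2 * N = e.2 ^+ 2 * N.
      rewrite -{1}ee -PP /dot !mulrDr.
      have E : e.1 * P.1 = - (e.2 * P.2) by apply/eqP; rewrite -addr_eq0; apply/eqP.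
      have E2 : (e.1 * P.1) ^+ 2 = (e.2 * P.2) ^+ 2 by rewrite E sqrrN.
      rewrite !exprMn in E2; nra.
    move=> /(mulIf N0) h; rewrite -subr_sqr h; ring.
  have E : e.1 * P.1 + e.2 * P.2 = 0 := eP.
  move: h1 => /eqP; rewrite mulf_eq0 => /orP[/eqP h|/eqP h].
    have p1 : P.1 = e.2 by flra.
    have [e2|e2] := eqVneq e.2 0.
      have p2 : (P.2 - e.1) * (P.2 + e.1) = 0.
        by move: PP; rewrite -ee /dot p1 e2; nra.
      move: p2 => /eqP; rewrite mulf_eq0 => /orP[/eqP h2|/eqP h2].
        left; split; [by rewrite p1 e2 oppr0|flra].
      by right; split=> //; flra.
    right; split=> //; apply: (mulfI e2); rewrite p1 in E; flra.
  have p1 : P.1 = - e.2 by flra.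
  have [e2|e2] := eqVneq e.2 0.
    have p2 : (P.2 - e.1) * (P.2 + e.1) = 0.
      by move: PP; rewrite -ee /dot p1 e2; nra.
    move: p2 => /eqP; rewrite mulf_eq0 => /orP[/eqP h2|/eqP h2].
      by left; split=> //; flra.
    by right; split; [rewrite p1 e2 oppr0|flra].
  left; split=> //; apply: (mulfI e2); rewrite p1 in E; flra.
have EE : e.1 * e.1 + e.2 * e.2 = N := ee.
have a1 : z = (N / N) *: z by rewrite divff // scale1r.
rewrite {1}a1 -{1}EE; apply: vecP; rewrite /= /GRing.scale /= /dot;
  by case: key => -[-> ->]; ring.
Qed.

(** Translates signs of pairings into inequalities of slopes: a covector orthogonal to [U x]
    measures on which side of the line of slope [slope e P U x] a vector lies. *)
Lemma normal_slope e P n U x w (N : R) : dot e P = 0 -> dot e e = N -> dot P P = N -> N != 0 ->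
  dot e (U x) != 0 -> dot n (U x) = 0 ->
  N * dot n w = dot P n * (dot P w - slope e P U x * dot e w).
Proof.
move=> eP ee PP N0 eU nU.
have dd q : N * dot n q = dot e n * dot e q + dot P n * dot P q.
  have D := frame_decomp e P n N eP ee PP N0.
  rewrite {1}D dotDl !dotZl; field; exact: N0.
have en : dot e n = - slope e P U x * dot P n.
  have := dd (U x); rewrite nU mulr0 /slope => E.
  apply: (mulIf eU); rewrite mulNr mulNr mulrAC divfK //; flra.
by rewrite dd en; ring.
Qed.

Lemma slopeN e P U x : slope e P (fun q => - U q) x = slope e P U x.
Proof.
rewrite /slope; have dN p q : dot p (- q) = - dot p q by rewrite /dot /=; ring.
by rewrite !dN invrN mulrNN.
Qed.

Lemma near_dot e U A (r K : R) y : nice U A r K -> 0 <= K -> n1 y <= r -> 0 < dot e (U y) ->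
  exists mu rho : R, [/\ 0 < mu, 0 < rho &
    forall x, n1 x <= r -> n1 (x - y) <= rho -> mu <= dot e (U x)].
Proof.
move=> nU K0 hy e0; have Q : 0 < n1 e * K + 1 by rewrite ltr_wpDl // mulr_ge0 ?n1_ge0.
exists (dot e (U y) / 2), (dot e (U y) / 2 / (n1 e * K + 1)).
split; rewrite ?divr_gt0 // => x hx; rewrite ler_pdivlMr // => xy.
have [_ _ /(_ _ hx)[l _]] := nU y hy.
have : `|dot e (U x - U y)| <= n1 e * (K * n1 (x - y)).
  by rewrite (le_trans (n1_dot _ _)) // ler_wpM2l ?n1_ge0.
rewrite dotBr => h; have := ler_norm (- (dot e (U x) - dot e (U y))); rewrite normrN.
have := n1_ge0 (x - y); nra.
Qed.

(** Provides the points at which [graphs_order] compares two curves issued from the same point on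
    the same side. *)
Lemma same_abscissa e Ua Ub Aa Ab (ra rb K C ha hb : R) ca cb :
  nice Ua Aa ra K -> nice Ub Ab rb K -> 0 <= K -> 0 <= C -> 0 < ha -> 0 < hb ->
  (forall s : R, 0 <= s <= ha -> n1 (ca s) <= ra) ->
  (forall s : R, 0 <= s <= hb -> n1 (cb s) <= rb) ->
  follows Ua ca 0 ha C -> follows Ub cb 0 hb C -> ca 0 = cb 0 ->
  0 < dot e (Ua (ca 0)) -> 0 < dot e (Ub (cb 0)) ->
  exists2 h : R, 0 < h <= ha & forall s : R, 0 <= s <= h -> exists s' : R,
    [/\ 0 <= s' <= hb, 0 < s -> 0 < s' & dot e (ca s - cb s') = 0].
Proof.
move=> na nb K0 C0 ha0 hb0 car cbr fa fb ab ea eb.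
have z0 (h : R) : 0 < h -> 0 <= (0 : R) <= h by move=> h0; rewrite lexx ltW.
have [ma [rha [ma0 rha0 Ha]]] := near_dot e _ _ _ _ _ na K0 (car _ (z0 _ ha0)) ea.
have [mb [rhb [mb0 rhb0 Hb]]] := near_dot e _ _ _ _ _ nb K0 (cbr _ (z0 _ hb0)) eb.
(* Only abscissas are compared, so [e] also stands for the direction of the ordinate. *)
have [h0 [h1 [C1 [sg [h00 /andP[h10 h11] _ [ga1 ga2] _]]]]] := graph e e _ _ _ _ _ _ _ _ _ na K0 C0 ha0 ma0 rha0 car fa Ha.
have [h0' [h1' [C1' [sg' [h00' /andP[h10' h11'] _ [gb1 gb2] _]]]]] := graph e e _ _ _ _ _ _ _ _ _ nb K0 C0 hb0 mb0 rhb0 cbr fb Hb.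
pose B := K + `|C| * ha; have B0 : 0 <= B by rewrite addr_ge0 // mulr_ge0 // ltW.
have Q : 0 < n1 e * B + 1 by rewrite ltr_wpDl // mulr_ge0 ?n1_ge0.
pose h := Num.min h1 (h0' / (n1 e * B + 1)).
have hh : h <= h1 by rewrite ge_min lexx.
exists h; first by rewrite lt_min h10 divr_gt0 //= (le_trans hh).
move=> s /andP[s0 sh]; have hs1 : 0 <= s <= h1 by rewrite s0 (le_trans sh).
have hsa : 0 <= s <= ha by rewrite s0 (le_trans sh) // (le_trans hh).
have [/andP[a0 a1] sgs] := ga2 s hs1; set a := dot e (ca s - ca 0) in a0 a1 sgs.
have aB : a <= h0'.
  have : `|a| <= n1 e * (B * s).
    rewrite (le_trans (n1_dot _ _)) // ler_wpM2l ?n1_ge0 //.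
    have := follows_lip _ _ _ _ _ _ _ na car fa 0 s (z0 _ ha0) hsa.
    by rewrite subr0 (ger0_norm s0).
  have : s * (n1 e * B + 1) <= h0' by rewrite -ler_pdivlMr // (le_trans sh) // ge_min lexx orbT.
  have := ler_norm a; flra.
have [/andP[q0 q1] q2 _ q3] := gb1 a (ltac:(by rewrite a0)).
exists (sg' a); split; first by rewrite q0 (le_trans q1).
  move=> sp; apply: q2; rewrite lt_neqAle a0 andbT; apply: contraTneq sp => az.
  have [_ e0] := ga2 0 (z0 _ h10); move: e0; rewrite subrr (_ : dot e 0 = 0) => [e0|]; last by rewrite /dot /= !mulr0 addr0.
  by rewrite -sgs -az e0 ltxx.
have -> : ca s - cb (sg' a) = (ca s - ca 0) - (cb (sg' a) - cb 0).
  by rewrite ab; apply: vecP; rewrite /=; ring.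
by rewrite dotBr q3 subrr.
Qed.

(** Comparison principle for the slope equations. The slopes are ordered only at points of [ca]; the
    Lipschitz bound on the slope of [Ub] pays for evaluating it at [cb] instead, and Gronwall's
    lemma keeps the negative part of the difference at zero. *)
Lemma graphs_order e P Ua Ub Aa Ab (r K C N ha hb : R) ca cb :
  dot e P = 0 -> dot e e = N -> dot P P = N -> 0 < N ->
  nice Ua Aa r K -> nice Ub Ab r K -> 0 <= K -> 0 <= C -> 0 < ha -> 0 < hb ->
  (forall s : R, 0 <= s <= ha -> n1 (ca s) <= r) ->
  (forall s : R, 0 <= s <= hb -> n1 (cb s) <= r) ->
  follows Ua ca 0 ha C -> follows Ub cb 0 hb C -> ca 0 = cb 0 ->
  0 < dot e (Ua (ca 0)) -> 0 < dot e (Ub (cb 0)) ->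
  (forall s : R, 0 <= s <= ha -> slope e P Ub (ca s) <= slope e P Ua (ca s)) ->
  exists2 h : R, 0 < h <= Num.min ha hb & forall s s' : R, 0 <= s <= h -> 0 <= s' <= h ->
    dot e (ca s - cb s') = 0 -> 0 <= dot P (ca s - cb s').
Proof.
move=> eP ee PP N0 na nb K0 C0 ha0 hb0 car cbr fa fb ab ea eb Hs.
have z0 (h : R) : 0 < h -> 0 <= (0 : R) <= h by move=> h0; rewrite lexx ltW.
set y := cb 0 in ab eb *; rewrite ab in ea.
have hy : n1 y <= r by apply/cbr/z0.
have [ma [rha [ma0 rha0 Ha]]] := near_dot e _ _ _ _ _ na K0 hy ea.
have [mb [rhb [mb0 rhb0 Hb]]] := near_dot e _ _ _ _ _ nb K0 hy eb.
pose rho := Num.min rha rhb.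
have rho0 : 0 < rho by rewrite lt_min rha0.
have Ha' : forall x, n1 x <= r -> n1 (x - ca 0) <= rho -> ma <= dot e (Ua x).
  by move=> x hx; rewrite ab le_min => /andP[h1 _]; apply: Ha.
have Hb' : forall x, n1 x <= r -> n1 (x - cb 0) <= rho -> mb <= dot e (Ub x).
  by move=> x hx; rewrite le_min => /andP[_ h1]; apply: Hb.
have [h0 [h1 [C1 [sg [h00 /andP[h10 h11] C10 [ga1 ga2] gi]]]]] :=
  graph e P _ _ _ _ _ _ _ _ _ na K0 C0 ha0 ma0 rho0 car fa Ha'.
have [h0' [h1' [C1' [sg' [h00' /andP[h10' h11'] C10' [gb1 gb2] gi']]]]] :=
  graph e P _ _ _ _ _ _ _ _ _ nb K0 C0 hb0 mb0 rho0 cbr fb Hb'.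
(* At equal abscissas the two points differ by [D a / N] times [P], which explains the factor
   [n1 P / N]. *)
pose K1 := (n1 P * K / mb + n1 P * K * n1 e * K / mb ^+ 2) * (n1 P / N).
have K10 : 0 <= K1.
  apply: mulr_ge0; last by rewrite divr_ge0 ?n1_ge0 // ltW.
  by apply: addr_ge0; rewrite ?mulr_ge0 ?n1_ge0 ?invr_ge0 ?sqr_ge0 // ltW.
have K1p : 0 < 2 * K1 + 1 by flra.
pose H := Num.min (Num.min h0 h0') (2 * K1 + 1)^-1.
have H0 : 0 < H by rewrite !lt_min h00 h00' invr_gt0.
have KH : K1 * H <= 2^-1.
  have : H * (2 * K1 + 1) <= 1 by rewrite -ler_pdivlMr // div1r ge_min lexx orbT.
  flra.
have Hh (a : R) : 0 <= a <= H -> 0 <= a <= h0 /\ 0 <= a <= h0'.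
  by move=> /andP[a0]; rewrite !le_min => /andP[/andP[a1 a2] _]; rewrite a0 a1 a2.
pose xa a := ca (sg a); pose xb a := cb (sg' a).
pose D a := dot P (xa a - xb a).
have DE a : D a = dot P (xa a - ca 0) - dot P (xb a - cb 0).
  by rewrite /D -dotBr ab; congr dot; apply: vecP; rewrite /=; ring.
have lip (a : R) : 0 <= a <= H -> `|slope e P Ub (xa a) - slope e P Ub (xb a)| <= K1 * `|D a|.
  move=> /Hh[hA hB].
  have [/andP[s0 s1] _ n_a ea1] := ga1 a hA; have [/andP[s0' s1'] _ n_b eb1] := gb1 a hB.
  have ra : n1 (xa a) <= r by apply: car; rewrite s0 (le_trans s1).
  have rb : n1 (xb a) <= r by apply: cbr; rewrite s0' (le_trans s1').
  have ea' : mb <= `|dot e (Ub (xa a))|.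
    by rewrite (le_trans _ (ler_norm _)) // Hb' // -/y -ab.
  have eb' : mb <= `|dot e (Ub (xb a))| by rewrite (le_trans _ (ler_norm _)) // Hb'.
  rewrite (le_trans (slope_lip e P _ _ _ _ mb _ _ nb K0 mb0 ra rb ea' eb')) // /K1 -[leRHS]mulrA.
  apply: ler_wpM2l.
    by apply: addr_ge0; rewrite ?mulr_ge0 ?n1_ge0 ?invr_ge0 ?sqr_ge0 // ltW.
  have e0 : dot e (xa a - xb a) = 0.
    have -> : xa a - xb a = (xa a - ca 0) - (xb a - cb 0) by rewrite ab; apply: vecP; rewrite /=; ring.
    by rewrite dotBr ea1 eb1 subrr.
  rewrite (frame_decomp e P (xa a - xb a) N eP ee PP (lt0r_neq0 N0)) e0 mul0r scale0r add0r -/(D a).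
  by rewrite n1Z normrM normfV (gtr0_norm N0) mulrC -mulrA [_^-1 * _]mulrC mulrA mulrC mulrA.
pose f a := Num.max (- D a) 0.
have D0 : D 0 = 0.
  have [_ e1] := ga2 0 (z0 _ h10); have [_ e2] := gb2 0 (z0 _ h10').
  move: e1 e2; rewrite !subrr (_ : dot e 0 = 0); last by rewrite /dot /= !mulr0 addr0.
  by move=> e1 e2; rewrite /D /xa /xb e1 e2 ab subrr /dot /= !mulr0 addr0.
have f0 : f 0 = 0 by rewrite /f D0 oppr0 maxxx.
have fz (a : R) : 0 <= a <= H -> f a <= 0.
  move=> hA; have := @gronwall_quad _ f H K1 0 (C1 + C1') (ltW H0) K10 (lexx _) KH _ _ a hA.
  rewrite f0 mul0r addr0 mulr0; apply=> [q _|b b' b0 bb bH].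
    by rewrite /f le_max lexx orbT.
  have hb_ : 0 <= b <= H by rewrite b0 (le_trans bb).
  have hb_' : 0 <= b' <= H by rewrite (le_trans b0).
  have [p1 p2] := Hh b hb_; have [p1' p2'] := Hh b' hb_'.
  have i1 := gi b b' p1 p1'; have i2 := gi' b b' p2 p2'.
  rewrite -/(xa b) -/(xa b') in i1; rewrite -/(xb b) -/(xb b') in i2.
  have [/andP[s0 s1] _ _ _] := ga1 b p1.
  have sl : slope e P Ub (xa b) <= slope e P Ua (xa b) by apply: Hs; rewrite s0 (le_trans s1).
  have l := lip b hb_.
  have l' := ler_norm (- (slope e P Ub (xa b) - slope e P Ub (xb b))); rewrite normrN in l'.
  have b1 := ler_norm (- (dot P (xa b' - ca 0) - dot P (xa b - ca 0) - slope e P Ua (xa b) * (b' - b))).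
  have b2 := ler_norm (dot P (xb b' - cb 0) - dot P (xb b - cb 0) - slope e P Ub (xb b) * (b' - b)).
  rewrite normrN in b1.
  have bb0 : 0 <= b' - b by rewrite subr_ge0.
  have s3 : (slope e P Ub (xa b) - slope e P Ub (xb b)) * (b' - b) <=
            (slope e P Ua (xa b) - slope e P Ub (xb b)) * (b' - b).
    by rewrite ler_wpM2r // lerD2r.
  have s4 : - (slope e P Ub (xa b) - slope e P Ub (xb b)) * (b' - b) <= K1 * `|D b| * (b' - b).
    by rewrite ler_wpM2r // (le_trans l').
  have main : - D b' <= - D b + K1 * `|D b| * (b' - b) + (C1 + C1') * (b' - b) ^+ 2.
    rewrite !DE; rewrite DE in s4; move: b1 b2 i1 i2 s3 s4; clear; flra.
  have Kb : K1 * (b' - b) <= 2^-1.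
    by rewrite (le_trans _ KH) // ler_wpM2l // (le_trans _ bH) // gerBl.
  have Cb : 0 <= (C1 + C1') * (b' - b) ^+ 2 by rewrite mulr_ge0 ?sqr_ge0 ?addr_ge0.
  rewrite mul0r addr0 lerBlDl {1}/f ge_max; apply/andP; split.
    have [Db|Db] := leP (D b) 0.
      by rewrite /f max_l ?oppr_ge0 // (ler0_norm Db) in main *; move: main; clear; flra.
    rewrite /f max_r ?oppr_le0 ?(ltW Db) // (gtr0_norm Db) in main *.
    have : K1 * (b' - b) * D b <= 2^-1 * D b by rewrite ler_wpM2r // ltW.
    move: main Db; clear; flra.
  have fb0 : 0 <= f b by rewrite /f le_max lexx orbT.
  have := mulr_ge0 (mulr_ge0 K10 fb0) bb0.
  move: Cb fb0; clear; flra.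
pose B := K + `|C| * ha; have B0 : 0 <= B by rewrite addr_ge0 // mulr_ge0 // ltW.
have Q : 0 < n1 e * B + 1 by rewrite ltr_wpDl // mulr_ge0 ?n1_ge0.
pose h := Num.min (Num.min h1 h1') (H / (n1 e * B + 1)).
have hq : h <= Num.min h1 h1' by rewrite ge_min lexx.
exists h.
  rewrite !lt_min h10 h10' divr_gt0 //= le_min; move: hq; rewrite le_min => /andP[q1 q2].
  by rewrite (le_trans q1) // (le_trans q2).
move=> s s' /andP[s0 sh] /andP[s0' sh'] es.
move: hq; rewrite le_min => /andP[q1 q2].
have hs : 0 <= s <= h1 by rewrite s0 (le_trans sh).
have hs' : 0 <= s' <= h1' by rewrite s0' (le_trans sh').
have hsa : 0 <= s <= ha by rewrite s0 (le_trans sh) // (le_trans q1).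
have [/andP[a0 a1] sgs] := ga2 s hs; have [_ sgs'] := gb2 s' hs'.
have Eab : dot e (cb s' - cb 0) = dot e (ca s - ca 0).
  apply/eqP; rewrite eq_sym -subr_eq0 -dotBr (_ : _ - _ = ca s - cb s') ?es //.
  by rewrite ab; apply: vecP; rewrite /=; ring.
rewrite Eab in sgs'; set a := dot e (ca s - ca 0) in a0 a1 sgs sgs'.
have aH : 0 <= a <= H.
  rewrite a0 /=; have : `|a| <= n1 e * (B * s).
    rewrite (le_trans (n1_dot _ _)) // ler_wpM2l ?n1_ge0 //.
    have := follows_lip _ _ _ _ _ _ _ na car fa 0 s (z0 _ ha0) hsa.
    by rewrite subr0 (ger0_norm s0).
  have : s * (n1 e * B + 1) <= H by rewrite -ler_pdivlMr // (le_trans sh) // ge_min lexx orbT.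
  have := ler_norm a; flra.
have := fz a aH; rewrite /f ge_max => /andP[Da _].
by move: Da; rewrite oppr_le0 /D /xa /xb sgs sgs'.
Qed.

End Comparison.

(** * Orientation of the covector along a piece *)

Section PieceCovectors.
Context {R : realType}.

Lemma lim_le0 (f : R -> R) (a h B : R) : 0 < h ->
  (forall s : R, a < s <= a + h -> f s <= 0) ->
  (forall s : R, a < s <= a + h -> `|f s - f a| <= B * (s - a)) -> f a <= 0.
Proof.
move=> h0 H1 H2; apply: (@le_of_le_pow2 _ _ (B * h)) => n.
pose e := h / 2 ^+ n; have p2 : 0 < 2 ^+ n :> R by rewrite exprn_gt0.
have e0 : 0 < e by rewrite divr_gt0.
have eh : e <= h by rewrite ler_pdivrMr // ler_peMr ?(ltW h0) // exprn_ege1 // ler1n.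
have hs : a < a + e <= a + h by rewrite ltrDl e0 lerD2l.
have := H1 _ hs; have := H2 _ hs; rewrite addrAC subrr add0r distrC => h2 h1.
have -> : B * h / 2 ^+ n = B * e by rewrite /e; ring.
by have := ler_norm (f a - f (a + e)); flra.
Qed.

Lemma n1_rot90 (p : R * R) : n1 (rot90 p) = n1 p.
Proof. by rewrite /n1 /rot90 /= normrN addrC. Qed.

Lemma dot_n1 (p : R * R) : n1 p ^+ 2 <= 2 * dot p p.
Proof.
rewrite /n1 /dot -!expr2 -(real_normK (num_real p.1)) -(real_normK (num_real p.2)).
by have := sqr_ge0 (`|p.1| - `|p.2|); nra.
Qed.

Lemma interior_margin (K : set (R * R)) c0 : einterior K c0 ->
  exists2 k : R, 0 < k & forall x p, normal K x p -> dot p (c0 - x) <= - k * n1 p.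
Proof.
move=> [e [e0 He]]; exists (e / 4); first by rewrite divr_gt0.
move=> x p N; have [->|p0] := eqVneq p 0; first by rewrite n10 mulr0 /dot /= !mul0r addr0.
have np : 0 < n1 p by rewrite lt_neqAle n1_ge0 andbT eq_sym; apply: contra_neq p0 => h; apply: n1_eq0; rewrite h.
pose k := e / (2 * n1 p); have k0 : 0 < k by rewrite divr_gt0 // mulr_gt0.
have : K (c0 + k *: p).
  apply: He; rewrite /eball /=; apply: le_lt_trans (edist_n1 _ _) _.
  rewrite n1C [c0 + _]addrC addrK n1Z (gtr0_norm k0) /k.
  by rewrite (_ : e / (2 * n1 p) * n1 p = e / 2) ?gtr_pMr ?invf_lt1 ?ltr1n //; field; rewrite gt_eqF.
move=> /N; rewrite (_ : c0 + k *: p - x = (c0 - x) + k *: p); last by apply: vecP; rewrite /=; ring.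
rewrite dotDr dotZr => h.
have : e / 4 * n1 p <= k * dot p p.
  have -> : e / 4 * n1 p = k * (n1 p ^+ 2 / 2) by rewrite /k; field; rewrite gt_eqF.
  rewrite ler_pM2l //; have := dot_n1 p; flra.
flra.
Qed.

Context {M : nat}.
Variables (F : R * R -> R * R) (G : 'I_M -> R * R -> R * R) (L : R).
Hypotheses (hF : C11_vec L F) (hG : forall i, C11_vec L (G i)).
Variable calT : R.
Hypothesis ha : forall t, 0 < t < calT -> prop_a F G t.
Notation X w := (fun x => Defs.field F G x w).

Lemma abnormalZ t x p (k : R) : 0 < k -> abnormal F G t x p -> abnormal F G t x (k *: p).
Proof.
move=> k0 [p0 N H]; split.
- by rewrite scaler_eq0 negb_or p0 gt_eqF.
- exact: normalZ (ltW k0) N.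
- by move=> w w1; rewrite dotZl mulr_ge0 ?H // ltW.
Qed.

Lemma reach_mono (s s' : R) x : s <= s' -> reach F G s x -> reach F G s' x.
Proof. by move=> ss; rewrite /reach /= => h; rewrite (le_trans h) // lee_fin. Qed.

(** Supplies the point against which orientations are tested: the midpoint of [z] and the origin,
    interior by strict convexity. As the sublevel sets grow, one point and one margin serve for all
    [s >= s0]. *)
Lemma reach_margin (s0 : R) z : 0 < s0 < calT -> reach F G s0 z -> z <> (0, 0) ->
  exists c0 (k : R), 0 < k /\ forall (s : R) x p, s0 <= s -> normal (reach F G s) x p ->
    dot p (c0 - x) <= - k * n1 p.
Proof.
move=> hs rz z0; have [sc _] := ha _ hs; have /andP[s00 _] := hs.
have r0 : reach F G s0 (0, 0) by rewrite /reach /= (minT0 F G L hF hG) lee_fin ltW.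
have := sc z (0, 0) 2^-1 rz r0 z0 (ltac:(apply/andP; split; flra)).
move=> /interior_margin [k k0 H]; exists (vcomb 2^-1 z (0, 0)), k; split=> // s x p ss N.
by apply: H => q rq; apply: N; exact: reach_mono ss rq.
Qed.

Lemma arc_setup t Y : 0 <= t -> abnormal_arc F G t Y ->
  exists r B K : R, [/\ 0 <= r, 0 <= B, 0 <= K,
    forall w : 'I_M -> R, (forall i, `|w i| <= 1) -> nice (X w) (fieldD F G w) r K &
    (forall s : R, 0 <= s <= t -> n1 (Y s) <= r) /\
    forall s s' : R, 0 <= s <= t -> 0 <= s' <= t -> n1 (Y s' - Y s) <= B * `|s' - s|].
Proof.
move=> t0 [[B lip] _ _ _ _].
have lip' (s s' : R) : 0 <= s <= t -> 0 <= s' <= t -> n1 (Y s' - Y s) <= `|B| * `|s' - s|.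
  by move=> hs hs'; rewrite (le_trans (lip _ _ hs hs')) // ler_wpM2r // ler_norm.
pose r := n1 (Y 0) + `|B| * t.
have r0 : 0 <= r by rewrite addr_ge0 ?n1_ge0 // mulr_ge0.
have [K K0 nK] := field_nice F G L r r0 hF hG.
exists r, `|B|, K; split=> //; split=> // s hs; have /andP[s0 st] := hs.
have := lip' 0 s (ltac:(by rewrite lexx)) hs; rewrite subr0 (ger0_norm s0).
have := n1D (Y s - Y 0) (Y 0); rewrite subrK.
have : `|B| * s <= `|B| * t by rewrite ler_wpM2l.
rewrite /r; flra.
Qed.

(** A zero of the velocity would freeze the arc after [s], or before [s] if [s = b], against
    [arc_time]. *)
Lemma arc_field_neq0 t Y (v : 'I_M -> R) (a b C s : R) : abnormal_arc F G t Y ->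
  (forall i, `|v i| <= 1) -> 0 <= a -> a < b -> b <= t ->
  follows (fun x => - Defs.field F G x v) Y a b C -> a <= s <= b ->
  Defs.field F G (Y s) v != 0.
Proof.
move=> arc v1 a0 ab bt fY /andP[as_ sb]; apply/eqP => V0.
have t0 : 0 <= t by flra.
have [r [B [K [r0 B0 K0 nK [Yr lip]]]]] := arc_setup t Y t0 arc.
have nv := nK v v1.
have Kp : 0 < 2 * K + 1 by flra.
have Ty := arc_time _ _ _ _ arc.
have Kh (h : R) : h <= (2 * K + 1)^-1 -> 0 <= h -> K * h <= 2^-1.
  move=> hk h0; have : h * (2 * K + 1) <= 1 by rewrite -ler_pdivlMr // div1r.
  flra.
have [s_b|bs] := ltP s b.
  pose h := Num.min (b - s) (2 * K + 1)^-1.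
  have h0 : 0 < h by rewrite lt_min subr_gt0 s_b invr_gt0.
  have hb : h <= b - s by rewrite ge_min lexx.
  have hk : h <= (2 * K + 1)^-1 by rewrite ge_min lexx orbT.
  have f : follows (fun x => - Defs.field F G x v) (fun q => Y (s + q)) 0 h C.
    by have := follows_shift _ _ _ _ _ s fY; apply: follows_sub; flra.
  have := stationary _ _ _ _ _ _ _ (nice_opp _ _ _ _ nv) K0 (ltW h0) (Kh _ hk (ltW h0)) _ f.
  rewrite addr0 V0 oppr0 => /(_ _ erefl h (ltac:(by rewrite lexx ltW))) => E.
  have hs : 0 <= s <= t by apply/andP; split; flra.
  have hsh : 0 <= s + h <= t by apply/andP; split; flra.
  have : minT F G (Y (s + h)) = minT F G (Y s).
    congr minT; apply: E => q /andP[q0 qh]; apply: Yr; apply/andP; split; flra.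
  by rewrite !Ty // => -[]; flra.
pose h := Num.min (s - a) (2 * K + 1)^-1.
have h0 : 0 < h by rewrite lt_min invr_gt0 Kp andbT; flra.
have hb : h <= s - a by rewrite ge_min lexx.
have hk : h <= (2 * K + 1)^-1 by rewrite ge_min lexx orbT.
have f : follows (fun x => - - Defs.field F G x v) (fun q => Y (s - q)) 0 h C.
  by have := follows_rev _ _ _ _ _ s fY; apply: follows_sub; flra.
have := stationary _ _ _ _ _ _ _ (nice_opp _ _ _ _ (nice_opp _ _ _ _ nv)) K0 (ltW h0) (Kh _ hk (ltW h0)) _ f.
rewrite subr0 V0 !oppr0 => /(_ _ erefl h (ltac:(by rewrite lexx ltW))) => E.
have hs : 0 <= s <= t by apply/andP; split; flra.
have hsh : 0 <= s - h <= t by apply/andP; split; flra.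
have : minT F G (Y (s - h)) = minT F G (Y s).
  congr minT; apply: E => q /andP[q0 qh]; apply: Yr; apply/andP; split; flra.
by rewrite !Ty // => -[]; flra.
Qed.

(** Towards the origin the arc moves inside the sublevel set, so normality gives one sign of the
    pairing with the velocity and the last clause of [abnormal] gives the other. *)
Lemma arc_perp t Y (v : 'I_M -> R) (a b C s : R) p : abnormal_arc F G t Y ->
  (forall i, `|v i| <= 1) -> 0 <= C -> 0 <= a -> b <= t ->
  follows (fun x => - Defs.field F G x v) Y a b C -> a < s <= b ->
  abnormal F G s (Y s) p -> dot p (Defs.field F G (Y s) v) = 0.
Proof.
move=> arc v1 C0 a0 bt fY /andP[as_ sb] [p0 N H]; apply/le_anti; rewrite H // andbT.
have f : follows (X v) (fun q => Y (s - q)) 0 (s - a) C.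
  have f1 := follows_rev _ _ _ _ _ s fY.
  have : follows (fun x => - - Defs.field F G x v) (fun q => Y (s - q)) 0 (s - a) C.
    by move: f1; apply: follows_sub; flra.
  by move=> f2 q q' hq hq'; have := f2 q q' hq hq'; rewrite opprK.
have := forward_le _ _ _ _ p _ C0 f; rewrite subr0; apply; first by rewrite subr_gt0.
move=> q /andP[q0 qs]; apply: N; rewrite /reach /= (arc_time _ _ _ _ arc) ?lee_fin; first flra.
by apply/andP; split; flra.
Qed.

(** At each time the covector is a multiple of the rotated velocity with an unknown sign. That sign
    is read off from the pairing [g] with an interior point, which is Lipschitz in time and nonzero
    at [s0], so it is constant near [s0]. *)
Lemma piece_abnormal t Y (v : 'I_M -> R) (a b C s0 : R) : abnormal_arc F G t Y -> t < calT ->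
  (forall i, `|v i| <= 1) -> 0 <= C -> 0 < a -> a < b -> b <= t ->
  follows (fun x => - Defs.field F G x v) Y a b C -> a <= s0 <= b ->
  exists ep h : R, [/\ `|ep| = 1, 0 < h & forall s : R, a <= s <= b -> `|s - s0| <= h ->
    abnormal F G s (Y s) (ep *: rot90 (Defs.field F G (Y s) v))].
Proof.
move=> arc tc v1 C0 a0 ab bt fY hs0; have /andP[as0 s0b] := hs0.
have t0 : 0 <= t by flra.
have [r [B [K [r0 B0 K0 nK [Yr lip]]]]] := arc_setup t Y t0 arc.
have Ty := arc_time _ _ _ _ arc.
pose V := X v; have nv : nice V (fieldD F G v) r K := nK v v1.
have in_ (s : R) : a <= s <= b -> 0 <= s <= t by move=> /andP[? ?]; apply/andP; split; flra.
have V0 (s : R) : a <= s <= b -> V (Y s) != 0.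
  by move=> hs; apply: (arc_field_neq0 t Y v a b C s arc) => //; exact: ltW.
have Vp (s : R) : a <= s <= b -> 0 < n1 (V (Y s)).
  move=> hs; rewrite lt_neqAle n1_ge0 andbT eq_sym.
  by apply: contra_neq (V0 s hs) => h; apply: n1_eq0; rewrite h.
have haa : a <= a <= b by rewrite lexx ltW.
have Ya : Y a <> (0, 0).
  move=> E; have := Ty a (in_ _ haa); rewrite E (minT0 F G L hF hG) => -[]; flra.
have rYa : reach F G a (Y a) by rewrite /reach /= Ty ?in_.
have [c0 [k [k0 Hk]]] := reach_margin a (Y a) (ltac:(apply/andP; split; flra)) rYa Ya.
have LV (s s' : R) : a <= s <= b -> a <= s' <= b -> n1 (V (Y s') - V (Y s)) <= K * B * `|s' - s|.
  move=> hs hs'; have [_ _ /(_ _ (Yr _ (in_ _ hs')))[l _]] := nv _ (Yr _ (in_ _ hs)).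
  by rewrite (le_trans l) // -mulrA ler_wpM2l // lip // in_.
have Lc z (s s' : R) : a <= s <= b -> a <= s' <= b ->
    `|cross (V (Y s')) (z - Y s') - cross (V (Y s)) (z - Y s)| <=
    (K * B * (n1 z + r) + K * B) * `|s' - s|.
  move=> hs hs'.
  have -> : cross (V (Y s')) (z - Y s') - cross (V (Y s)) (z - Y s) =
    cross (V (Y s') - V (Y s)) (z - Y s') - cross (V (Y s)) (Y s' - Y s) by rewrite /cross /=; ring.
  rewrite (le_trans (ler_normB _ _)) // mulrDl lerD //.
    rewrite (le_trans (n1_cross _ _)) // mulrAC ler_pM ?n1_ge0 ?LV //.
    by rewrite (le_trans (n1B _ _)) // lerD2l Yr ?in_.
  rewrite (le_trans (n1_cross _ _)) // -mulrA ler_pM ?n1_ge0 ?lip ?in_ //.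
  by have [] := nv _ (Yr _ (in_ _ hs)).
have LW (w : 'I_M -> R) (s s' : R) : (forall i, `|w i| <= 1) -> a <= s <= b -> a <= s' <= b ->
    `|cross (V (Y s')) (X w (Y s')) - cross (V (Y s)) (X w (Y s))| <= (K * B * K + K * (K * B)) * `|s' - s|.
  move=> w1 hs hs'; have nw := nK w w1.
  have -> : cross (V (Y s')) (X w (Y s')) - cross (V (Y s)) (X w (Y s)) =
    cross (V (Y s') - V (Y s)) (X w (Y s')) + cross (V (Y s)) (X w (Y s') - X w (Y s)) by rewrite /cross /=; ring.
  have [W1 _ _] := nw _ (Yr _ (in_ _ hs')).
  have [_ _ /(_ _ (Yr _ (in_ _ hs')))[l _]] := nw _ (Yr _ (in_ _ hs)).
  rewrite (le_trans (ler_normD _ _)) // mulrDl lerD //.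
    by rewrite (le_trans (n1_cross _ _)) // mulrAC ler_pM ?n1_ge0 ?LV.
  rewrite (le_trans (n1_cross _ _)) // -mulrA ler_pM ?n1_ge0 //.
    by have [] := nv _ (Yr _ (in_ _ hs)).
  by rewrite (le_trans l) // -mulrA ler_wpM2l // lip // in_.
pose g s := cross (V (Y s)) (c0 - Y s).
pose Bg := K * B * (n1 c0 + r) + K * B.
have Bg0 : 0 <= Bg by rewrite addr_ge0 ?mulr_ge0 ?addr_ge0 ?n1_ge0.
have sgn (s : R) : a < s <= b -> exists e : R, [/\ `|e| = 1,
    abnormal F G s (Y s) (e *: rot90 (V (Y s))) & e * g s <= - k * n1 (V (Y s))].
  move=> /andP[as_ sb]; have hs : a <= s <= b by rewrite ltW.
  have [p ap_] := arc_abnormal _ _ _ _ arc s (ltac:(apply/andP; split; flra)).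
  have pV := arc_perp t Y v a b C s p arc v1 C0 (ltW a0) bt fY (ltac:(by rewrite as_)) ap_.
  have E := perp_rot _ _ (V0 s hs) pV; set q := (_ / _) in E.
  have q0 : q != 0 by have [p0 _ _] := ap_; apply: contra_neq p0 => h; rewrite E h scale0r.
  exists (Num.sg q); rewrite normr_sg q0; split=> //.
    have := abnormalZ _ _ _ (`|q|^-1) _ ap_; rewrite E scalerA invr_gt0 normr_gt0 => /(_ q0).
    by rewrite {2}[q]numEsg mulrCA mulVf ?mulr1 // normr_eq0.
  have [_ Np _] : abnormal F G s (Y s) (Num.sg q *: rot90 (V (Y s))).
    have := abnormalZ _ _ _ (`|q|^-1) _ ap_; rewrite E scalerA invr_gt0 normr_gt0 => /(_ q0).
    by rewrite {2}[q]numEsg mulrCA mulVf ?mulr1 // normr_eq0.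
  have := Hk s _ _ (ltW as_) Np; rewrite dotZl dot_rot n1Z normr_sg q0 mul1r.
  by rewrite n1_rot90.
(* At [s0 = a] the control to the left of [a] may be another one and [arc_perp] does not apply; the
   bound is then a limit from the right. *)
have gs0 : k * n1 (V (Y s0)) <= `|g s0|.
  have ge (s : R) : a < s <= b -> k * n1 (V (Y s)) - `|g s| <= 0.
    move=> hs; have [e [e1 _ h]] := sgn s hs.
    have := ler_norm (- (e * g s)); rewrite normrN normrM e1 mul1r; flra.
  have [as1|as1] := ltP a s0; first by have := ge s0 (ltac:(by rewrite as1)); flra.
  have Ea : s0 = a by apply/le_anti; rewrite as1 as0.
  rewrite Ea -subr_le0.
  apply: (@lim_le0 (fun s => k * n1 (V (Y s)) - `|g s|) a (b - a) (k * (K * B) + Bg)).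
  - by rewrite subr_gt0.
  - by move=> s /andP[h1 h2]; apply: ge; rewrite h1 /=; flra.
  move=> s /andP[h1 h2]; have hs : a <= s <= b by apply/andP; split; flra.
  have i1 : `|n1 (V (Y s)) - n1 (V (Y a))| <= K * B * (s - a).
    have := LV a s haa hs; rewrite (ger0_norm (_ : 0 <= s - a)) ?subr_ge0 ?(ltW h1) // => l.
    have := n1D (V (Y s) - V (Y a)) (V (Y a)); rewrite subrK.
    have := n1D (V (Y a) - V (Y s)) (V (Y s)); rewrite subrK n1C.
    by move=> ? ?; rewrite ler_norml; apply/andP; split; flra.
  have i2 := Lc c0 a s haa hs; rewrite (ger0_norm (_ : 0 <= s - a)) ?subr_ge0 ?(ltW h1) // in i2.
  have i3 := ler_dist_dist (g s) (g a).
  have -> : k * n1 (V (Y s)) - `|g s| - (k * n1 (V (Y a)) - `|g a|) =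
    k * (n1 (V (Y s)) - n1 (V (Y a))) - (`|g s| - `|g a|) by ring.
  rewrite (le_trans (ler_normB _ _)) // normrM (gtr0_norm k0) mulrDl lerD //.
    by rewrite -mulrA ler_pM2l.
  exact: le_trans i3 i2.
have ga0 : 0 < `|g s0| by rewrite (lt_le_trans _ gs0) // mulr_gt0 // Vp.
(* The pairing of a normal with the direction of an interior point is negative, hence the minus
   sign. *)
pose ep := - Num.sg (g s0).
have g0 : g s0 != 0 by rewrite -normr_gt0.
have ep1 : `|ep| = 1 by rewrite normrN normr_sg g0.
have epg : ep * g s0 = - `|g s0| by rewrite mulNr normrEsg.
pose h := `|g s0| / 2 / (Bg + 1).
have Bp : 0 < Bg + 1 by rewrite ltr_wpDl.
have hp : 0 < h by rewrite !divr_gt0.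
have good (s : R) : a < s <= b -> `|s - s0| <= h -> abnormal F G s (Y s) (ep *: rot90 (V (Y s))).
  move=> hs sh; have [e [e1 abn eg]] := sgn s hs; have /andP[h1 h2] := hs.
  have hs' : a <= s <= b by rewrite ltW.
  suff -> : ep = e by [].
  have l : `|ep * g s - ep * g s0| <= `|g s0| / 2.
    rewrite -mulrBr normrM ep1 mul1r (le_trans (Lc c0 s0 s hs0 hs')) // -/Bg.
    have : `|s - s0| * (Bg + 1) <= `|g s0| / 2 by rewrite -ler_pdivlMr.
    by have := normr_ge0 (s - s0); flra.
  have neg : ep * g s < 0.
    by have := ler_norm (ep * g s - ep * g s0); rewrite epg in l *; flra.
  have negs : e * g s < 0.
    apply: le_lt_trans eg _; rewrite mulNr oppr_lt0 mulr_gt0 // Vp //.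
  have sgn1 q : `|q| = 1 -> q = 1 \/ q = -1 :> R.
    move=> q1; have [q0|q0] := leP 0 q; first by left; rewrite -q1 ger0_norm.
    by right; rewrite -q1 ltr0_norm // opprK.
  case: (sgn1 _ e1) => Ee; case: (sgn1 _ ep1) => Eep; rewrite Ee Eep //; exfalso;
    by rewrite Ee in negs; rewrite Eep in neg; flra.
exists ep, (h / 2); split=> //; first by rewrite divr_gt0.
move=> s hs sh; have /andP[h1 h2] := hs.
have [as_|sa] := ltP a s; first by apply: good; rewrite ?as_ //; flra.
have Es : s = a by apply/le_anti; rewrite sa h1.
rewrite {}Es in sh hs h1 h2 *.
(* At the left end the three clauses of [abnormal] pass to the limit, the sign being already fixed
   on the right. *)
pose h3 := Num.min (h / 2) (b - a).
have h30 : 0 < h3 by rewrite lt_min divr_gt0 // subr_gt0.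
have g3 (q : R) : a < q <= a + h3 -> a < q <= b /\ abnormal F G q (Y q) (ep *: rot90 (V (Y q))).
  move=> /andP[q1 q2]; have q3 : h3 <= h / 2 by rewrite ge_min lexx.
  have q4 : h3 <= b - a by rewrite ge_min lexx orbT.
  have q5 : a < q <= b by rewrite q1; flra.
  split=> //; apply: good => //.
  have -> : q - s0 = (q - a) + (a - s0) by ring.
  rewrite (le_trans (ler_normD _ _)) // (gtr0_norm (_ : 0 < q - a)) ?subr_gt0 //; flra.
split.
- by rewrite scaler_eq0 negb_or rot90_neq0 ?V0 // andbT -normr_eq0 ep1 oner_eq0.
- move=> z rz; rewrite dotZl dot_rot.
  apply: (@lim_le0 (fun q => ep * cross (V (Y q)) (z - Y q)) a h3 (K * B * (n1 z + r) + K * B)) => // q hq.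
    have [/andP[q1 q2] [_ N _]] := g3 q hq.
    by have := N z (reach_mono _ _ _ (ltW q1) rz); rewrite dotZl dot_rot.
  have [/andP[q1 q2] _] := g3 q hq.
  rewrite -mulrBr normrM ep1 mul1r.
  have := Lc z a q haa (ltac:(by rewrite ltW)).
  by rewrite (ger0_norm (_ : 0 <= q - a)) ?subr_ge0 ?(ltW q1).
- move=> w w1; rewrite dotZl dot_rot -oppr_le0.
  apply: (@lim_le0 (fun q => - (ep * cross (V (Y q)) (X w (Y q)))) a h3 (K * B * K + K * (K * B))) => // q hq.
    have [_ [_ _ H]] := g3 q hq; rewrite oppr_le0.
    by have := H w w1; rewrite dotZl dot_rot.
  have [/andP[q1 q2] _] := g3 q hq.
  rewrite -opprD normrN -mulrBr normrM ep1 mul1r.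
  have := LW w a q w1 haa (ltac:(by rewrite ltW)).
  by rewrite (ger0_norm (_ : 0 <= q - a)) ?subr_ge0 ?(ltW q1).
Qed.

End PieceCovectors.

(** * Neither cusps nor branching *)

Section Branching.
Context {R : realType}.

Lemma follows_le V (c : R -> R * R) (a b C C' : R) : C <= C' -> follows V c a b C ->
  follows V c a b C'.
Proof.
by move=> CC f s s' hs hs'; rewrite (le_trans (f s s' hs hs')) // ler_wpM2r ?sqr_ge0.
Qed.

(** Abnormality read as an order of slopes. The field [W] runs against [e], so dividing by
    [dot e (W x)] reverses the inequality given by [normal_slope]. *)
Lemma slope_le (e P n x : R * R) V W (N : R) : dot e P = 0 -> dot e e = N -> dot P P = N -> 0 < N ->
  dot e (V x) != 0 -> dot e (W x) < 0 -> 0 < dot P n -> dot n (V x) = 0 -> 0 <= dot n (W x) ->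
  slope e P W x <= slope e P V x.
Proof.
move=> eP ee PP N0 eV eW Pn nV nW.
have E := normal_slope e P n V x (W x) N eP ee PP (lt0r_neq0 N0) eV nV.
have : 0 <= dot P n * (dot P (W x) - slope e P V x * dot e (W x)) by rewrite -E mulr_ge0 // ltW.
rewrite pmulr_rge0 // subr_ge0 => h.
by rewrite {1}/slope ler_ndivrMr.
Qed.

Lemma small_step (Y : R -> R * R) (B rho : R) : 0 <= B -> 0 < rho ->
  exists2 h : R, 0 < h & forall s s' : R, n1 (Y s' - Y s) <= B * `|s' - s| -> `|s' - s| <= h ->
    n1 (Y s' - Y s) <= rho.
Proof.
move=> B0 rho0; have Bp : 0 < B + 1 by rewrite ltr_wpDl.
exists (rho / (B + 1)); first by rewrite divr_gt0.
move=> s s' l; rewrite ler_pdivlMr // => h; have := normr_ge0 (s' - s); flra.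
Qed.

Lemma rot90_inj (p q : R * R) : rot90 p = rot90 q -> p = q.
Proof.
by move=> h; apply: vecP; [exact: (congr1 snd h)|exact: (oppr_inj (congr1 fst h))].
Qed.

Context {M : nat}.
Variables (F : R * R -> R * R) (G : 'I_M -> R * R -> R * R) (L : R).
Hypotheses (hF : C11_vec L F) (hG : forall i, C11_vec L (G i)).
Variable calT : R.
Hypothesis ha : forall t, 0 < t < calT -> prop_a F G t.
Notation X w := (fun x => Defs.field F G x w).

(** Both covectors are orthogonal to the velocity of the incoming piece, hence collinear; both pair
    negatively with the direction of an interior point, hence they point the same way. Undoing the
    rotations leaves the sign [ep * ep0]. *)
Lemma covector_parallel t Y (v0 v : 'I_M -> R) (a C0 s0 ep0 ep : R) :
  abnormal_arc F G t Y -> t < calT -> (forall i, `|v0 i| <= 1) ->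
  0 <= C0 -> 0 < a -> a < s0 -> s0 <= t ->
  follows (fun x => - Defs.field F G x v0) Y a s0 C0 ->
  `|ep0| = 1 -> `|ep| = 1 ->
  abnormal F G s0 (Y s0) (ep0 *: rot90 (X v0 (Y s0))) ->
  abnormal F G s0 (Y s0) (ep *: rot90 (X v (Y s0))) ->
  exists2 l : R, 0 < l & X v (Y s0) = (ep * ep0 * l) *: X v0 (Y s0).
Proof.
move=> arc tc v01 C00 a0 as0 s0t f0 ep01 ep1 ab0 ab.
have Ty := arc_time _ _ _ _ arc.
have hs : 0 <= s0 <= t by apply/andP; split; flra.
have Z0 : X v0 (Y s0) != 0.
  by apply: (arc_field_neq0 F G L hF hG t Y v0 a s0 C0 s0 arc) => //; rewrite ?(ltW a0) ?(ltW as0) ?lexx.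
have pZ := arc_perp F G t Y v0 a s0 C0 s0 _ arc v01 C00 (ltW a0) s0t f0 (ltac:(by rewrite as0 lexx)) ab.
have E := perp_rot _ _ Z0 pZ; set k := (_ / _) in E.
have Y0 : Y s0 <> (0, 0).
  by move=> h; have := Ty s0 hs; rewrite h (minT0 F G L hF hG) => -[]; flra.
have [c0 [kk [kk0 Hk]]] := reach_margin F G L hF hG calT ha s0 (Y s0)
  (ltac:(apply/andP; split; flra)) (ltac:(by rewrite /reach /= Ty)) Y0.
have sq q : `|q| = 1 -> q * q = 1 :> R by move=> h; rewrite -expr2 -(real_normK (num_real q)) h expr1n.
have neg p : abnormal F G s0 (Y s0) p -> dot p (c0 - Y s0) < 0.
  move=> [p0 N _]; apply: le_lt_trans (Hk s0 _ _ (lexx _) N) _.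
  rewrite mulNr oppr_lt0 mulr_gt0 // lt_neqAle n1_ge0 andbT eq_sym.
  by apply: contra_neq p0 => h; apply: n1_eq0; rewrite h.
have n0 := neg _ ab0; have n1' := neg _ ab; rewrite E in n1'.
rewrite !dotZl in n0 n1'.
exists (k * ep0).
  set d := dot _ _ in n0 n1'.
  have : 0 < (k * d) * (ep0 * d) by rewrite nmulr_rgt0.
  have -> : k * d * (ep0 * d) = (k * ep0) * d ^+ 2 by ring.
  rewrite pmulr_lgt0 // lt_neqAle sqr_ge0 andbT eq_sym sqrf_eq0.
  by apply: contraTneq n0 => ->; rewrite mulr0 ltxx.
apply: rot90_inj; have rZ (q : R) (p : R * R) : rot90 (q *: p) = q *: rot90 p.
  by apply: vecP; rewrite /= /GRing.scale /= ?mulrN.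
have -> : rot90 (X v (Y s0)) = ep *: (ep *: rot90 (X v (Y s0))) by rewrite scalerA sq // scale1r.
rewrite E rZ scalerA; congr (_ *: _).
by rewrite -mulrA [ep0 * _]mulrC -mulrA sq // mulr1.
Qed.

(* If the arc turned back at [s0], its two branches would be graphs over the same side of
   the common tangent, ordered one way by normality and the other way by [abnormal]:
   they would meet at points with different times-to-go. *)
Lemma no_cusp t Y (v0 v : 'I_M -> R) (a b C0 C s0 ep0 ep h0 h : R) :
  abnormal_arc F G t Y -> t < calT ->
  (forall i, `|v0 i| <= 1) -> (forall i, `|v i| <= 1) ->
  0 <= C0 -> 0 <= C -> 0 < a -> a < s0 -> s0 < b -> b <= t -> 0 < h0 -> 0 < h ->
  follows (fun x => - Defs.field F G x v0) Y a s0 C0 ->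
  follows (fun x => - Defs.field F G x v) Y s0 b C ->
  `|ep0| = 1 -> `|ep| = 1 ->
  (forall s : R, a <= s <= s0 -> `|s - s0| <= h0 ->
    abnormal F G s (Y s) (ep0 *: rot90 (X v0 (Y s)))) ->
  (forall s : R, s0 <= s <= b -> `|s - s0| <= h ->
    abnormal F G s (Y s) (ep *: rot90 (X v (Y s)))) ->
  ep = ep0.
Proof.
move=> arc tc v01 v1 C00 C0' a0 as0 s0b bt h00 h0' f0 f ep01 ep1 ab0 ab.
have Ty := arc_time _ _ _ _ arc.
have zz : `|s0 - s0| <= 0 by rewrite subrr normr0.
have hs0 : 0 <= s0 <= t by apply/andP; split; flra.
have [l l0 Vl] := covector_parallel t Y v0 v a C0 s0 ep0 ep arc tc v01 C00 a0 as0
  (ltac:(flra)) f0 ep01 ep1 (ab0 s0 (ltac:(by rewrite lexx ltW)) (le_trans zz (ltW h00)))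
  (ab s0 (ltac:(by rewrite lexx ltW)) (le_trans zz (ltW h0'))).
have sgn1 q : `|q| = 1 -> q = 1 \/ q = -1 :> R.
  move=> q1; have [q0|q0] := leP 0 q; first by left; rewrite -q1 ger0_norm.
  by right; rewrite -q1 ltr0_norm // opprK.
have [//|epn] : ep = ep0 \/ ep * ep0 = -1.
  by case: (sgn1 _ ep1) => ->; case: (sgn1 _ ep01) => ->; [left|right|right|left]; rewrite ?mulr1 ?mul1r.
exfalso; rewrite epn mulN1r in Vl.
have ep0sq : ep0 * ep0 = 1 by case: (sgn1 _ ep01) => ->; rewrite ?mulrNN mulr1.
have t0 : 0 <= t by flra.
have [r [B [K [r0 B0 K0 nK [Yr lip]]]]] := arc_setup F G L hF hG t Y t0 arc.
pose Z := X v0; pose V := X v.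
have nZ : nice Z _ r K := nK v0 v01; have nV : nice V _ r K := nK v v1.
have nVN := nice_opp _ _ _ _ nV.
(* Seen from [Y s0], both branches leave in the direction [e], because [V] is opposite to [Z] there;
   [P] is the common covector direction. *)
pose e := Z (Y s0); pose P := ep0 *: rot90 e; pose N := dot e e.
have Z0 : e != 0.
  by apply: (arc_field_neq0 F G L hF hG t Y v0 a s0 C0 s0 arc) => //; rewrite ?(ltW a0) ?(ltW as0) ?lexx //; flra.
have N0 : 0 < N by exact: sqr_dot_eq0.
have eP : dot e P = 0 by rewrite /P dotZr dotC dot_rot /cross; ring.
have PP : dot P P = N.
  by rewrite /P dotZl dotZr mulrA ep0sq mul1r dot_rot /N /dot /cross /rot90 /=; ring.
have eZ : 0 < dot e (Z (Y s0)) by [].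
have eV : 0 < dot e (- V (Y s0)).
  rewrite /V Vl -/Z -/e -scaleNr opprK dotZr mulr_gt0 //.
have Pn w : dot P (ep0 *: rot90 w) = dot e w.
  by rewrite /P dotZl dotZr mulrA ep0sq mul1r /dot /rot90 /=; ring.
have Pn' w : dot P (ep *: rot90 w) = - dot e w.
  by rewrite /P dotZl dotZr mulrA [ep0 * ep]mulrC epn mulN1r /dot /rot90 /=; ring.
have Yr0 := Yr s0 hs0.
have [m1 [rh1 [m10 rh10 H1]]] := near_dot e _ _ _ _ _ nZ K0 Yr0 eZ.
have [m2 [rh2 [m20 rh20 H2]]] := near_dot e _ _ _ _ _ nVN K0 Yr0 eV.
have rh0 : 0 < Num.min rh1 rh2 by rewrite lt_min rh10.
have [hs hsp Hs] := small_step Y B _ B0 rh0.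
have near_ (s : R) : 0 <= s <= t -> `|s - s0| <= hs -> 0 < dot e (Z (Y s)) /\ dot e (V (Y s)) < 0.
  move=> hst sh; have := Hs s0 s (lip _ _ hs0 hst) sh; rewrite le_min => /andP[q1 q2].
  split; first exact: lt_le_trans (H1 _ (Yr s hst) q1).
  have := lt_le_trans m20 (H2 _ (Yr s hst) q2).
  by rewrite (_ : dot e (- V (Y s)) = - dot e (V (Y s))) ?oppr_gt0 // /dot /=; ring.
pose hA := Num.min (Num.min (s0 - a) h0) hs.
have hA0 : 0 < hA by rewrite !lt_min subr_gt0 as0 h00 hsp.
pose hB := Num.min (Num.min (b - s0) h) hs.
have hB0 : 0 < hB by rewrite !lt_min subr_gt0 s0b h0' hsp.
have inA (q : R) : 0 <= q <= hA -> [/\ 0 <= s0 - q <= t, a <= s0 - q <= s0, `|s0 - q - s0| <= h0 & `|s0 - q - s0| <= hs].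
  move=> /andP[q0]; rewrite !le_min => /andP[/andP[q1 q2] q3].
  rewrite addrAC subrr add0r normrN (ger0_norm q0); split=> //.
    by rewrite subr_ge0 (le_trans _ (ltW (lt_le_trans s0b bt))) ?gerBl // andbT (le_trans q1) // gerBl ltW.
  by rewrite gerBl q0 andbT lerBrDl -lerBrDr.
have inB (q : R) : 0 <= q <= hB -> [/\ 0 <= s0 + q <= t, s0 <= s0 + q <= b, `|s0 + q - s0| <= h & `|s0 + q - s0| <= hs].
  move=> /andP[q0]; rewrite !le_min => /andP[/andP[q1 q2] q3].
  rewrite addrAC subrr add0r (ger0_norm q0); split=> //; rewrite -lerBrDl ?lerDl ?q0 ?q1 // (le_trans q1) ?lerD2r // andbT.
  by rewrite addr_ge0 // ltW // (lt_trans a0).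
pose ca q := Y (s0 - q); pose cb q := Y (s0 + q).
have hAa : hA <= s0 - a by rewrite !ge_min lexx.
have hBb : hB <= b - s0 by rewrite !ge_min lexx.
have fa : follows Z ca 0 hA (C0 + C).
  have f1 := follows_rev _ _ _ _ _ s0 f0; rewrite subrr in f1.
  have f2 : follows (fun x => - - Defs.field F G x v0) ca 0 hA C0 by move: f1; apply: follows_sub.
  apply: (follows_le _ _ _ _ C0); first by rewrite lerDl.
  by move=> q q' hq hq'; have := f2 q q' hq hq'; rewrite opprK.
have fb : follows (fun x => - V x) cb 0 hB (C0 + C).
  apply: (follows_le _ _ _ _ C); first by rewrite lerDr.
  by have := follows_shift _ _ _ _ _ s0 f; apply: follows_sub; rewrite ?subrr.
have car (q : R) : 0 <= q <= hA -> n1 (ca q) <= r by move=> /inA [h1 _ _ _]; exact: Yr.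
have cbr (q : R) : 0 <= q <= hB -> n1 (cb q) <= r by move=> /inB [h1 _ _ _]; exact: Yr.
have ca0 : ca 0 = Y s0 by rewrite /ca subr0.
have cb0 : cb 0 = Y s0 by rewrite /cb addr0.
have CC : 0 <= C0 + C by rewrite addr_ge0.
have ab_ : ca 0 = cb 0 by rewrite ca0 cb0.
have ea : 0 < dot e (Z (ca 0)) by rewrite ca0.
have eb : 0 < dot e (- V (cb 0)) by rewrite cb0.
(* First order: abnormality along the branch [ca], tested with the control of the other branch. *)
have A (q : R) : 0 <= q <= hA -> slope e P (fun x => - V x) (ca q) <= slope e P Z (ca q).
  move=> /inA [q1 q2 q3 q4]; rewrite slopeN.
  have [z1 z2] := near_ _ q1 q4; have [_ _ H] := ab0 _ q2 q3.
  apply: (slope_le e P (ep0 *: rot90 (Z (ca q))) _ _ _ N) => //.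
  - by rewrite gt_eqF.
  - by rewrite Pn.
  - by rewrite dotZl dot_rot /cross (_ : _ - _ = 0) ?mulr0 //; ring.
  - exact: H.
have [h1 /andP[h10 h11] ord] := graphs_order e P _ _ _ _ r K (C0 + C) N hA hB ca cb eP erefl PP N0 nZ nVN K0 CC hA0 hB0 car cbr fa fb ab_ ea eb A.
move: h11; rewrite le_min => /andP[h1A h1B].
have fb' : follows (fun x => - V x) cb 0 h1 (C0 + C) by move: fb; apply: follows_sub.
have fa' : follows Z ca 0 h1 (C0 + C) by move: fa; apply: follows_sub.
have subA (q : R) : 0 <= q <= h1 -> 0 <= q <= hA by move=> /andP[-> q1]; rewrite (le_trans q1).
have subB (q : R) : 0 <= q <= h1 -> 0 <= q <= hB by move=> /andP[-> q1]; rewrite (le_trans q1).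
have [h2 /andP[h20 h21] ex] := same_abscissa e _ _ _ _ r r K (C0 + C) h1 h1 ca cb nZ nVN K0 CC h10 h10
  (fun q hq => car q (subA q hq)) (fun q hq => cbr q (subB q hq)) fa' fb' ab_ ea eb.
have hh2 : 0 <= h2 <= h2 by rewrite lexx ltW.
have [s' [s'1 _ es]] := ex h2 hh2.
have hh1 : 0 <= h2 <= h1 by rewrite (ltW h20).
have D0 := ord h2 s' hh1 s'1 es.
have [p1 p2 p3 p4] := inA _ (subA _ hh1); have [p1' p2' p3' p4'] := inB _ (subB _ s'1).
(* Second order, the opposite one: [ca h2] has the smaller time-to-go, hence lies in the sublevel
   set to which the covector at [cb s'] is normal. *)
have D1 : dot P (ca h2 - cb s') <= 0.
  have [_ Nn _] := ab _ p2' p3'.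
  have rc : reach F G (s0 + s') (ca h2).
    rewrite /reach /= Ty // lee_fin lerD2l (le_trans _ (_ : 0 <= s')) ?oppr_le0 ?(ltW h20) //.
    by have /andP[] := s'1.
  have [z1 z2] := near_ _ p1' p4'.
  have := Nn _ rc; rewrite -/(cb s') -/(V (cb s')) => I.
  have nVz : dot (ep *: rot90 (V (cb s'))) (V (cb s')) = 0.
    by rewrite dotZl dot_rot /cross (_ : _ - _ = 0) ?mulr0 //; ring.
  have E := normal_slope e P (ep *: rot90 (V (cb s'))) V (cb s') (ca h2 - cb s') N eP erefl PP
    (lt0r_neq0 N0) (ltac:(by rewrite lt_eqF)) nVz.
  rewrite es mulr0 subr0 Pn' in E.
  have : - dot e (V (cb s')) * dot P (ca h2 - cb s') <= 0 by rewrite -E pmulr_rle0.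
  by rewrite pmulr_rle0 // oppr_gt0.
have DZ : dot P (ca h2 - cb s') = 0 by apply/le_anti; rewrite D0 D1.
have : ca h2 - cb s' = 0.
  by rewrite (frame_decomp e P (ca h2 - cb s') N eP erefl PP (lt0r_neq0 N0)) es DZ !mul0r !scale0r addr0.
move=> /eqP; rewrite subr_eq0 => /eqP E.
(* The common point would have the times-to-go [s0 - h2] and [s0 + s'], where [h2 > 0] and
   [s' >= 0]. *)
have := Ty _ p1; rewrite -/(ca h2) E Ty // => -[].
have /andP[s'0 _] := s'1; move: s'0 h20; clear -hF hG; flra.
Qed.

End Branching.

Section Uniqueness.
Context {R : realType} {M : nat}.
Variables (F : R * R -> R * R) (G : 'I_M -> R * R -> R * R) (L : R).
Hypotheses (hF : C11_vec L F) (hG : forall i, C11_vec L (G i)).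
Variable calT : R.
Hypothesis ha : forall t, 0 < t < calT -> prop_a F G t.
Notation X w := (fun x => Defs.field F G x w).

(** Applied twice with the two arcs exchanged: each arc is abnormal against the control of the
    other, which gives both orders. *)
Lemma graphs_ordered_pair (e P : R * R) (ep r K C N h : R) (va vb : 'I_M -> R) ca cb y :
  dot e P = 0 -> dot e e = N -> dot P P = N -> 0 < N -> 0 <= K -> 0 <= C -> 0 < h ->
  (forall w : 'I_M -> R, (forall i, `|w i| <= 1) -> nice (X w) (fieldD F G w) r K) ->
  (forall i, `|va i| <= 1) -> (forall i, `|vb i| <= 1) ->
  (forall q : R, 0 <= q <= h -> n1 (ca q) <= r) -> (forall q : R, 0 <= q <= h -> n1 (cb q) <= r) ->
  follows (fun x => - X va x) ca 0 h C -> follows (fun x => - X vb x) cb 0 h C ->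
  ca 0 = y -> cb 0 = y -> dot e (X va y) < 0 -> dot e (X vb y) < 0 ->
  (forall w, dot P (ep *: rot90 w) = - dot e w) ->
  (forall q : R, 0 <= q <= h -> [/\ dot e (X va (ca q)) < 0, dot e (X vb (ca q)) < 0 &
     exists s : R, abnormal F G s (ca q) (ep *: rot90 (X va (ca q)))]) ->
  exists2 h' : R, 0 < h' <= h & forall s s' : R, 0 <= s <= h' -> 0 <= s' <= h' ->
    dot e (ca s - cb s') = 0 -> 0 <= dot P (ca s - cb s').
Proof.
move=> eP ee PP N0 K0 C0 h0 nK va1 vb1 car cbr fa fb ca0 cb0 ea eb Pn H.
have dN (p q : R * R) : dot p (- q) = - dot p q by rewrite /dot /=; ring.
have [||||h' hh H'] := graphs_order e P _ _ _ _ r K C N h h ca cb eP ee PP N0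
   (nice_opp _ _ _ _ (nK va va1)) (nice_opp _ _ _ _ (nK vb vb1)) K0 C0 h0 h0 car cbr fa fb.
- by rewrite ca0 cb0.
- by rewrite ca0 dN oppr_gt0.
- by rewrite cb0 dN oppr_gt0.
- move=> q hq; have [q1 q2 [s [_ _ A]]] := H q hq; rewrite !slopeN.
  apply: (slope_le e P (ep *: rot90 (X va (ca q))) _ _ _ N) => //.
  + by rewrite lt_eqF.
  + by rewrite Pn oppr_gt0.
  + by rewrite dotZl dot_rot /cross (_ : _ - _ = 0) ?mulr0 //; ring.
  + exact: A.
by exists h' => //; move: hh; rewrite minxx.
Qed.

(** By [no_cusp] both continuations inherit the orientation of the common past, so by
    [covector_parallel] their velocities are positive multiples of the same vector. As graphs they
    are ordered both ways, so they have the same image near [Y1 s0]. *)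
Lemma no_branch t1 t2 Y1 Y2 (s0 : R) :
  abnormal_arc F G t1 Y1 -> abnormal_arc F G t2 Y2 -> t1 < calT -> t2 < calT ->
  0 < s0 -> s0 < t1 -> s0 < t2 -> (forall s : R, 0 <= s <= s0 -> Y1 s = Y2 s) ->
  exists2 h : R, 0 < h & forall s : R, 0 <= s <= h -> Y1 (s0 + s) = Y2 (s0 + s).
Proof.
move=> arc1 arc2 tc1 tc2 s00 st1 st2 agree.
have Ty1 := arc_time _ _ _ _ arc1; have Ty2 := arc_time _ _ _ _ arc2.
have le1 (v : 'I_M -> R) : (forall i, `|v i| = 1) -> forall i, `|v i| <= 1 by move=> h i; rewrite h.
have [v0 [k0 [C0 [/le1 v01 k00 C00 k0s f0]]]] := arc_left _ _ _ _ arc1 s0 (ltac:(by rewrite s00 ltW)).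
have [v1 [k1 [C1 [/le1 v11 k10 C10 k1s f1]]]] := arc_right _ _ _ _ arc1 s0 (ltac:(by rewrite ltW)).
have [v2 [k2 [C2 [/le1 v21 k20 C20 k2s f2]]]] := arc_right _ _ _ _ arc2 s0 (ltac:(by rewrite ltW)).
(* Half of the left piece, so that [a > 0] even when that piece starts at the origin. *)
pose a := s0 - k0 / 2; have a0 : 0 < a by rewrite /a; flra.
have as0 : a < s0 by rewrite /a; flra.
have f0a : follows (fun x => - Defs.field F G x v0) Y1 a s0 C0.
  by move: f0; apply: follows_sub; rewrite /a; flra.
have f0b : follows (fun x => - Defs.field F G x v0) Y2 a s0 C0.
  move=> s s' hs hs'; move: (hs) (hs') => /andP[? ?] /andP[? ?].
  by rewrite -!agree ?f0a //; apply/andP; split; flra.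
have ss : Y2 s0 = Y1 s0 by rewrite agree // lexx ltW.
have [ep0 [h0 [ep01 h00 ab0]]] := piece_abnormal F G L hF hG calT ha t1 Y1 v0 a s0 C0 s0 arc1 tc1 v01 C00
  a0 as0 (ltW st1) f0a (ltac:(by rewrite lexx ltW)).
have ab0' (s : R) : a <= s <= s0 -> `|s - s0| <= h0 -> abnormal F G s (Y2 s) (ep0 *: rot90 (X v0 (Y2 s))).
  by move=> /andP[? ?] sh; rewrite -agree; [apply: ab0|]; rewrite //; apply/andP; split; flra.
have [ep1 [h1 [ep11 h10 ab1]]] := piece_abnormal F G L hF hG calT ha t1 Y1 v1 s0 (s0 + k1) C1 s0 arc1 tc1 v11 C10
  s00 (ltac:(flra)) k1s f1 (ltac:(apply/andP; split; flra)).
have [ep2 [h2 [ep21 h20 ab2]]] := piece_abnormal F G L hF hG calT ha t2 Y2 v2 s0 (s0 + k2) C2 s0 arc2 tc2 v21 C20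
  s00 (ltac:(flra)) k2s f2 (ltac:(apply/andP; split; flra)).
have E1 : ep1 = ep0.
  by apply: (no_cusp F G L hF hG calT ha t1 Y1 v0 v1 a (s0 + k1) C0 C1 s0 ep0 ep1 h0 h1) => //; flra.
have E2 : ep2 = ep0.
  by apply: (no_cusp F G L hF hG calT ha t2 Y2 v0 v2 a (s0 + k2) C0 C2 s0 ep0 ep2 h0 h2) => //; flra.
rewrite {}E1 in ep11 ab1; rewrite {}E2 in ep21 ab2.
have zz : `|s0 - s0| <= 0 by rewrite subrr normr0.
have hs0l : a <= s0 <= s0 by rewrite lexx ltW.
have ep0sq : ep0 * ep0 = 1 by rewrite -expr2 -(real_normK (num_real ep0)) ep01 expr1n.
have [l1 l10 V1] := covector_parallel F G L hF hG calT ha t1 Y1 v0 v1 a C0 s0 ep0 ep0 arc1 tc1 v01 C00 a0 as0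
  (ltW st1) f0a ep01 ep01 (ab0 s0 hs0l (le_trans zz (ltW h00)))
  (ab1 s0 (ltac:(apply/andP; split; flra)) (le_trans zz (ltW h10))).
have [l2 l20 V2] := covector_parallel F G L hF hG calT ha t2 Y2 v0 v2 a C0 s0 ep0 ep0 arc2 tc2 v01 C00 a0 as0
  (ltW st2) f0b ep01 ep01 (ab0' s0 hs0l (le_trans zz (ltW h00)))
  (ab2 s0 (ltac:(apply/andP; split; flra)) (le_trans zz (ltW h20))).
rewrite ep0sq mul1r in V1; rewrite ep0sq mul1r ss in V2.
set y := Y1 s0 in V1 V2 ss.
have t10 : 0 <= t1 by apply/ltW/(lt_trans s00).
have t20 : 0 <= t2 by apply/ltW/(lt_trans s00).
have [r1 [B1 [K1 [r10 B10 K10 _ [Yr1 lip1]]]]] := arc_setup F G L hF hG t1 Y1 t10 arc1.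
have [r2 [B2 [K2 [r20 B20 K20 _ [Yr2 lip2]]]]] := arc_setup F G L hF hG t2 Y2 t20 arc2.
pose r := r1 + r2; have r0 : 0 <= r by rewrite addr_ge0.
have [K K0 nK] := field_nice F G L r r0 hF hG.
have Yr1' (s : R) : 0 <= s <= t1 -> n1 (Y1 s) <= r by move=> /Yr1 q; rewrite (le_trans q) // lerDl.
have Yr2' (s : R) : 0 <= s <= t2 -> n1 (Y2 s) <= r by move=> /Yr2 q; rewrite (le_trans q) // lerDr.
pose Z := X v0.
(* The arcs run in reversed time, hence against the field. *)
pose e := - Z y; pose P := ep0 *: rot90 (Z y); pose N := dot e e.
have Z0 : Z y != 0.
  by apply: (arc_field_neq0 F G L hF hG t1 Y1 v0 a s0 C0 s0 arc1) => //; rewrite ?(ltW a0) ?(ltW as0) ?lexx //; flra.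
have dNr (p q : R * R) : dot p (- q) = - dot p q by rewrite /dot /=; ring.
have dNl (p q : R * R) : dot (- p) q = - dot p q by rewrite /dot /=; ring.
have NZ : N = dot (Z y) (Z y) by rewrite /N /e dNr dNl opprK.
have N0 : 0 < N by rewrite NZ; exact: sqr_dot_eq0.
have eP : dot e P = 0 by rewrite /P /e dNl dotZr dotC dot_rot /cross; ring.
have PP : dot P P = N.
  by rewrite NZ /P dotZl dotZr mulrA ep0sq mul1r dot_rot /dot /cross /rot90 /=; ring.
have Pn w : dot P (ep0 *: rot90 w) = - dot e w.
  by rewrite /P /e dNl opprK dotZl dotZr mulrA ep0sq mul1r /dot /rot90 /=; ring.
have eV1 : dot e (X v1 y) < 0 by rewrite V1 dotZr /e dNl -/Z -NZ mulrN oppr_lt0 mulr_gt0.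
have eV2 : dot e (X v2 y) < 0 by rewrite V2 dotZr /e dNl -/Z -NZ mulrN oppr_lt0 mulr_gt0.
have yr : n1 y <= r by apply: Yr1'; rewrite (ltW s00) ltW.
have eV1N : 0 < dot e (- X v1 y) by rewrite dNr oppr_gt0.
have eV2N : 0 < dot e (- X v2 y) by rewrite dNr oppr_gt0.
have [m1 [rh1 [m10 rh10 H1]]] := near_dot e _ _ _ _ _ (nice_opp _ _ _ _ (nK v1 v11)) K0 yr eV1N.
have [m2 [rh2 [m20 rh20 H2]]] := near_dot e _ _ _ _ _ (nice_opp _ _ _ _ (nK v2 v21)) K0 yr eV2N.
have rh0 : 0 < Num.min rh1 rh2 by rewrite lt_min rh10.
have near_ x : n1 x <= r -> n1 (x - y) <= Num.min rh1 rh2 -> dot e (X v1 x) < 0 /\ dot e (X v2 x) < 0.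
  move=> hx; rewrite le_min => /andP[q1 q2].
  by split; rewrite -oppr_gt0 -dNr; [exact: lt_le_trans (H1 _ hx q1)|exact: lt_le_trans (H2 _ hx q2)].
have [hs1 hs1p Hs1] := small_step Y1 B1 _ B10 rh0.
have [hs2 hs2p Hs2] := small_step Y2 B2 _ B20 rh0.
pose h := Num.min (Num.min (Num.min k1 k2) (Num.min h1 h2)) (Num.min hs1 hs2).
have hp : 0 < h by rewrite !lt_min k10 k20 h10 h20 hs1p hs2p.
have inh (q : R) : 0 <= q <= h -> [/\ q <= k1, q <= k2, q <= h1, q <= h2 & q <= hs1 /\ q <= hs2].
  by move=> /andP[_]; rewrite !le_min => /andP[/andP[/andP[-> ->] /andP[-> ->]] /andP[-> ->]].
pose ca q := Y1 (s0 + q); pose cb q := Y2 (s0 + q).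
pose C := C1 + C2.
have CC : 0 <= C by rewrite addr_ge0.
have hk1 : h <= k1 by rewrite !ge_min lexx.
have hk2 : h <= k2 by rewrite !ge_min lexx !orbT.
have fa : follows (fun x => - X v1 x) ca 0 h C.
  apply: (follows_le _ _ _ _ C1); first by rewrite lerDl.
  by have := follows_shift _ _ _ _ _ s0 f1; apply: follows_sub; rewrite ?subrr // addrAC subrr add0r.
have fb : follows (fun x => - X v2 x) cb 0 h C.
  apply: (follows_le _ _ _ _ C2); first by rewrite lerDr.
  by have := follows_shift _ _ _ _ _ s0 f2; apply: follows_sub; rewrite ?subrr // addrAC subrr add0r.
have hq1 (q : R) : 0 <= q <= h -> 0 <= s0 + q <= t1.
  move=> hq; have [q1 _ _ _ _] := inh q hq; have /andP[q0 _] := hq.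
  by rewrite addr_ge0 ?(ltW s00) //= (le_trans _ k1s) // lerD2l.
have hq2 (q : R) : 0 <= q <= h -> 0 <= s0 + q <= t2.
  move=> hq; have [_ q1 _ _ _] := inh q hq; have /andP[q0 _] := hq.
  by rewrite addr_ge0 ?(ltW s00) //= (le_trans _ k2s) // lerD2l.
have hz1 : 0 <= s0 <= t1 by rewrite (ltW s00) ltW.
have hz2 : 0 <= s0 <= t2 by rewrite (ltW s00) ltW.
have car (q : R) : 0 <= q <= h -> n1 (ca q) <= r by move=> /hq1 /Yr1'.
have cbr (q : R) : 0 <= q <= h -> n1 (cb q) <= r by move=> /hq2 /Yr2'.
have ca0 : ca 0 = y by rewrite /ca addr0.
have cb0 : cb 0 = y by rewrite /cb addr0.
have dq (q : R) : 0 <= q -> `|s0 + q - s0| = q by move=> q0; rewrite addrAC subrr add0r ger0_norm.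
have Na (q : R) : 0 <= q <= h -> dot e (X v1 (ca q)) < 0 /\ dot e (X v2 (ca q)) < 0.
  move=> hq; have [_ _ _ _ [q5 _]] := inh q hq; have /andP[q0 _] := hq; apply: near_ (car q hq) _.
  by apply: Hs1; [apply: lip1 => //; exact: hq1|rewrite dq].
have Nb (q : R) : 0 <= q <= h -> dot e (X v1 (cb q)) < 0 /\ dot e (X v2 (cb q)) < 0.
  move=> hq; have [_ _ _ _ [_ q5]] := inh q hq; have /andP[q0 _] := hq; apply: near_ (cbr q hq) _.
  by rewrite -ss; apply: Hs2; [apply: lip2 => //; exact: hq2|rewrite dq].
have Ha (q : R) : 0 <= q <= h -> [/\ dot e (X v1 (ca q)) < 0, dot e (X v2 (ca q)) < 0 &
    exists s : R, abnormal F G s (ca q) (ep0 *: rot90 (X v1 (ca q)))].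
  move=> hq; have [q1 _ q3 _ _] := inh q hq; have /andP[q0 _] := hq; have [z1 z2] := Na q hq; split=> //.
  by exists (s0 + q); apply: ab1; rewrite ?dq // lerDl q0 lerD2l.
have Hb (q : R) : 0 <= q <= h -> [/\ dot e (X v2 (cb q)) < 0, dot e (X v1 (cb q)) < 0 &
    exists s : R, abnormal F G s (cb q) (ep0 *: rot90 (X v2 (cb q)))].
  move=> hq; have [_ q1 _ q3 _] := inh q hq; have /andP[q0 _] := hq; have [z1 z2] := Nb q hq; split=> //.
  by exists (s0 + q); apply: ab2; rewrite ?dq // lerDl q0 lerD2l.
have [ha' /andP[ha'0 ha'h] orda] := graphs_ordered_pair e P ep0 r K C N h v1 v2 ca cb y eP erefl PP N0 K0 CC hp nK
  v11 v21 car cbr fa fb ca0 cb0 eV1 eV2 Pn Ha.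
have [hb' /andP[hb'0 hb'h] ordb] := graphs_ordered_pair e P ep0 r K C N h v2 v1 cb ca y eP erefl PP N0 K0 CC hp nK
  v21 v11 cbr car fb fa cb0 ca0 eV2 eV1 Pn Hb.
pose h3 := Num.min ha' hb'.
have h30 : 0 < h3 by rewrite lt_min ha'0.
have h3a : h3 <= ha' by rewrite ge_min lexx.
have h3b : h3 <= hb' by rewrite ge_min lexx orbT.
have h3h : h3 <= h by rewrite (le_trans h3a).
have sub3 (q : R) : 0 <= q <= h3 -> 0 <= q <= h by move=> /andP[-> q1]; rewrite (le_trans q1).
have fa3 : follows (fun x => - X v1 x) ca 0 h3 C by move: fa; apply: follows_sub.
have fb3 : follows (fun x => - X v2 x) cb 0 h3 C by move: fb; apply: follows_sub.
have ea3 : 0 < dot e (- X v1 (ca 0)) by rewrite ca0.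
have eb3 : 0 < dot e (- X v2 (cb 0)) by rewrite cb0.
have [h4 /andP[h40 h43] ex] := same_abscissa e _ _ _ _ r r K C h3 h3 ca cb
  (nice_opp _ _ _ _ (nK v1 v11)) (nice_opp _ _ _ _ (nK v2 v21)) K0 CC h30 h30
  (fun q hq => car q (sub3 q hq)) (fun q hq => cbr q (sub3 q hq)) fa3 fb3
  (ltac:(by rewrite ca0 cb0)) ea3 eb3.
exists h4 => // s hs; have [s' [hs' _ es]] := ex s hs.
have hs3 : 0 <= s <= h3 by move: hs => /andP[-> q1]; rewrite (le_trans q1).
have D0 : 0 <= dot P (ca s - cb s').
  apply: orda => //; [move: hs3|move: hs']; by move=> /andP[-> q1]; rewrite (le_trans q1).
have D1 : 0 <= dot P (cb s' - ca s).
  apply: ordb; [move: hs'|move: hs3|].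
  - by move=> /andP[-> q1]; rewrite (le_trans q1).
  - by move=> /andP[-> q1]; rewrite (le_trans q1).
  - by rewrite -opprB dNr es oppr0.
have DZ : dot P (ca s - cb s') = 0.
  by apply/le_anti; rewrite D0 andbT -oppr_ge0 -dNr opprB.
have : ca s - cb s' = 0.
  by rewrite (frame_decomp e P (ca s - cb s') N eP erefl PP (lt0r_neq0 N0)) es DZ !mul0r !scale0r addr0.
move=> /eqP; rewrite subr_eq0 => /eqP E.
have T1 := Ty1 _ (hq1 _ (sub3 _ hs3)); have T2 := Ty2 _ (hq2 _ (sub3 _ hs')).
rewrite -/(ca s) in T1; rewrite -/(cb s') -E T1 in T2.
(* The points [ca s] and [cb s'] coincide, and the time-to-go identifies the parameters. *)
have ess : s' = s by move: T2 => [] /addrI.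
by move: E; rewrite ess.
Qed.

End Uniqueness.

Section ArcUniqueness.
Context {R : realType} {M : nat}.
Variables (F : R * R -> R * R) (G : 'I_M -> R * R -> R * R) (L : R).
Hypotheses (hF : C11_vec L F) (hG : forall i, C11_vec L (G i)).
Variable calT : R.
Hypothesis ha : forall t, 0 < t < calT -> prop_a F G t.
Notation X w := (fun x => Defs.field F G x w).

Lemma follows_unique V A (r K C1 C2 h : R) (c1 c2 : R -> R * R) : nice V A r K -> 0 <= K ->
  0 <= h -> K * h <= 2^-1 ->
  (forall s : R, 0 <= s <= h -> n1 (c1 s) <= r) -> (forall s : R, 0 <= s <= h -> n1 (c2 s) <= r) ->
  follows V c1 0 h C1 -> follows V c2 0 h C2 -> c1 0 = c2 0 ->
  forall s : R, 0 <= s <= h -> c1 s = c2 s.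
Proof.
move=> nV K0 h0 Kh r1 r2 f1 f2 e0 s hs.
have := @gronwall_quad _ (fun s => n1 (c1 s - c2 s)) h K 0 (C1 + C2) h0 K0 (lexx _) Kh _ _ s hs.
rewrite e0 subrr n10 mul0r addr0 mulr0 => H; apply/eqP; rewrite -subr_eq0; apply/eqP/n1_eq0.
apply: H => [z _|a b a0 ab bh]; first exact: n1_ge0.
have hA : 0 <= a <= h by rewrite a0 (le_trans ab).
have hB : 0 <= b <= h by rewrite (le_trans a0).
have [_ _ /(_ _ (r1 _ hA))[l _]] := nV _ (r2 _ hA).
have i1 := f1 a b hA hB; have i2 := f2 a b hA hB.
have -> : c1 b - c2 b = (c1 b - c1 a - (b - a) *: V (c1 a)) - (c2 b - c2 a - (b - a) *: V (c2 a)) +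
   (c1 a - c2 a) + (b - a) *: (V (c1 a) - V (c2 a)).
  by apply: vecP; rewrite /= /GRing.scale /=; ring.
have := n1D ((c1 b - c1 a - (b - a) *: V (c1 a)) - (c2 b - c2 a - (b - a) *: V (c2 a)) +
   (c1 a - c2 a)) ((b - a) *: (V (c1 a) - V (c2 a))).
have := n1D ((c1 b - c1 a - (b - a) *: V (c1 a)) - (c2 b - c2 a - (b - a) *: V (c2 a)))
   (c1 a - c2 a).
have := n1B (c1 b - c1 a - (b - a) *: V (c1 a)) (c2 b - c2 a - (b - a) *: V (c2 a)).
rewrite n1Z ger0_norm ?subr_ge0 //.
have : (b - a) * n1 (V (c1 a) - V (c2 a)) <= (b - a) * (K * n1 (c1 a - c2 a)).
  by rewrite ler_wpM2l ?subr_ge0.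
lra.
Qed.

(** Agreement persists up to the supremum of its times by continuity and beyond it by [no_branch].
    The latter requires a positive time, so a first piece is obtained separately from uniqueness for
    the differential equation, the initial control being the same. *)
Lemma arc_unique t1 t2 Y1 Y2 (v : 'I_M -> R) (h1 h2 C1 C2 : R) :
  abnormal_arc F G t1 Y1 -> abnormal_arc F G t2 Y2 -> Y1 0 = Y2 0 ->
  0 < t1 -> t1 <= t2 -> t2 < calT -> (forall i, `|v i| <= 1) -> 0 < h1 -> 0 < h2 ->
  h1 <= t1 -> h2 <= t2 ->
  follows (fun x => - X v x) Y1 0 h1 C1 -> follows (fun x => - X v x) Y2 0 h2 C2 ->
  forall s : R, 0 <= s <= t1 -> Y1 s = Y2 s.
Proof.
move=> arc1 arc2 Y00 t10 t12 tc v1 h10 h20 h1t h2t f1 f2.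
have t20 : 0 < t2 by exact: lt_le_trans t12.
have [r1 [B1 [K1 [r10 B10 _ _ [Yr1 lip1]]]]] := arc_setup F G L hF hG t1 Y1 (ltW t10) arc1.
have [r2 [B2 [K2 [r20 B20 _ _ [Yr2 lip2]]]]] := arc_setup F G L hF hG t2 Y2 (ltW t20) arc2.
pose r := r1 + r2; have r0 : 0 <= r by rewrite addr_ge0.
have [K K0 nK] := field_nice F G L r r0 hF hG.
have Kp : 0 < 2 * K + 1 by rewrite ltr_wpDl // mulr_ge0.
pose h := Num.min (Num.min h1 h2) (2 * K + 1)^-1.
have hp : 0 < h by rewrite !lt_min h10 h20 invr_gt0.
have hh1 : h <= h1 by rewrite !ge_min lexx.
have hh2 : h <= h2 by rewrite !ge_min lexx !orbT.
have Kh : K * h <= 2^-1.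
  have : h * (2 * K + 1) <= 1 by rewrite -ler_pdivlMr // div1r !ge_min lexx !orbT.
  lra.
have start (s : R) : 0 <= s <= h -> Y1 s = Y2 s.
  apply: (follows_unique (fun x => - X v x) _ r K C1 C2 h Y1 Y2 (nice_opp _ _ _ _ (nK v v1)) K0 (ltW hp) Kh) => //.
  - move=> q /andP[q0 qh]; apply: (@le_trans _ _ r1); last by rewrite lerDl.
    by apply: Yr1; rewrite q0 (le_trans qh) // (le_trans hh1).
  - move=> q /andP[q0 qh]; apply: (@le_trans _ _ r2); last by rewrite lerDr.
    by apply: Yr2; rewrite q0 (le_trans qh) // (le_trans hh2).
  - exact: follows_sub f1.
  - exact: follows_sub f2.
pose E := [set s : R | 0 <= s <= t1 /\ forall q : R, 0 <= q <= s -> Y1 q = Y2 q].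
have Eh : E h by split=> //; rewrite (ltW hp) (le_trans hh1).
have hE : has_sup E by split; [exists h|exists t1 => s [/andP[_ ?] _]].
set s0 := sup E.
have hs0 : h <= s0 by exact: sup_upper_bound.
have s00 : 0 < s0 by exact: lt_le_trans hs0.
have s0t : s0 <= t1 by apply: ge_sup => [|s [/andP[_ ?] _]//]; exact: hE.1.
have before (q : R) : 0 <= q -> q < s0 -> Y1 q = Y2 q.
  move=> q0 qs; have e0 : 0 < s0 - q by rewrite subr_gt0.
  have [s [_ Hs] sq] := sup_adherent e0 hE; apply: Hs; rewrite q0 /= ltW //.
  by move: sq; rewrite -/s0 subKr.
have at0 : Y1 s0 = Y2 s0.
  apply/eqP; rewrite -subr_eq0; apply/eqP/n1_eq0.
  apply: (@le_of_le_pow2 _ _ ((B1 + B2) * s0)) => n.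
  pose e := s0 / 2 ^+ n; have p2 : 0 < 2 ^+ n :> R by rewrite exprn_gt0.
  have e0 : 0 < e by rewrite divr_gt0.
  have es : e <= s0 by rewrite ler_pdivrMr // ler_peMr ?(ltW s00) // exprn_ege1 // ler1n.
  have q0 : 0 <= s0 - e by rewrite subr_ge0.
  have qs : s0 - e < s0 by rewrite gtrBl.
  have b := before _ q0 qs.
  have i1 := lip1 (s0 - e) s0 (ltac:(by rewrite q0 (le_trans (ltW qs)))) (ltac:(by rewrite (ltW s00))).
  have i2 := lip2 s0 (s0 - e) (ltac:(by rewrite (ltW s00) (le_trans s0t)))
    (ltac:(by rewrite q0 (le_trans (ltW qs)) // (le_trans s0t))).
  rewrite subKr (gtr0_norm e0) in i1; rewrite distrC subKr (gtr0_norm e0) in i2.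
  have := n1_tri (Y1 s0) (Y1 (s0 - e)) (Y2 s0); rewrite {2}b.
  have -> : (B1 + B2) * s0 / 2 ^+ n = B1 * e + B2 * e by rewrite /e; ring.
  by move=> q; rewrite (le_trans q) // lerD.
have agree (s : R) : 0 <= s <= s0 -> Y1 s = Y2 s.
  by move=> /andP[q0]; rewrite le_eqVlt => /orP[/eqP ->//|]; exact: before.
have [st|ts] := ltP s0 t1; last first.
  by move=> s /andP[q0 q1]; apply: agree; rewrite q0 (le_trans q1).
have [k k0 Hk] := no_branch F G L hF hG calT ha t1 t2 Y1 Y2 s0 arc1 arc2 (le_lt_trans t12 tc) tc s00 st
  (lt_le_trans st t12) agree.
pose k1 := Num.min k (t1 - s0); have k10 : 0 < k1 by rewrite lt_min k0 subr_gt0.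
have k1k : k1 <= k by rewrite ge_min lexx.
have k1t : s0 + k1 <= t1 by rewrite -lerBrDl ge_min lexx orbT.
have : E (s0 + k1).
  split; first by rewrite k1t andbT addr_ge0 // ltW.
  move=> q /andP[q0 q1]; have [qs|sq] := leP q s0; first by apply: agree; rewrite q0.
  rewrite (_ : q = s0 + (q - s0)); last by rewrite addrC subrK.
  by apply: Hk; rewrite subr_ge0 (ltW sq) (le_trans _ k1k) // lerBlDl.
move=> /(sup_upper_bound hE); rewrite -/s0 gerDl => k1n.
by move: (lt_le_trans k10 k1n); rewrite ltxx.
Qed.

End ArcUniqueness.

(** * Hausdorff measure of curves *)

Section Hausdorff.
Context {R : realType}.
Notation mu := (@lebesgue_measure R).

Lemma ediam_ge0 (A : set (R * R)) : (0 <= ediam A)%E.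
Proof. by apply: ereal_sup_ubound; left. Qed.

Lemma H1_set0 : H1 (@set0 (R * R)) = 0%E.
Proof.
have Hd (d : R) : 0 < d -> H1delta d (@set0 (R * R)) = 0%E.
  move=> d0; have e0 : ediam (@set0 (R * R)) = 0%E.
    apply/le_anti; rewrite ediam_ge0 andbT; apply: ge_ereal_sup => _ [->//|[x [y [[]]]]].
  apply/le_anti/andP; split.
    apply: ge_ereal_inf; exists 0%E => //; exists (fun=> set0); split=> //; split.
      by move=> n; rewrite e0 lee_fin ltW.
    by rewrite eseries0.
  apply: le_ereal_inf_tmp => _ [C [_ [_ ->]]].
  by apply: nneseries_ge0 => n _ _; exact: ediam_ge0.
rewrite /H1 (_ : [set H1delta d set0 | d in [set d : R | 0 < d]] = [set 0%E]) ?ereal_sup1 //.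
apply/seteqP; split=> [_ [d /= d0 <-]|_ ->]; first by rewrite Hd.
by exists 1 => //=; rewrite Hd.
Qed.

Lemma H1delta_le_H1 (d : R) A : 0 < d -> (H1delta d A <= H1 A)%E.
Proof. by move=> d0; apply: ereal_sup_ubound; exists d. Qed.

(** A projection that does not increase distances maps each covering set into an interval no longer
    than its diameter, and these intervals cover the one from [a] to [b]: countable subadditivity of
    [mu] bounds the sum of diameters below. *)
Lemma H1_projection (A : set (R * R)) (p : R * R -> R) (a b : R) :
  (forall x y, `|p x - p y| <= Defs.edist x y) -> a < b ->
  (forall c : R, a <= c <= b -> exists2 x, A x & p x = c) -> (0 < H1 A)%E.
Proof.
move=> lp ab H; apply: lt_le_trans (H1delta_le_H1 1 A ltr01).
apply: (@lt_le_trans _ _ (b - a)%:E); first by rewrite lte_fin subr_gt0.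
apply: le_ereal_inf_tmp => _ [C [AC [Cd ->]]].
(* The closed hull of the projection, because the projection itself may fail to be measurable. *)
pose J n : set R := if pselect (C n !=set0) then `[inf (p @` C n), sup (p @` C n)]%classic else set0.
have dC n x y : C n x -> C n y -> ((p x - p y)%:E <= ediam (C n))%E.
  move=> Cx Cy; apply: (@le_trans _ _ (Defs.edist x y)%:E).
    by rewrite lee_fin (le_trans (ler_norm _)).
  by apply: ereal_sup_ubound; right; exists x, y.
have bd n x y : C n x -> C n y -> p x - p y <= 1.
  by move=> Cx Cy; rewrite -lee_fin (le_trans (dC n x y Cx Cy)).
have ub n x : C n x -> has_ubound (p @` C n).
  by move=> Cx; exists (p x + 1) => z [y Cy yz]; have := bd n y x Cy Cx; lra.
have lb n x : C n x -> has_lbound (p @` C n).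
  by move=> Cx; exists (p x - 1) => z [y Cy yz]; have := bd n x y Cx Cy; lra.
have mJ n : measurable (J n) by rewrite /J; case: pselect => h; [exact: measurable_itv|exact: measurable0].
have -> : (b - a)%:E = mu `[a, b]%classic.
  by rewrite lebesgue_measure_itv /= lte_fin ab EFinB.
have sub : `[a, b]%classic `<=` \bigcup_n J n.
  move=> c /=; rewrite in_itv /= => /H [x /AC [n _ Cx] <-]; exists n => //.
  rewrite /J; case: pselect => [h|]; last by case; exists x.
  rewrite /= in_itv /=; apply/andP; split.
    by apply: ge_inf; [exact: lb Cx|exists x].
  by apply: sup_upper_bound; [split; [exists (p x), x|exact: ub Cx]|exists x].
apply: le_trans (measure_sigma_subadditive mu mJ _ sub) _ => //.
apply: lee_nneseries => // n _; rewrite /J; case: pselect => [[x Cx]|h]; last by rewrite measure0 ediam_ge0.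
rewrite /= lebesgue_measure_itv /=; case: ifP => _; last exact: ediam_ge0.
have [->|fin] := eqVneq (ediam (C n)) +oo%E; first by rewrite leey.
have fn : ediam (C n) \is a fin_num by rewrite ge0_fin_numE ?ediam_ge0 // ltey.
rewrite -(fineK fn) -EFinB lee_fin lerBlDl.
have ne : (p @` C n) !=set0 by exists (p x), x.
apply: ge_sup => // _ [y Cy <-]; rewrite -lerBlDr.
apply: lb_le_inf => // _ [z Cz <-].
by rewrite lerBlDr -lerBlDl -lee_fin fineK // dC.
Qed.

(** The end points differ in some coordinate, and along the path that coordinate takes all
    intermediate values. *)
Lemma H1_path (A : set (R * R)) (c : R -> R * R) (a b B : R) : a <= b -> c a <> c b ->
  (forall s s' : R, a <= s <= b -> a <= s' <= b -> n1 (c s' - c s) <= B * `|s' - s|) ->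
  (forall s : R, a <= s <= b -> A (c s)) -> (0 < H1 A)%E.
Proof.
move=> ab cab lip Ac.
have key (p : R * R -> R) : (forall x y, `|p x - p y| <= Defs.edist x y) ->
    (forall x y, `|p x - p y| <= n1 (x - y)) -> p (c a) != p (c b) -> (0 < H1 A)%E.
  move=> lp np pab.
  have cont : {within `[a, b]%classic, continuous (p \o c)}.
    by apply: (@lip_within _ _ _ _ B) => s s' hs hs'; rewrite (le_trans (np _ _)) // lip.
  apply: (H1_projection A p (Num.min (p (c a)) (p (c b))) (Num.max (p (c a)) (p (c b)))) => //.
    move: pab; rewrite neq_lt => /orP[] q; first by rewrite min_l ?max_r ?ltW.
    by rewrite min_r ?max_l ?ltW.
  move=> q hq; have [s] := IVT ab cont hq.
  by rewrite in_itv /= => hs <-; exists (c s) => //; exact: Ac.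
have [e1|n1_] := eqVneq (c a).1 (c b).1; last first.
  apply: (key fst) => // x y; last exact: (fst_n1 (x - y)).
  rewrite edistE /enorm -sqrtr_sqr ler_wsqrtr // /dot /= -!expr2 lerDl; exact: sqr_ge0.
have [e2|n2_] := eqVneq (c a).2 (c b).2; first by case: cab; exact: vecP.
apply: (key snd) => // x y; last exact: (snd_n1 (x - y)).
rewrite edistE /enorm -sqrtr_sqr ler_wsqrtr // /dot /= -!expr2 lerDr; exact: sqr_ge0.
Qed.

End Hausdorff.

(** * Abnormal arcs at the origin *)

Section AbnormalComparison.
Context {R : realType}.

(* [E + kappa (1 - lambda s) U^2] is a Lyapunov function: the gain [c a dU] pays for
   the growth of [U^2], since [U a <= m a]. *)
Lemma comparison_le0 (E U tr : R -> R) (h m c K K2 C3 : R) :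
  0 <= h -> 0 <= m -> 0 < c -> 0 <= K -> 0 <= K2 -> 0 <= C3 -> K * h <= 2^-1 ->
  (K2 * (2 * m + 1) / c + K) * h <= 1 ->
  E 0 = 0 -> U 0 = 0 ->
  (forall a b : R, 0 <= a -> a <= b -> b <= h -> 0 <= U b - U a <= m * (b - a)) ->
  (forall a b : R, 0 <= a -> a <= b -> b <= h ->
    E b - E a <= - tr a * E a * (b - a) + K2 * U a ^+ 2 * (b - a) - c * a * (U b - U a)
      + C3 * (b - a) ^+ 2) ->
  (forall a : R, 0 <= a <= h -> `|tr a| <= K) ->
  forall s : R, 0 <= s <= h -> E s <= 0.
Proof.
move=> h0 m0 c0 K0 K20 C30 Kh Lh E0 U0 HU HE Htr.
(* Chosen so that [kp * (2 * m) <= c]: the growth of [kp * U ^+ 2] is then covered by the gain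
   [c * a * dU]. *)
pose kp := c / (2 * m + 1); have mp : 0 < 2 * m + 1 by rewrite ltr_wpDl // mulr_ge0.
have kp0 : 0 < kp by rewrite divr_gt0.
(* The decreasing weight loses [kp * la * U ^+ 2] per unit time, that is [K2 * U ^+ 2] for the error
   term plus [K * kp * U ^+ 2] for replacing [E] by [Phi] in the trace term. *)
pose la := K2 / kp + K.
have laE : la = K2 * (2 * m + 1) / c + K.
  by rewrite /la /kp; field; rewrite !gt_eqF.
have la0 : 0 <= la by rewrite addr_ge0 // divr_ge0 // ltW.
have lah : la * h <= 1 by rewrite laE.
have km : kp * (2 * m) <= c.
  by rewrite /kp mulrAC ler_pdivrMr // ler_wpM2l ?(ltW c0) // lerDl.
pose Phi s := E s + kp * (1 - la * s) * U s ^+ 2.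
pose f s := Num.max (Phi s) 0.
have Ua (a : R) : 0 <= a <= h -> 0 <= U a /\ U a <= m * a.
  by move=> /andP[a0 ah]; have := HU 0 a (lexx _) a0 ah; rewrite U0 !subr0 => /andP[].
have inc (a b : R) : 0 <= a -> a <= b -> b <= h ->
    Phi b - Phi a <= - tr a * Phi a * (b - a) + (C3 + kp * m ^+ 2) * (b - a) ^+ 2.
  move=> a0 ab bh; have ha : 0 <= a <= h by rewrite a0 (le_trans ab).
  have hE := HE a b a0 ab bh; have /andP[dU0 dU1] := HU a b a0 ab bh.
  have [u0 u1] := Ua a ha; have trK := Htr a ha.
  have D0 : 0 <= b - a by rewrite subr_ge0.
  have lb : la * b <= 1 by rewrite (le_trans _ lah) // ler_wpM2l.
  have lb0 : 0 <= la * b by rewrite mulr_ge0 // (le_trans a0).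
  have laa : la * a <= la * b by rewrite ler_wpM2l.
  have la00 : 0 <= la * a by rewrite mulr_ge0.
  set dU := U b - U a in dU0 dU1 hE.
  have Ub : U b = U a + dU by rewrite /dU addrC subrK.
  have i1 : kp * (2 * U a * dU) <= c * a * dU.
    rewrite mulrA; apply: ler_wpM2r => //.
    have : kp * (2 * U a) <= kp * (2 * (m * a)) by rewrite !ler_wpM2l // ltW.
    have : kp * (2 * m) * a <= c * a by rewrite ler_wpM2r.
    clear -kp0; lra.
  have i2 : kp * dU ^+ 2 <= kp * (m ^+ 2 * (b - a) ^+ 2).
    rewrite ler_wpM2l ?(ltW kp0) // -exprMn lerXn2r ?nnegrE //.
    by rewrite mulr_ge0.
  have i3 : (1 - la * b) * (kp * (2 * U a * dU + dU ^+ 2)) <= kp * (2 * U a * dU + dU ^+ 2).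
    have q0 : 0 <= kp * (2 * U a * dU + dU ^+ 2).
      by apply: mulr_ge0 (ltW kp0) _; rewrite addr_ge0 ?sqr_ge0 // !mulr_ge0.
    rewrite -[leRHS]mul1r ler_wpM2r //; lra.
  have i4 : - tr a * (- (kp * (1 - la * a) * U a ^+ 2)) <= K * (kp * U a ^+ 2).
    have q0 : 0 <= kp * U a ^+ 2 by rewrite mulr_ge0 ?sqr_ge0 // ltW.
    have -> : - tr a * (- (kp * (1 - la * a) * U a ^+ 2)) = (tr a * (1 - la * a)) * (kp * U a ^+ 2) by ring.
    rewrite ler_wpM2r // (le_trans (ler_norm _)) // normrM -[leRHS]mulr1 ler_pM //.
    by rewrite ger0_norm; lra.
  have i5 : - tr a * E a = - tr a * Phi a + - tr a * (- (kp * (1 - la * a) * U a ^+ 2)).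
    by rewrite /Phi; ring.
  have lk : kp * la = K2 + K * kp by rewrite /la; field; rewrite gt_eqF.
  have i6 : (- tr a * E a) * (b - a) <= (- tr a * Phi a + K * (kp * U a ^+ 2)) * (b - a).
    by rewrite ler_wpM2r // i5 lerD2l.
  have -> : Phi b - Phi a = (E b - E a) + (1 - la * b) * (kp * (2 * U a * dU + dU ^+ 2))
     - kp * la * (b - a) * U a ^+ 2.
    by rewrite /Phi Ub; ring.
  rewrite lk; move: hE i1 i2 i3 i6; clear; move=> hE i1 i2 i3 i6; lra.
have f0 : f 0 = 0 by rewrite /f /Phi E0 U0 expr0n /= mulr0 addr0 maxxx.
have CC : 0 <= C3 + kp * m ^+ 2 by rewrite addr_ge0 // mulr_ge0 ?sqr_ge0 // ltW.
move=> s hs; have := @gronwall_quad _ f h K 0 (C3 + kp * m ^+ 2) h0 K0 (lexx _) Kh _ _ s hs.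
rewrite f0 mul0r addr0 mulr0 => fs.
have {fs} : f s <= 0.
  apply: fs => [q _|a b a0 ab bh]; first by rewrite /f le_max lexx orbT.
  have ha : 0 <= a <= h by rewrite a0 (le_trans ab).
  have i := inc a b a0 ab bh; have trK := Htr a ha.
  have D0 : 0 <= b - a by rewrite subr_ge0.
  have Kb : K * (b - a) <= 2^-1.
    by rewrite (le_trans _ Kh) // ler_wpM2l // (le_trans _ bh) // gerBl.
  have C0 : 0 <= (C3 + kp * m ^+ 2) * (b - a) ^+ 2 by rewrite mulr_ge0 ?sqr_ge0.
  rewrite mul0r addr0 lerBlDl {1}/f ge_max; apply/andP; split; last first.
    have fa : 0 <= f a by rewrite /f le_max lexx orbT.
    have := mulr_ge0 (mulr_ge0 K0 fa) D0; lra.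
  have tb : `|tr a * (b - a)| <= K * (b - a) by rewrite normrM (ger0_norm D0) ler_wpM2r.
  have [Pa|Pa] := leP 0 (Phi a).
    have -> : f a = Phi a by rewrite /f max_l.
    have : - tr a * Phi a * (b - a) <= K * Phi a * (b - a).
      by rewrite !ler_wpM2r // (le_trans (ler_norm _)) // normrN.
    lra.
  have -> : f a = 0 by rewrite /f max_r // ltW.
  have : (1 - tr a * (b - a)) * Phi a <= 0.
    rewrite mulr_ge0_le0 ?(ltW Pa) //; have := ler_norm (tr a * (b - a)); lra.
  lra.
rewrite /f ge_max => /andP[Ps _].
have /andP[s0 sh] := hs.
have : 0 <= kp * (1 - la * s) * U s ^+ 2.
  by rewrite mulr_ge0 ?sqr_ge0 // mulr_ge0 ?(ltW kp0) // subr_ge0 (le_trans _ lah) // ler_wpM2l.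
by move: Ps; rewrite /Phi; lra.
Qed.

Notation mu := (@lebesgue_measure R).

Lemma integrable_comb {I : Type} (l : seq I) (k : I -> R) (g : I -> R -> R) (k0 t : R) :
  (forall i, mu.-integrable `[0, t]%classic (EFin \o g i)) ->
  mu.-integrable `[0, t]%classic (EFin \o (fun r => k0 + \sum_(i <- l) k i * g i r)) /\
  forall a b : R, 0 <= a -> a <= b -> b <= t ->
   primit (fun r => k0 + \sum_(i <- l) k i * g i r) b -
   primit (fun r => k0 + \sum_(i <- l) k i * g i r) a =
   k0 * (b - a) + \sum_(i <- l) k i * (primit (g i) b - primit (g i) a).
Proof.
move=> ig; elim: l => [|i l [IH1 IH2]].
  have -> : (fun r : R => k0 + \sum_(i <- [::]) k i * g i r) = (fun=> k0).
    by apply/funext => r; rewrite big_nil addr0.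
  have i0 : mu.-integrable `[0, t]%classic (EFin \o (fun=> k0)).
    by apply: integrable_cont; apply: continuous_subspaceT => x; exact: cst_continuous.
  split=> // a b a0 ab bt; rewrite big_nil addr0 (primit_incr _ t) // int_cst_oo //.
have -> : (fun r : R => k0 + \sum_(j <- i :: l) k j * g j r) =
    (fun r => k i * g i r + (k0 + \sum_(j <- l) k j * g j r)).
  by apply/funext => r; rewrite big_cons addrCA.
have ii : mu.-integrable `[0, t]%classic (EFin \o (fun r => k i * g i r)).
  rewrite (_ : _ \o _ = (fun r => (k i)%:E * (EFin \o g i) r)%E) //.
  by apply: integrableZl.
have itot : mu.-integrable `[0, t]%classic
    (EFin \o (fun r => k i * g i r + (k0 + \sum_(j <- l) k j * g j r))).
  rewrite (_ : _ \o _ = (fun r => (EFin \o (fun r => k i * g i r)%R) r + (EFin \o (fun r => k0 + \sum_(j <- l) k j * g j r)%R) r)%E) //.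
  by apply: integrableD.
split=> // a b a0 ab bt.
rewrite (primit_incr _ t) // RintegralD //; try exact: integrable_oo a0 bt.
rewrite RintegralZl //; last exact: integrable_oo (ig i) a0 bt.
by rewrite -!(primit_incr _ t) // IH2 // big_cons; ring.
Qed.

End AbnormalComparison.

(** * Competing controls and their deviation from a sign vector *)

Section ControlIncrements.
Context {R : realType} {M : nat}.
Variables (F : R * R -> R * R) (G : 'I_M -> R * R -> R * R) (L : R).
Hypotheses (hF : C11_vec L F) (hG : forall i, C11_vec L (G i)).
Notation mu := (@lebesgue_measure R).
Notation X w := (fun x => Defs.field F G x w).

(** Since [v i ^+ 2 = 1], one has [u r i = v i - v i * deficit v u i r]: the deficit is the
    nonnegative quantity by which a component of the control departs from [v], and the field is
    affine in it. *)
Definition deficit (v : 'I_M -> R) (u : R -> 'I_M -> R) (i : 'I_M) (r : R) : R := 1 - v i * u r i.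

Lemma integrable_deficit (v : 'I_M -> R) u t i : admissible u t -> `|v i| = 1 ->
  mu.-integrable `[0, t]%classic (EFin \o deficit v u i) /\
  forall r : R, 0 <= r <= t -> 0 <= deficit v u i r <= 2.
Proof.
move=> adm v1; have [mu_ ub] := adm i.
have b (r : R) : 0 <= r <= t -> 0 <= deficit v u i r <= 2.
  move=> hr; have : `|v i * u r i| <= 1 by rewrite normrM v1 mul1r ub.
  by rewrite ler_norml /deficit => /andP[? ?]; apply/andP; split; lra.
split=> //; apply: (integrable_bounded _ _ 2) => [|r /b /andP[h1 h2]]; last by rewrite ger0_norm.
apply: measurable_funB; first exact: measurable_cst.
by apply: measurable_funM; [exact: measurable_cst|exact: mu_].
Qed.

(** With the state frozen, the velocity is [X v] minus the deficits times [v i *: G i], and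
    integration in time acts on the deficits only. The state is frozen at the later time [b] because
    competitors will be read backwards. *)
Lemma ctrl_incr (v : 'I_M -> R) u y t x0 (r K a b : R) :
  (forall i, `|v i| = 1) -> admissible u t -> trajectory F G x0 u t y -> 0 <= K ->
  (forall s : R, 0 <= s <= t -> n1 (y s) <= r) ->
  (forall w : 'I_M -> R, (forall i, `|w i| <= 1) -> nice (X w) (fieldD F G w) r K) ->
  (forall s s' : R, 0 <= s <= t -> 0 <= s' <= t -> n1 (y s' - y s) <= 2 * K * `|s' - s|) ->
  0 <= a -> a <= b -> b <= t ->
  n1 (y b - y a - (b - a) *: X v (y b) +
    \sum_(i < M) (v i * (primit (deficit v u i) b - primit (deficit v u i) a)) *: G i (y b))
  <= 4 * K ^+ 2 * (b - a) ^+ 2.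
Proof.
move=> v1 adm tr K0 yr nK lip a0 ab bt.
have [i1 i2 E] := traj_primit F G L hF hG _ _ _ _ adm tr.
have idf i := (integrable_deficit v u t i adm (v1 i)).1.
have vv i : v i * v i = 1 by rewrite -expr2 -(real_normK (num_real (v i))) v1 expr1n.
have hb : 0 <= b <= t by rewrite (le_trans a0).
have key (p : R * R -> R) : (forall q, `|p q| <= n1 q) ->
    (forall q q', p (q - q') = p q - p q') ->
    (forall w, p (Defs.field F G (y b) w) = p (F (y b)) + \sum_(i < M) w i * p (G i (y b))) ->
    mu.-integrable `[0, t]%classic (EFin \o (fun s => p (Defs.field F G (y s) (u s)))) ->
    `|(primit (fun s => p (Defs.field F G (y s) (u s))) b - primit (fun s => p (Defs.field F G (y s) (u s))) a)
     - (b - a) * p (X v (y b)) +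
     \sum_(i < M) v i * (primit (deficit v u i) b - primit (deficit v u i) a) * p (G i (y b))| <=
     2 * K ^+ 2 * (b - a) ^+ 2.
  move=> pn pB pf ip.
  pose k i := - (v i * p (G i (y b))); pose k0 := p (X v (y b)).
  have [ic cE] := integrable_comb (index_enum 'I_M) k (deficit v u) k0 t idf.
  pose g r := k0 + \sum_(i < M) k i * deficit v u i r.
  have gE s : p (Defs.field F G (y b) (u s)) = g s.
    rewrite /g /k0 !pf -addrA; congr (_ + _); rewrite -big_split /=; apply: eq_bigr => i _.
    rewrite /k /deficit.
    have -> : v i * p (G i (y b)) + - (v i * p (G i (y b))) * (1 - v i * u s i) =
      v i * v i * (u s i * p (G i (y b))) by ring.
    by rewrite vv mul1r.
  pose f s := p (Defs.field F G (y s) (u s)).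
  have ifg : mu.-integrable `[0, t]%classic (EFin \o (fun s => f s - g s)).
    by rewrite (_ : _ \o _ = (fun x => (EFin \o f) x - (EFin \o g) x)%E) //; apply: integrableB.
  have := primit_bound_oo _ _ a b 0 (K * (2 * K * (b - a))) ifg a0 ab bt.
  rewrite mul0r subr0 => I.
  have {}I : `|primit (fun s => f s - g s) b - primit (fun s => f s - g s) a| <= K * (2 * K * (b - a)) * (b - a).
    apply: I => s /andP[as_ sb]; rewrite subr0 /f -gE -pB (le_trans (pn _)) //.
    have hs : 0 <= s <= t by rewrite (le_trans a0 (ltW as_)) (le_trans (ltW sb)).
    have us i : `|u s i| <= 1 by have [_ ub] := adm i; exact: ub.
    have [_ _ /(_ _ (yr _ hs))[l _]] := nK (u s) us _ (yr _ hb).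
    rewrite (le_trans l) // ler_wpM2l // (le_trans (lip _ _ hb hs)) // ler_wpM2l ?mulr_ge0 //.
    by rewrite distrC ger0_norm ?subr_ge0 ?(ltW sb) // lerD2l lerN2 ltW.
  have PB q : 0 <= q -> q <= t -> primit (fun s => f s - g s) q = primit f q - primit g q.
    by move=> q0 qt; rewrite /primit RintegralB //; [exact: integrable_sub ip|exact: integrable_sub ic].
  rewrite !PB // ?(le_trans ab bt) ?(le_trans a0 ab) // in I.
  have cE' : primit g b - primit g a = k0 * (b - a) + \sum_(i < M) k i * (primit (deficit v u i) b - primit (deficit v u i) a) := cE a b a0 ab bt.
  have -> : 2 * K ^+ 2 * (b - a) ^+ 2 = K * (2 * K * (b - a)) * (b - a) by ring.
  apply: le_trans I; rewrite le_eqVlt; apply/orP; left; apply/eqP; congr `|_|.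
  have -> : primit f b - primit g b - (primit f a - primit g a) = (primit f b - primit f a) - (primit g b - primit g a) by ring.
  rewrite cE' opprD addrA [k0 * _]mulrC; congr (_ + _); rewrite -sumrN; apply: eq_bigr => i _.
  by rewrite /k; ring.
have e1 := key fst (@fst_n1 R) (fun _ _ => erefl) (fun _ => erefl) i1.
have e2 := key snd (@snd_n1 R) (fun _ _ => erefl) (fun _ => erefl) i2.
rewrite (_ : y b - y a = (primit (fun s => (Defs.field F G (y s) (u s)).1) b - primit (fun s => (Defs.field F G (y s) (u s)).1) a,
  primit (fun s => (Defs.field F G (y s) (u s)).2) b - primit (fun s => (Defs.field F G (y s) (u s)).2) a)); last first.
  rewrite (E b) // (E a); last by rewrite a0 (le_trans ab).
  by apply: vecP; rewrite /=; ring.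
rewrite {1}/n1 /= !fst_sum !snd_sum.
by rewrite (le_trans (lerD e1 e2)) // -mulrDl -mulrDl -natrD.
Qed.

(** The origin is an equilibrium for the zero control, so a trajectory that arrives early can wait
    there. *)
Lemma steers_extend z t u y (t' : R) : F (0, 0) = (0, 0) -> steers F G z t u y -> t <= t' ->
  exists u' y', steers F G z t' u' y'.
Proof.
move=> F0 [t0 [adm [tr yt]]] tt'.
have [y0 [c1 [c2 _]]] := tr.
have [i1 i2 E] := traj_primit F G L hF hG _ _ _ _ adm tr.
pose u' s := if s <= t then u s else fun=> 0 : R.
pose y' s := if s <= t then y s else (0, 0).
have d0 : 0 <= t' - t by rewrite subr_ge0.
have adm' : admissible u' t'.
  move=> i; have [mu_ ub] := adm i; split=> [|s /andP[s0 st]].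
    have -> : (fun s => u' s i) = (fun s => if s <= t then u s i else 0).
      by apply/funext => s; rewrite /u'; case: ifP.
    apply: measurable_fun_if; first exact: measurable_itv.
    - by apply: measurable_fun_ler; [exact: measurable_id|exact: measurable_cst].
    - apply: measurable_funS mu_ => // s [/=]; rewrite !in_itv /= => /andP[-> _] -> //.
    - exact: measurable_cst.
  rewrite /u'; case: (leP s t) => se; last by rewrite normr0.
  by apply: ub; rewrite s0.
have cc (p : R * R -> R) : p (0, 0) = 0 -> {within `[0, t]%classic, continuous (fun s => p (y s))} ->
    {within `[0, t']%classic, continuous (fun s => p (y' s))}.
  move=> p0 cp; have := glue_continuous (fun s => p (y s)) (fun=> 0) t (t' - t) t0 d0 cp.
  rewrite [t + _]addrC subrK yt p0 (_ : (fun s => if s <= t then p (y s) else 0) = (fun s => p (y' s))).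
    by apply => //; apply: continuous_subspaceT => x; exact: cst_continuous.
  by apply/funext => s; rewrite /y'; case: ifP.
have c1' := cc fst erefl c1; have c2' := cc snd erefl c2.
exists u', y'; split; first by rewrite (le_trans t0).
split=> //; split; last first.
  rewrite /y'; case: (leP t' t) => h //.
  by rewrite (_ : t' = t) //; apply/le_anti; rewrite h.
apply: (primit_traj F G L) => //; first exact: le_trans tt'.
have [f1 f2] := traj_integrable F G L hF hG _ _ _ adm' c1' c2'.
have key (p : R * R -> R) : p (0, 0) = 0 ->
    mu.-integrable `[0, t']%classic (EFin \o (fun s => p (Defs.field F G (y' s) (u' s)))) ->
    forall s : R, 0 <= s <= t' -> primit (fun s => p (Defs.field F G (y' s) (u' s))) s =
    primit (fun s => p (Defs.field F G (y s) (u s))) (Num.min s t).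
  move=> p0 ip s /andP[s0 st].
  have lo (q : R) : q <= t -> primit (fun s => p (Defs.field F G (y' s) (u' s))) q =
      primit (fun s => p (Defs.field F G (y s) (u s))) q.
    move=> qt; apply: eq_Rintegral => x; rewrite inE /= in_itv /= => /andP[x0 xs].
    by rewrite /y' /u' (le_trans xs qt).
  case: (leP s t) => h; first exact: lo.
  rewrite -lo //; have := primit_bound_oo _ _ t s 0 0 ip t0 (ltW h) st.
  rewrite !mul0r subr0 => I.
  have {}I : `|primit (fun s => p (Defs.field F G (y' s) (u' s))) s -
     primit (fun s => p (Defs.field F G (y' s) (u' s))) t| <= 0.
    apply: I => x /andP[tx _]; rewrite /y' /u' (leNgt x t) tx /= (_ : Defs.field _ _ _ _ = (0, 0)) ?p0 ?subr0 ?normr0 //.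
    by rewrite /Defs.field F0 /=; apply: vecP; rewrite /= big1 ?addr0 // => i _; rewrite mul0r.
  by apply/eqP; rewrite -subr_eq0 -normr_le0.
move=> s hs; rewrite (key fst) // (key snd) //.
have hm : 0 <= Num.min s t <= t by have /andP[s0 _] := hs; rewrite le_min s0 t0 ge_min lexx orbT.
rewrite -E //; rewrite /y'; case: (leP s t) => // h; exact: esym.
Qed.

End ControlIncrements.

Section OriginData.
Context {R : realType}.

Lemma jac_grad (V : R * R -> R * R) x :
  [/\ jac V x ord0 ord0 = (grad V x).1.1, jac V x ord0 ord_max = (grad V x).1.2,
      jac V x ord_max ord0 = (grad V x).2.1 & jac V x ord_max ord_max = (grad V x).2.2].
Proof. by rewrite /jac !mxE. Qed.

Lemma jac0_grad (V : R * R -> R * R) x : jac V x = 0 -> grad V x = 0.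
Proof.
move=> j0; have [] := jac_grad V x; rewrite j0 !mxE => h1 h2 h3 h4.
case: (grad V x) h1 h2 h3 h4 => [[a b] [c d]] /= <- <- <- <- //.
Qed.

Lemma det_mx2 (B : 'M[R]_2) :
  \det B = B ord0 ord0 * B ord_max ord_max - B ord0 ord_max * B ord_max ord0.
Proof.
rewrite (expand_det_row _ ord0) big_ord_recl big_ord1 /cofactor !det_mx11 !mxE /=.
rewrite (_ : lift ord0 ord0 = ord_max :> 'I_2); last exact: val_inj.
rewrite (_ : lift ord_max ord0 = ord0 :> 'I_2); last exact: val_inj.
by rewrite expr0 expr1; ring.
Qed.

(** The cross product is the determinant of the matrix whose rank is given. *)
Lemma rank_cross (V : R * R -> R * R) x (g : R * R) :
  \rank (row_mx (colv g) (jac V x *m colv g)) = 2%N -> cross g (ap (grad V x) g) != 0.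
Proof.
set B := row_mx _ _ => rB.
have uB : (B : 'M[R]_2) \in unitmx by rewrite -row_free_unit /row_free rB.
move: uB; rewrite unitmxE unitfE det_mx2.
have [j1 j2 j3 j4] := jac_grad V x.
have l0 (i : 'I_2) : B i ord0 = Defs.coord i g.
  have -> : B i ord0 = B i (lshift 1 ord0) by congr (B i _); exact: val_inj.
  by rewrite /B row_mxEl mxE.
have l1 (i : 'I_2) : B i ord_max = jac V x i ord0 * g.1 + jac V x i ord_max * g.2.
  have -> : B i ord_max = B i (rshift 1 ord0) by congr (B i _); exact: val_inj.
  rewrite /B row_mxEr mxE big_ord_recl big_ord1.
  rewrite (_ : lift ord0 ord0 = ord_max :> 'I_2); last exact: val_inj.
  by rewrite !(mxE _ _ (_ : 'I_2) (_ : 'I_1)) /Defs.coord.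
rewrite !l0 !l1 j1 j2 j3 j4 /Defs.coord /= /cross /ap /dot /=.
by congr (_ != _); ring.
Qed.

(** At the origin both vectors are multiples of [e0], so the term of order 0 vanishes. [H] is flat
    there because [A' 0 = 0], so the linear term comes only from the variation
    [- a *: ap (A 0) (V 0)] of [V] along [xi]; it is the number governed by the rank condition. *)
Lemma sign_estimate (V H : R * R -> R * R) A A' xi x (e0 : R * R) (r K C h a B k c q : R) :
  nice V A r K -> nice H A' r K -> 0 <= K -> 0 <= C -> 0 <= r -> A' 0 = 0 ->
  (forall s : R, 0 <= s <= h -> n1 (xi s) <= r) -> xi 0 = 0 ->
  follows (fun z => - V z) xi 0 h C -> 0 <= a <= h -> h <= 1 -> 0 <= B ->
  n1 x <= r -> n1 x <= B * a ->
  V 0 = k *: e0 -> H 0 = c *: e0 -> q = cross e0 (ap (A 0) e0) ->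
  `|cross (V (xi a)) (H x) - a * (k * c * q)| <=
  ((K * (K + C) ^+ 2 + K * C) * K + K * (K * B ^+ 2)) * a ^+ 2.
Proof.
move=> nV nH K0 C0 r0 A'0 xr xi0 fx ha h1 B0 xr' xB V0 H0 qE.
have /andP[a0 ah] := ha.
have z0 : n1 (0 : R * R) <= r by rewrite n10.
have h00 : 0 <= (0 : R) <= h by rewrite lexx (le_trans a0).
have f := fx 0 a h00 ha; rewrite xi0 !subr0 scalerN opprK in f.
have [V0K A0K /(_ _ (xr a ha))[_ TV]] := nV 0 z0; rewrite subr0 in TV.
have [HK _ /(_ _ xr')[_ TH]] := nH 0 z0.
rewrite A'0 subr0 (_ : ap 0 x = 0) ?subr0 in TH; last by apply: vecP; rewrite /ap /dot /= !mul0r addr0.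
have [VaK _ _] := nV _ (xr a ha).
have a1 : a <= 1 by rewrite (le_trans ah).
have xia : n1 (xi a) <= (K + C) * a.
  have := n1B (xi a + a *: V 0) (a *: V 0); rewrite addrK n1Z (ger0_norm a0) => h'.
  have : a * n1 (V 0) <= a * K by rewrite ler_wpM2l.
  have : C * a ^+ 2 <= C * a by rewrite ler_wpM2l // expr2 ler_piMl.
  lra.
pose rho := V (xi a) - V 0 + a *: ap (A 0) (V 0).
have hrho : n1 rho <= (K * (K + C) ^+ 2 + K * C) * a ^+ 2.
  have -> : rho = (V (xi a) - V 0 - ap (A 0) (xi a)) + ap (A 0) (xi a + a *: V 0).
    by rewrite /rho; apply: vecP; rewrite /ap /dot /= /GRing.scale /=; ring.
  rewrite (le_trans (n1D _ _)) // mulrDl lerD //.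
    rewrite (le_trans TV) // -mulrA -exprMn ler_wpM2l // lerXn2r ?nnegrE ?n1_ge0 //.
    by rewrite mulr_ge0 // addr_ge0.
  by rewrite (le_trans (n1_ap _ _)) // -mulrA ler_pM ?addr_ge0 ?n1_ge0.
have -> : cross (V (xi a)) (H x) - a * (k * c * q) = cross rho (H 0) + cross (V (xi a)) (H x - H 0).
  have -> : V (xi a) = V 0 - a *: ap (A 0) (V 0) + rho.
    by rewrite /rho; apply: vecP; rewrite /= /GRing.scale /=; ring.
  clear -qE V0 H0; rewrite qE V0 H0; move: (H x) rho => hx rh.
  by rewrite /cross /ap /dot /= /GRing.scale /=; ring.
rewrite (le_trans (ler_normD _ _)) // mulrDl lerD //.
  by rewrite (le_trans (n1_cross _ _)) // mulrAC ler_pM ?n1_ge0.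
rewrite (le_trans (n1_cross _ _)) // -mulrA ler_pM ?n1_ge0 //.
rewrite (le_trans TH) // -mulrA ler_wpM2l // -exprMn lerXn2r ?nnegrE ?n1_ge0 //.
exact: mulr_ge0.
Qed.

End OriginData.

Section Deviation.
Context {R : realType}.

Lemma n1_sum {I : Type} (l : seq I) (f : I -> R * R) : n1 (\sum_(i <- l) f i) <= \sum_(i <- l) n1 (f i).
Proof.
elim: l => [|a l IH]; first by rewrite !big_nil n10.
by rewrite !big_cons (le_trans (n1D _ _)) // lerD2l.
Qed.

Lemma cross_sum {I : Type} (l : seq I) p (f : I -> R * R) :
  cross p (\sum_(i <- l) f i) = \sum_(i <- l) cross p (f i).
Proof.
elim: l => [|a l IH]; first by rewrite !big_nil /cross /= !mulr0 subrr.
by rewrite !big_cons cross_addr IH.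
Qed.

(** Both curves start at the same point in reversed time. The distance between them is at most a
    multiple of the total deficit [Us], so the Taylor error in Liouville's formula is a multiple of
    [Us ^+ 2], while [sign] makes each control increment contribute at most [- c * a] times its
    deficit. This is the situation of [comparison_le0]. *)
Lemma deviation_le {M : nat} (V : R * R -> R * R) A (G : 'I_M -> R * R -> R * R)
    (v : 'I_M -> R) (sg : R) (xi o : R -> R * R) (U : 'I_M -> R -> R) (K C1 C2 h c : R) :
  nice V A 2 K -> 0 <= K -> 0 <= C1 -> 0 <= C2 -> (forall i, `|v i| <= 1) -> `|sg| <= 1 ->
  (forall i x, n1 x <= 2 -> n1 (G i x) <= K) ->
  (forall s : R, 0 <= s <= h -> n1 (xi s) <= 2) -> follows (fun x => - V x) xi 0 h C1 ->
  xi 0 = o 0 -> (forall s : R, 0 <= s <= h -> n1 (o s) <= 1) ->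
  (forall i, U i 0 = 0) ->
  (forall i (a b : R), 0 <= a -> a <= b -> b <= h -> 0 <= U i b - U i a <= 2 * (b - a)) ->
  (forall a b : R, 0 <= a -> a <= b -> b <= h ->
    n1 (o b - o a + (b - a) *: V (o a) - \sum_(i < M) (v i * (U i b - U i a)) *: G i (o a))
      <= C2 * (b - a) ^+ 2) ->
  (forall i (a : R), 0 <= a <= h -> sg * v i * cross (V (xi a)) (G i (o a)) <= - (c * a)) ->
  0 <= h -> h <= 1 -> 0 < c -> K * h <= 2^-1 -> K * (2 * M%:R) * h <= 1 ->
  (4 * K ^+ 4 * (2 * (2 * M%:R) + 1) / c + K) * h <= 1 ->
  forall s : R, 0 <= s <= h -> sg * cross (V (xi s)) (o s - xi s) <= 0.
Proof.
move=> nV K0 C10 C20 v1 sg1 GK xr fx xo ob U0 HU fo sign h0 h1 c0 Kh KM Lh.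
pose Us s := \sum_(i < M) U i s; pose m : R := 2 * M%:R.
have m0 : 0 <= m by rewrite mulr_ge0.
have dUs (a b : R) : Us b - Us a = \sum_(i < M) (U i b - U i a) by rewrite /Us sumrB.
have HUs (a b : R) : 0 <= a -> a <= b -> b <= h -> 0 <= Us b - Us a <= m * (b - a).
  move=> a0 ab bh; rewrite dUs sumr_ge0 /= => [|i _]; last by have /andP[] := HU i a b a0 ab bh.
  have -> : m * (b - a) = \sum_(i < M) 2 * (b - a).
    by rewrite sumr_const card_ord -mulr_natr /m; ring.
  by apply: ler_sum => i _; have /andP[] := HU i a b a0 ab bh.
have Us0 : Us 0 = 0 by rewrite /Us big1.
pose w (a b : R) := \sum_(i < M) (v i * (U i b - U i a)) *: G i (o a).
have or2 (s : R) : 0 <= s <= h -> n1 (o s) <= 2 by move=> /ob; lra.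
have hw (a b : R) : 0 <= a -> a <= b -> b <= h -> n1 (w a b) <= K * (Us b - Us a).
  move=> a0 ab bh; rewrite (le_trans (n1_sum _ _)) // dUs mulr_sumr; apply: ler_sum => i _.
  have /andP[u0 _] := HU i a b a0 ab bh.
  rewrite n1Z normrM (ger0_norm u0) mulrC ler_pM ?n1_ge0 ?mulr_ge0 //.
    by apply: GK; apply: or2; rewrite a0 (le_trans ab).
  by rewrite -[leRHS]mul1r ler_wpM2r.
pose d s := o s - xi s.
have d0 : d 0 = 0 by rewrite /d xo subrr.
have split_d (a b : R) : d b = d a - (b - a) *: (V (o a) - V (xi a)) + w a b +
    (o b - o a + (b - a) *: V (o a) - w a b) - (xi b - xi a - (b - a) *: - V (xi a)).
  by rewrite /d; move: (w a b) (V (o a)) (V (xi a)) => w1 w2 w3; apply: vecP; rewrite /= /GRing.scale /=; ring.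
(* Deficits enter the deviation directly, through [K * Us], and through the flow; Gronwall's lemma
   is applied to what exceeds the direct part. *)
have hd (s : R) : 0 <= s <= h -> n1 (d s) <= 2 * K * Us s.
  move=> /andP[s0 sh]; pose g q := Num.max (n1 (d q) - K * Us q) 0.
  have U0s : 0 <= Us s by have := HUs 0 s (lexx _) s0 sh; rewrite Us0 subr0 => /andP[].
  have Ks : K * s <= 2^-1 by rewrite (le_trans _ Kh) // ler_wpM2l.
  have E0 : 0 <= K ^+ 2 * Us s by rewrite mulr_ge0 ?sqr_ge0.
  have hs : 0 <= s <= s by rewrite s0 lexx.
  have := @gronwall_quad _ g s K (K ^+ 2 * Us s) (C2 + C1) s0 K0 E0 Ks _ _ s hs.
  have -> : g 0 = 0 by rewrite /g d0 n10 Us0 mulr0 subr0 maxxx.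
  rewrite add0r => G0.
  have {G0} : g s <= 2 * (K ^+ 2 * Us s * s).
    apply: G0 => [q _|a b a0 ab bs]; first by rewrite /g le_max lexx orbT.
    have bh := le_trans bs sh.
    have ha : 0 <= a <= h by rewrite a0 (le_trans ab).
    have hb : 0 <= b <= h by rewrite (le_trans a0).
    have D0 : 0 <= b - a by rewrite subr_ge0.
    have /andP[dU0 _] := HUs a b a0 ab bh.
    have /andP[ dUs0 _] := HUs b s (le_trans a0 ab) bs sh.
    have i1 := fo a b a0 ab bh; have i2 := fx a b ha hb; have i3 := hw a b a0 ab bh.
    rewrite -/(w a b) in i1.
    have [_ _ /(_ _ (or2 _ ha))[l _]] := nV _ (xr _ ha); rewrite -/(d a) in l.
    have l' : (b - a) * n1 (V (o a) - V (xi a)) <= (b - a) * (K * n1 (d a)) by rewrite ler_wpM2l.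
    have fb : n1 (d b) <= n1 (d a) + K * n1 (d a) * (b - a) + K * (Us b - Us a) + (C2 + C1) * (b - a) ^+ 2.
      rewrite (split_d a b).
      apply: le_trans (n1B _ _) _; have := n1D (d a - (b - a) *: (V (o a) - V (xi a)) + w a b) (o b - o a + (b - a) *: V (o a) - w a b).
      have := n1D (d a - (b - a) *: (V (o a) - V (xi a))) (w a b).
      have := n1B (d a) ((b - a) *: (V (o a) - V (xi a))); rewrite n1Z (ger0_norm D0).
      move: i1 i2 i3 l'; clear; lra.
    have ga : n1 (d a) - K * Us a <= g a by rewrite /g le_max lexx.
    have ga0 : 0 <= g a by rewrite /g le_max lexx orbT.
    have C20' : 0 <= (C2 + C1) * (b - a) ^+ 2 by rewrite mulr_ge0 ?sqr_ge0 // addr_ge0.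
    rewrite lerBlDl {1}/g ge_max; apply/andP; split; last first.
      have := mulr_ge0 (mulr_ge0 K0 ga0) D0; have := mulr_ge0 E0 D0.
      move: ga0 C20'; clear; lra.
    have KU : K * Us a <= K * Us s by rewrite ler_wpM2l //; move: dU0 dUs0; clear; lra.
    have : K * n1 (d a) * (b - a) <= K * (g a + K * Us s) * (b - a).
      by rewrite ler_wpM2r // ler_wpM2l //; move: ga KU; clear; lra.
    have -> : K ^+ 2 * Us s = K * (K * Us s) by ring.
    move: fb ga; clear; lra.
  rewrite {1}/g ge_max => /andP[gs _].
  have : 2 * (K ^+ 2 * Us s * s) <= K * Us s.
    have -> : 2 * (K ^+ 2 * Us s * s) = 2 * (K * s) * (K * Us s) by ring.
    by rewrite -[leRHS]mul1r ler_wpM2r ?mulr_ge0 //; move: Ks; clear; lra.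
  move: gs; clear; lra.
pose C3 := (K * (K + C1) ^+ 2 + K * C1) * (2 * 2) + K * (C1 + C2)
     + K * (K + C1) * (2 * K + C1 + C2).
pose C4 := C3 + K * (K + C1) * (K * m).
pose tr (a : R) := (A (xi a)).1.1 + (A (xi a)).2.2.
pose E s := sg * cross (V (xi s)) (d s).
have C40 : 0 <= C4.
  by rewrite /C4 /C3 !addr_ge0 ?mulr_ge0 ?addr_ge0 ?mulr_ge0 ?sqr_ge0 ?addr_ge0.
have K40 : 0 <= 4 * K ^+ 4 by rewrite mulr_ge0 // exprn_ge0.
apply: (@comparison_le0 _ E Us tr h m c K (4 * K ^+ 4) C4) => //.
- by rewrite /E d0 /cross /= !mulr0 subrr mulr0.
- move=> a b a0 ab bh.
  have ha : 0 <= a <= h by rewrite a0 (le_trans ab).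
  have hb : 0 <= b <= h by rewrite (le_trans a0).
  have D0 : 0 <= b - a by rewrite subr_ge0.
  have D1 : b - a <= 1 by move: a0 bh h1; clear; lra.
  have /andP[dU0 dU1] := HUs a b a0 ab bh.
  have i3 := hw a b a0 ab bh.
  (* [o b - w a b] is the competitor with its control term removed, an approximate step of [V] to
     which [cross_incr] applies. It may leave the unit ball, hence the radius 2 and the smallness
     condition on [K * (2 * M%:R) * h]. *)
  have ow : n1 (o b - w a b) <= 2.
    have : K * (Us b - Us a) <= K * (m * (b - a)) by rewrite ler_wpM2l.
    have : K * m * (b - a) <= K * m * h by rewrite ler_wpM2l ?mulr_ge0 //; move: a0 bh; clear; lra.
    have := n1B (o b) (w a b); have := ob _ hb.
    by move: i3 KM; rewrite -/m; clear; lra.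
  have fo' : n1 ((o b - w a b) - o a - (b - a) *: - V (o a)) <= C2 * (b - a) ^+ 2.
    have := fo a b a0 ab bh; rewrite -/(w a b); congr (n1 _ <= _).
    rewrite scalerN opprK; move: (w a b) (V (o a)) => w1 w2.
    by apply: vecP; rewrite /= /GRing.scale /=; ring.
  have := @cross_incr _ (fun x => - V x) (fun x => - A x) 2 K C1 C2 (b - a) (xi a) (xi b) (o a)
    (o b - w a b) (nice_opp _ _ _ _ nV) K0 C10 C20 D0 D1 (xr _ ha) (xr _ hb) (or2 _ ha) ow
    (fx _ _ ha hb) fo'.
  rewrite -/C3 -/(d a) => I.
  have trE : (- A (xi a)).1.1 + (- A (xi a)).2.2 = - tr a by rewrite /tr /= opprD.
  rewrite trE in I.
  have sI : sg * (cross (V (xi b)) (o b - w a b - xi b) - cross (V (xi a)) (d a) +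
       tr a * cross (V (xi a)) (d a) * (b - a)) <= K ^+ 2 * n1 (d a) ^+ 2 * (b - a) + C3 * (b - a) ^+ 2.
    apply: le_trans I; rewrite (le_trans (ler_norm _)) // normrM -[leRHS]mul1r ler_pM //.
    rewrite -normrN le_eqVlt; apply/orP; left; apply/eqP; congr `|_|.
    by move: (o b - w a b - xi b) (d a) (tr a) => z1 z2 z3; rewrite /cross /=; ring.
  have crw : cross (V (xi b)) (d b) = cross (V (xi b)) (o b - w a b - xi b) + cross (V (xi b)) (w a b).
    by rewrite -cross_addr addrAC subrK.
  have Vb : n1 (V (xi b) - V (xi a)) <= K * ((K + C1) * (b - a)).
    have [Va _ /(_ _ (xr _ hb))[l _]] := nV _ (xr _ ha).
    rewrite (le_trans l) // ler_wpM2l //.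
    have := fx a b ha hb; rewrite scalerN opprK => f.
    have := n1B (xi b - xi a + (b - a) *: V (xi a)) ((b - a) *: V (xi a)).
    rewrite addrK n1Z (ger0_norm D0).
    have : (b - a) * n1 (V (xi a)) <= (b - a) * K by rewrite ler_wpM2l.
    have : C1 * (b - a) ^+ 2 <= C1 * (b - a) by rewrite ler_wpM2l // expr2 ler_piMl.
    move: f; clear; lra.
  have sw : sg * cross (V (xi b)) (w a b) <= - c * a * (Us b - Us a) + K * (K + C1) * (K * m) * (b - a) ^+ 2.
    have -> : V (xi b) = V (xi a) + (V (xi b) - V (xi a)) by rewrite addrC subrK.
    rewrite cross_addl mulrDr lerD //.
      rewrite cross_sum mulr_sumr dUs mulr_sumr; apply: ler_sum => i _.
      have /andP[u0 _] := HU i a b a0 ab bh.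
      rewrite cross_zr; have := ler_wpM2r u0 (sign i a ha).
      by rewrite mulNr; congr (_ <= _); ring.
    rewrite (le_trans (ler_norm _)) // normrM -[leRHS]mul1r ler_pM //.
    rewrite (le_trans (n1_cross _ _)) //.
    have wm : n1 (w a b) <= K * (m * (b - a)) by rewrite (le_trans i3) // ler_wpM2l.
    have := ler_pM (n1_ge0 _) (n1_ge0 _) Vb wm.
    by congr (_ <= _); ring.
  have dq : K ^+ 2 * n1 (d a) ^+ 2 * (b - a) <= 4 * K ^+ 4 * Us a ^+ 2 * (b - a).
    have -> : 4 * K ^+ 4 * Us a ^+ 2 = K ^+ 2 * (2 * K * Us a) ^+ 2 by ring.
    rewrite ler_wpM2r // ler_wpM2l ?sqr_ge0 // lerXn2r ?nnegrE ?n1_ge0 ?hd //.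
    exact: le_trans (n1_ge0 _) (hd a ha).
  have -> : E b - E a = sg * (cross (V (xi b)) (o b - w a b - xi b) - cross (V (xi a)) (d a) +
       tr a * cross (V (xi a)) (d a) * (b - a)) + sg * cross (V (xi b)) (w a b) - tr a * E a * (b - a).
    by rewrite /E crw; ring.
  rewrite /C4; move: sI sw dq; clear; lra.
- move=> a ha; have [_ AK _] := nV _ (xr _ ha); apply: le_trans AK; apply: le_trans (ler_normD _ _) _.
  by apply: lerD; [exact: fst_n1|exact: snd_n1].
Qed.

End Deviation.

Definition singular_set {R : realType} {M : nat} (F : R * R -> R * R)
    (G : 'I_M -> R * R -> R * R) (tau : R) : set (R * R) :=
  [set x | reach F G tau x /\
     exists zeta, enorm zeta = 1 /\
       prox_normal (reach F G (fine (minT F G x))) x zeta /\ ham F G x zeta = 0].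

(** * Construction of an abnormal arc issued from the origin *)

Section Origin.
Context {R : realType} {M : nat}.
Variables (F : R * R -> R * R) (G : 'I_M -> R * R -> R * R) (L : R).
Hypotheses (hF : C11_vec L F) (hG : forall i, C11_vec L (G i)).
Notation X w := (fun x => Defs.field F G x w).

Lemma cross_self (p : R * R) : cross p p = 0.
Proof. by rewrite /cross mulrC subrr. Qed.

Lemma itv_sub (a s h : R) : 0 <= s <= a -> a <= h -> 0 <= a - s <= h.
Proof. by move=> /andP[s0 sa] ah; rewrite subr_ge0 sa (le_trans _ ah) // gerBl. Qed.

Lemma exists_small (l : seq R) : exists2 h : R, 0 < h & forall a, a \in l -> a * h <= 1.
Proof.
pose Q := 1 + \sum_(a <- l) `|a|.
have S0 : 0 <= \sum_(a <- l) `|a| by apply: sumr_ge0.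
have Q0 : 0 < Q by rewrite ltr_pwDl.
exists Q^-1; first by rewrite invr_gt0.
move=> a al; rewrite -/(a / Q) ler_pdivrMr // mul1r (le_trans (ler_norm a)) // /Q.
by rewrite (perm_big _ (perm_to_rem al)) big_cons addrCA lerDl addr_ge0 // sumr_ge0.
Qed.

Lemma abnormal_singular (tau : R) x p (v : 'I_M -> R) : reach F G tau x ->
  abnormal F G (fine (minT F G x)) x p -> (forall i, `|v i| <= 1) ->
  dot p (Defs.field F G x v) <= 0 -> singular_set F G tau x.
Proof.
move=> rx ab v1 pv; have [p0 _ _] := ab; split=> //.
have e0 : 0 < (enorm p)^-1.
  by rewrite invr_gt0 lt_neqAle enorm_ge0 andbT eq_sym; apply: contra_neq p0; exact: enorm_eq0.
exists ((enorm p)^-1 *: p); split; first exact: unit_enorm.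
have abZ := abnormalZ F G _ _ _ _ e0 ab; split.
  by have [_ N _] := abZ; exact: normal_prox.
apply: (abnormal_ham F G _ _ _ v abZ v1); rewrite dotZl.
by rewrite mulr_ge0_le0 // ltW.
Qed.

(** Every point steered to the origin in exactly the time [t] lies on one side of the tangent line
    of the reference curve at [xi t]; this is the future normal inequality. *)
Lemma origin_reference_optimal (v : 'I_M -> R) (sg : R) (xi : R -> R * R) (K C1 B t0 h c : R) :
  (forall i, `|v i| = 1) -> `|sg| <= 1 -> nice (X v) (fieldD F G v) 2 K -> 0 <= K -> 0 <= C1 ->
  (forall i x, n1 x <= 2 -> n1 (G i x) <= K) ->
  (forall s : R, 0 <= s <= h -> n1 (xi s) <= 2) -> follows (fun x => - Defs.field F G x v) xi 0 h C1 ->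
  xi 0 = (0, 0) ->
  (forall x t u y, t <= t0 -> steers F G x t u y ->
    forall s : R, 0 <= s <= t -> n1 (y s) <= B * (t - s) /\ n1 (y s) <= 1) ->
  (forall i (a : R) x, 0 <= a <= h -> n1 x <= 2 -> n1 x <= B * a ->
    sg * v i * cross (X v (xi a)) (G i x) <= - (c * a)) ->
  h <= t0 -> h <= 1 -> 0 < c -> K * h <= 2^-1 -> K * (2 * M%:R) * h <= 1 ->
  (4 * K ^+ 4 * (2 * (2 * M%:R) + 1) / c + K) * h <= 1 ->
  forall z t u y, 0 <= t <= h -> steers F G z t u y ->
    sg * cross (X v (xi t)) (z - xi t) <= 0.
Proof.
move=> v1 sg1 nV K0 C10 GK xr fx xi0 small sign ht0 h1 c0 Kh KM Lh z t u y /andP[t_0 th] st.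
have [_ [adm [tr yt]]] := st; have [y0 _] := tr.
have [r' [K' [r0' K0' yr nK' lip]]] := traj_lip F G L hF hG _ _ _ _ adm tr.
have yb := small z t u y (le_trans th ht0) st.
have dI i := integrable_deficit v u t i adm (v1 i).
pose o (s : R) := y (t - s).
pose U i (s : R) := primit (deficit v u i) t - primit (deficit v u i) (t - s).
(* [K'] depends on the competitor. This is harmless: it enters only the constant of a quadratic
   error, never a smallness condition on [h]. *)
have C20 : 0 <= 4 * K' ^+ 2 by rewrite mulr_ge0 // sqr_ge0.
have hq (a : R) : 0 <= a <= t -> 0 <= t - a <= t by move=> h'; exact: itv_sub h' _.
have dle (a : R) : 0 <= a -> a * t <= a * h by move=> ?; rewrite ler_wpM2l.
have tt : 0 <= t <= t by rewrite t_0 lexx.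
have -> : z - xi t = o t - xi t by rewrite /o subrr y0.
apply: (@deviation_le _ M (X v) (fieldD F G v) G v sg xi o U K C1 (4 * K' ^+ 2) t c) => //.
- by move=> i; rewrite v1.
- by move=> s /andP[s0 st']; apply: xr; rewrite s0 (le_trans st').
- by move: fx; apply: follows_sub.
- by rewrite xi0 /o subr0 yt.
- by move=> s hs; have [] := yb _ (hq s hs).
- by move=> i; rewrite /U subr0 subrr.
- move=> i a b a0 ab bt; have [di db] := dI i.
  have := primit_bound _ _ (t - b) (t - a) 1 1 di.
  rewrite (_ : t - a - (t - b) = b - a); last by ring.
  rewrite !mul1r => H; have {H} : `|primit (deficit v u i) (t - a) - primit (deficit v u i) (t - b) - (b - a)| <= b - a.
    apply: H; rewrite ?subr_ge0 ?lerD2l ?lerN2 ?gerBl //.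
    move=> x /andP[x1 x2]; have /db : 0 <= x <= t by rewrite (le_trans _ x1) ?subr_ge0 // (le_trans x2) ?gerBl.
    by rewrite ler_norml; clear -hF hG => /andP[? ?]; apply/andP; split; lra.
  rewrite ler_norml => /andP[e1 e2]; rewrite /U; apply/andP; split; move: e1 e2; clear -hF hG; lra.
- move=> a b a0 ab bt.
  have q1 : 0 <= t - b by rewrite subr_ge0.
  have q2 : t - b <= t - a by rewrite lerD2l lerN2.
  have q3 : t - a <= t by rewrite gerBl.
  have := ctrl_incr F G L hF hG v u y t z r' K' (t - b) (t - a) v1 adm tr K0' yr nK' lip q1 q2 q3.
  rewrite (_ : t - a - (t - b) = b - a); last by ring.
  rewrite -n1N; congr (n1 _ <= _); rewrite -/(o a) -/(o b).
  rewrite (eq_bigr (fun i => (v i * (U i b - U i a)) *: G i (o a))).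
    by move: (\sum_(i < M) _) (X v (o a)) => w1 w2; apply: vecP; rewrite /= /GRing.scale /=; ring.
  by move=> i _; congr (_ * _ *: _); rewrite /U; ring.
- move=> i a ha; have [y1 y2] := yb _ (hq a ha); rewrite -/(o a) in y1 y2.
  apply: sign; first by have /andP[a0 at_] := ha; rewrite a0 (le_trans at_).
    by rewrite (le_trans y2) // ler1n.
  by move: y1; rewrite subKr.
- exact: le_trans h1.
- by rewrite (le_trans (dle K K0)).
- by rewrite (le_trans (dle _ _)) // mulr_ge0 // mulr_ge0.
- by rewrite (le_trans (dle _ _)) // addr_ge0 // divr_ge0 ?(ltW c0) // !mulr_ge0 ?exprn_ge0 ?addr_ge0 ?mulr_ge0.
Qed.

(** The witness is a point of the backward trajectory of a suitable sign vector [v]. That its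
    rotated velocity is an abnormal covector follows from [sign], through comparison with all
    competitors. *)
Lemma singular_near_origin (tau : R) zeta : (0 < M)%N -> F (0, 0) = (0, 0) ->
  (forall i, \rank (row_mx (colv (G i (0, 0))) (jac F (0, 0) *m colv (G i (0, 0)))) = 2%N) ->
  (forall i, jac (G i) (0, 0) = 0) -> 0 < tau ->
  enorm zeta = 1 -> ham F G (0, 0) zeta = 0 ->
  exists2 x, x <> (0, 0) & singular_set F G tau x.
Proof.
move=> hM F0 hrank hDG tau0 z1 hz.
have zz : (0, 0) = 0 :> R * R by [].
have z0 : zeta != 0 by apply/eqP => e; move: z1; rewrite e /enorm /dot /= mulr0 addr0 sqrtr0; lra.
(* With [F] zero at the origin, [ham] is minus a sum of absolute values, so each of them vanishes.
   Hence all [G i 0] are multiples of [e0]. *)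
have dG i : dot zeta (G i (0, 0)) = 0.
  move: hz; rewrite /ham F0 /dot /= !mulr0 addr0 sub0r => /eqP; rewrite oppr_eq0 => /eqP hz.
  have := psumr_eq0P (fun i _ => normr_ge0 _) hz => /(_ i isT) /eqP; rewrite normr_eq0 => /eqP //.
pose e0 := rot90 zeta.
pose k i := cross zeta (G i (0, 0)) / dot zeta zeta.
have Gk i : G i 0 = k i *: e0 by rewrite [LHS](perp_rot _ zeta) // dotC.
pose q := cross e0 (ap (grad F 0) e0).
have rk i : k i != 0 /\ q != 0.
  have := rank_cross F (0, 0) (G i (0, 0)) (hrank i); rewrite zz Gk.
  have -> : cross (k i *: e0) (ap (grad F 0) (k i *: e0)) = k i ^+ 2 * q.
    by rewrite /q /cross /ap /dot /= /GRing.scale /=; ring.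
  by rewrite mulf_eq0 negb_or expf_eq0 /= => /andP[].
have q0 : q != 0 by have [] := rk (Ordinal hM).
have k0 i : 0 < `|k i| by have [h _] := rk i; rewrite normr_gt0.
(* With these signs the vectors [v i *: G i 0] add up without cancellation, to [kp *: e0]. *)
pose v i := Num.sg (k i).
have v1 i : `|v i| = 1 by have [h _] := rk i; rewrite normr_sg h.
have vle i : `|v i| <= 1 by rewrite v1.
(* The orientation of the covector for which the linear term of [sign_estimate] is negative. *)
pose sg := - Num.sg q.
have sg1 : `|sg| <= 1 by rewrite normrN normr_sg q0.
pose kp := \sum_(i < M) `|k i|.
have kp0 : 0 < kp.
  by rewrite /kp (bigD1 (Ordinal hM)) //= ltr_wpDr // sumr_ge0.
pose V := X v.
have V0 : V 0 = kp *: e0.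
  rewrite /V field_sum -zz F0 zz add0r /kp scaler_suml; apply: eq_bigr => i _.
  by rewrite Gk scalerA normrEsg.
have D0 : fieldD F G v 0 = grad F 0.
  rewrite /fieldD big1 ?addr0 // => i _.
  by rewrite (jac0_grad (G i) 0 (hDG i)) scaler0.
have V0n : 0 < n1 (V 0).
  rewrite V0 n1Z mulr_gt0 // ?gtr0_norm // n1_rot90 lt_neqAle n1_ge0 andbT eq_sym.
  by apply: contra_neq z0 => e; apply: n1_eq0; rewrite e.
have [K1 K10 nK1] := field_nice F G L 2 (ler0n _ 2) hF hG.
have /choice[KG hKG] : forall i, exists Ki : R, 0 <= Ki /\ nice (G i) (grad (G i)) 2 Ki.
  by move=> i; have [Ki Ki0 n] := C11_nice L (G i) 2 (ler0n _ 2) (hG i); exists Ki.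
pose K := K1 + \sum_(i < M) KG i.
have SK0 : 0 <= \sum_(i < M) KG i by apply: sumr_ge0 => i _; have [] := hKG i.
have K0 : 0 <= K by rewrite addr_ge0.
have nV : nice V (fieldD F G v) 2 K by apply: nice_le (nK1 v vle); rewrite lerDl.
have nG i : nice (G i) (grad (G i)) 2 K.
  have [Ki0 n] := hKG i; apply: nice_le n; rewrite /K (bigD1 i) //= addrCA lerDl addr_ge0 //.
  by apply: sumr_ge0 => j _; have [] := hKG j.
have GK i x : n1 x <= 2 -> n1 (G i x) <= K by move=> hx; have [] := nG i x hx.
have [B1 [t0 [B10 t00 small1]]] := small_time F G L hF hG.
pose C1 : R := 4 * K ^+ 2; have C10 : 0 <= C1 by rewrite mulr_ge0 // sqr_ge0.
pose B := B1 + (K + C1).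
have KC : 0 <= K + C1 by rewrite addr_ge0.
have B0 : 0 <= B by rewrite addr_ge0.
have small x t u y : t <= t0 -> steers F G x t u y ->
    forall s : R, 0 <= s <= t -> n1 (y s) <= B * (t - s) /\ n1 (y s) <= 1.
  move=> tt st s hs; have [h1 h2] := small1 x t u y tt st s hs; split=> //.
  by rewrite (le_trans h1) // ler_wpM2r ?lerDl // subr_ge0; have /andP[] := hs.
pose S := 1 + \sum_(i < M) `|k i|^-1.
have S1 : 0 <= \sum_(i < M) `|k i|^-1 by apply: sumr_ge0 => i _; rewrite invr_ge0.
have S0 : 0 < S by rewrite ltr_pwDl.
have kS i : S^-1 <= `|k i|.
  rewrite -[leRHS]invrK lef_pV2 ?posrE ?invr_gt0 // /S (bigD1 i) //= addrCA lerDl addr_ge0 //.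
  by apply: sumr_ge0 => j _; rewrite invr_ge0.
(* [S^-1] is a lower bound for all [|k i|]; the factor 2 leaves half of the linear term to absorb
   the quadratic error [C5]. *)
pose c := kp * `|q| / (2 * S).
have qp : 0 < `|q| by rewrite normr_gt0.
have c0 : 0 < c by rewrite divr_gt0 // mulr_gt0.
pose C5 := (K * (K + C1) ^+ 2 + K * C1) * K + K * (K * B ^+ 2).
(* The last two conditions keep the point [xi (h / 2)] and the velocity there different from
   zero. *)
have [h h0 hl] := exists_small [:: 1; 4 * K; K * (2 * M%:R);
  4 * K ^+ 4 * (2 * (2 * M%:R) + 1) / c + K; t0^-1; C5 / c; tau^-1;
  2 * C1 / n1 (V 0); 2 * (K * (K + C1)) / n1 (V 0)].
have h1 : h <= 1 by rewrite -[h]mul1r hl // !inE eqxx ?orbT.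
have h2 : 4 * K * h <= 1 by rewrite hl // !inE eqxx ?orbT.
have h3 : K * (2 * M%:R) * h <= 1 by rewrite hl // !inE eqxx ?orbT.
have h4 : (4 * K ^+ 4 * (2 * (2 * M%:R) + 1) / c + K) * h <= 1 by rewrite hl // !inE eqxx ?orbT.
have dv a b : 0 < b -> a / b * h <= 1 -> a * h <= b.
  by move=> b0; rewrite mulrAC ler_pdivrMr // mul1r.
have h5 : h <= t0 by rewrite -[h]mul1r dv // mul1r hl // !inE eqxx ?orbT.
have h6 : C5 * h <= c by rewrite dv // hl // !inE eqxx ?orbT.
have h7 : h <= tau by rewrite -[h]mul1r dv // mul1r hl // !inE eqxx ?orbT.
have h8 : 2 * C1 * h <= n1 (V 0) by rewrite dv // hl // !inE eqxx ?orbT.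
have h9 : 2 * (K * (K + C1)) * h <= n1 (V 0) by rewrite dv // hl // !inE eqxx ?orbT.
have Kh : K * h <= 2^-1 by move: h2; clear -hF hG; lra.
have z2 : n1 (0 : R * R) <= 1 by rewrite n10.
have hr : 1 + 2 * K * h <= 2 by move: h2; clear -hF hG; lra.
have [xi [xi0 xr fx]] := picard _ _ _ _ _ _ _ (nice_opp _ _ _ _ nV) K0 (ltW h0) z2 hr h2.
rewrite -/C1 in fx.
have lipx (a b : R) : 0 <= a <= h -> 0 <= b <= h -> n1 (xi b - xi a) <= (K + C1) * `|b - a|.
  move=> ha hb; have f := fx a b ha hb; rewrite scalerN opprK in f.
  have := n1B (xi b - xi a + (b - a) *: V (xi a)) ((b - a) *: V (xi a)).
  rewrite addrK n1Z.
  have [Va _ _] := nV _ (xr _ ha).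
  have : `|b - a| * n1 (V (xi a)) <= `|b - a| * K by rewrite ler_wpM2l.
  have n2 : (b - a) ^+ 2 <= `|b - a|.
    rewrite -(real_normK (num_real (b - a))) expr2 ler_piMl //.
    by rewrite ler_norml; move: ha hb h1; clear -hF hG; move=> /andP[? ?] /andP[? ?] ?; apply/andP; split; lra.
  have : C1 * (b - a) ^+ 2 <= C1 * `|b - a| by rewrite ler_wpM2l.
  move: f; clear -hF hG; lra.
have sign i (a : R) x : 0 <= a <= h -> n1 x <= 2 -> n1 x <= B * a ->
    sg * v i * cross (V (xi a)) (G i x) <= - (c * a).
  move=> ha x2 xB; have /andP[a0 ah] := ha.
  have := @sign_estimate _ V (G i) _ _ xi x e0 2 K C1 h a B kp (k i) q nV (nG i) K0 C10 (ler0n _ 2)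
    (jac0_grad _ _ (hDG i)) xr xi0 fx ha h1 B0 x2 xB V0 (Gk i).
  rewrite D0 -/C5 => /(_ erefl); set cr := cross _ _ => I.
  have sv : `|sg * v i| <= 1 by rewrite normrM v1 mulr1.
  have J : sg * v i * (cr - a * (kp * k i * q)) <= C5 * a ^+ 2.
    by rewrite (le_trans (ler_norm _)) // normrM -[leRHS]mul1r ler_pM.
  have e : sg * v i * (a * (kp * k i * q)) = - (a * (kp * `|k i| * `|q|)).
    by rewrite !normrEsg /sg /v; ring.
  have cE : 2 * c = kp * S^-1 * `|q| by rewrite /c; field; rewrite gt_eqF.
  have l1 : a * (2 * c) <= a * (kp * `|k i| * `|q|).
    by rewrite cE ler_wpM2l // ler_wpM2r // ler_wpM2l // ltW.
  have l2 : C5 * a ^+ 2 <= c * a.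
    rewrite expr2 mulrA ler_wpM2r // (le_trans _ h6) // ler_wpM2l //.
    by rewrite /C5 !addr_ge0 ?mulr_ge0 ?addr_ge0 ?mulr_ge0 ?sqr_ge0.
  have {J} : sg * v i * cr - sg * v i * (a * (kp * k i * q)) <= C5 * a ^+ 2 by rewrite -mulrBr.
  by rewrite e; move: l1 l2; clear -hF hG; lra.
have opt := origin_reference_optimal v sg xi K C1 B t0 h c v1 sg1 nV K0 C10 GK xr fx xi0 small sign
  h5 h1 c0 Kh h3 h4.
(* The point is taken halfway, which leaves room for times [s] slightly larger than [a]. *)
pose a : R := h / 2.
have a0 : 0 < a by rewrite divr_gt0.
have ah2 : a + a = h by rewrite /a -splitr.
have ha : 0 <= a <= h by rewrite -ah2 lerDl !ltW.
have h00 : 0 <= (0 : R) <= h by rewrite lexx ltW.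
pose x := xi a.
have xn : n1 x <= (K + C1) * a.
  by have := lipx 0 a h00 ha; rewrite xi0 !subr0 (gtr0_norm a0).
have x_neq0 : x <> 0.
  move=> ex; have := fx 0 a h00 ha; rewrite xi0 -/x ex !subr0 sub0r scalerN opprK n1Z (gtr0_norm a0).
  rewrite expr2 mulrA [a * _]mulrC ler_pM2r // => n.
  have : C1 * (a + a) = C1 * h by rewrite ah2.
  move: n h8 V0n; clear -hF hG; lra.
have Vx : V x != 0.
  apply/eqP => ex; have [_ _ /(_ _ (xr _ ha))[l _]] := nV 0 (le_trans z2 (ler1n _ 2)).
  rewrite -/x ex subr0 sub0r n1N in l.
  have : K * n1 x <= K * ((K + C1) * a) by rewrite ler_wpM2l.
  have : K * (K + C1) * (a + a) = K * (K + C1) * h by rewrite ah2.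
  move: l h9 V0n; clear -hF hG; lra.
have Tx : (minT F G x <= a%:E)%E.
  have bx (s : R) : 0 <= s <= a -> n1 (xi (a - s)) <= 2.
    by move=> hs; apply: xr; apply: itv_sub hs _; have /andP[] := ha.
  have f1 : follows V (fun s => xi (a - s)) 0 a C1.
    have := follows_rev _ _ _ _ _ a fx; rewrite subr0 => f2 s s' hs hs'.
    have f3 := follows_sub _ _ _ _ 0 a _ _ (lexx a) f2; have := f3 _ s s' hs hs'.
    by rewrite subr_le0 opprK; apply; have /andP[] := ha.
  have := minT_dp F G L hF hG v (fun s => xi (a - s)) a C1 2 vle (ltW a0) (ler0n _ 2) bx f1.
  by rewrite subr0 subrr xi0 -zz (minT0 F G L hF hG) adde0.
have Tge := minT_ge0 F G x.
have Tfin : (minT F G x) \is a fin_num.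
  by rewrite ge0_fin_numE // (le_lt_trans Tx) // ltry.
exists x => //; apply: (abnormal_singular tau x (sg *: rot90 (V x)) v) => //.
- by rewrite /reach /= (le_trans Tx) // lee_fin (le_trans _ h7) //; have /andP[] := ha.
- split.
  + rewrite scaler_eq0 negb_or rot90_neq0 // andbT.
    by rewrite /sg oppr_eq0 sgr_eq0.
  + move=> z rz; rewrite dotZl dot_rot.
    pose f (s : R) := sg * cross (V (xi s)) (z - xi s).
    rewrite -/(f a).
    (* The infimum defining [minT F G z] need not be attained, so [z] is steered in each time
       [s > a], waiting at the origin if necessary, and then [s] tends to [a]. The bound
       [minT F G x <= a] suffices for this. *)
    apply: (lim_le0 f a a (K * (K + C1) * (n1 z + 2) + K * (K + C1))) => // s /andP[as_ sh].
      have sh' : s <= h by rewrite -ah2.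
      have : (minT F G z < s%:E)%E.
        apply: (le_lt_trans rz); rewrite fineK //; apply: (le_lt_trans Tx); by rewrite lte_fin.
      move=> /ereal_inf_lt [_ [t [u [y st]] <-]]; rewrite lte_fin => ts.
      have [u' [y' st']] := steers_extend F G L hF hG z t u y s F0 st (ltW ts).
      by apply: opt st'; rewrite sh' andbT ltW // (lt_trans a0).
    have hs : 0 <= s <= h by rewrite -ah2 sh andbT ltW // (lt_trans a0).
    have -> : f s - f a = sg * (cross (V (xi s) - V (xi a)) (z - xi s) - cross (V (xi a)) (xi s - xi a)).
      by rewrite /f; move: (V (xi s)) (V (xi a)) => w1 w2; rewrite /cross /=; ring.
    rewrite normrM (le_trans (ler_piMl (normr_ge0 _) sg1)) // (le_trans (ler_normB _ _)) //.
    have l := lipx a s ha hs; rewrite ger0_norm ?subr_ge0 ?(ltW as_) // in l.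
    have [Va _ /(_ _ (xr _ hs))[lV _]] := nV _ (xr _ ha).
    have s0 : 0 <= s - a by rewrite subr_ge0 ltW.
    have l' : n1 (V (xi s) - V (xi a)) <= K * ((K + C1) * (s - a)).
      by rewrite (le_trans lV) // ler_wpM2l.
    have zx : n1 (z - xi s) <= n1 z + 2 by rewrite (le_trans (n1B _ _)) // lerD2l xr.
    rewrite mulrDl lerD // (le_trans (n1_cross _ _)) //.
      by apply: le_trans (ler_pM (n1_ge0 _) (n1_ge0 _) l' zx) _; rewrite le_eqVlt; apply/orP; left; apply/eqP; ring.
    by rewrite -mulrA ler_pM ?n1_ge0.
  + move=> w w1.
    (* The velocity of [v] has pairing zero, so it is enough that [v] minimises the pairing term by
       term, which is the sign condition at [x]. *)
    have pV : dot (sg *: rot90 (V x)) (V x) = 0 by rewrite dotZl dot_rot cross_self mulr0.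
    rewrite -pV /V !dot_field lerD2l; apply: ler_sum => i _.
    have xB : n1 x <= B * a by rewrite (le_trans xn) // ler_wpM2r ?(ltW a0) // lerDr.
    have := sign i a x ha (xr _ ha) xB; rewrite -/x => sn.
    rewrite dotZl dot_rot -/(V x); set g := cross _ _ in sn *.
    have ca : 0 <= c * a by rewrite mulr_ge0 // ltW.
    have vg : v i * (sg * g) = - `|sg * g|.
      rewrite -[LHS]opprK; congr (- _).
      have -> : `|sg * g| = `|v i * (sg * g)| by rewrite [RHS]normrM v1 mul1r.
      by rewrite ler0_norm //; rewrite (le_trans _ (_ : - (c * a) <= 0)) ?oppr_le0 // mulrCA mulrA.
    rewrite vg lerNl (le_trans (ler_norm _)) // normrN normrM.
    by rewrite ler_piMl.
- by rewrite dotZl dot_rot cross_self mulr0.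
Qed.

End Origin.

Lemma clamp_lip {R : realType} (t s s' : R) : 0 <= t ->
  `|Num.max 0 (Num.min s t) - Num.max 0 (Num.min s' t)| <= `|s - s'|.
Proof.
move=> t0; wlog ss : s s' / s' <= s.
  move=> H; have [/H//|/ltW/H] := leP s' s.
  by rewrite distrC [leRHS]distrC.
rewrite [leRHS]ger0_norm ?subr_ge0 //.
case: (leP s t) => h1; case: (leP s' t) => h2; rewrite ?(max_r t0) ?subrr ?normr0 ?subr_ge0 //;
  do ?[case: (leP 0 s) => h3]; do ?[case: (leP 0 s') => h4]; rewrite ler_norml; apply/andP; split; lra.
Qed.

(** * Structure of the singular set: arcs, measure and covering *)

Section SingularSet.
Context {R : realType} {M : nat}.
Variables (F : R * R -> R * R) (G : 'I_M -> R * R -> R * R) (L : R).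
Hypotheses (hF : C11_vec L F) (hG : forall i, C11_vec L (G i)).
Variable calT : R.
Hypothesis ha : forall t, 0 < t < calT -> prop_a F G t.
Variable tau : R.
Hypothesis htau : 0 < tau < calT.
Notation X w := (fun x => Defs.field F G x w).
Notation S := (singular_set F G tau).

Lemma singular_arc x : S x -> x <> (0, 0) ->
  exists t Y, [/\ 0 < t, t <= tau, abnormal_arc F G t Y, Y 0 = (0, 0) & Y t = x].
Proof.
move=> [rx [p [p1 [pn hp]]]] x0; have /andP[tau0 tc] := htau.
have Tfin : minT F G x \is a fin_num.
  by rewrite ge0_fin_numE ?minT_ge0 // (le_lt_trans rx) // ltry.
have tE : minT F G x = (fine (minT F G x))%:E by rewrite fineK.
set t := fine (minT F G x) in tE pn.
have t0 : 0 < t.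
  rewrite ltNge; apply/negP => tn; apply: x0; apply: (minT_eq0 F G L hF hG).
  by rewrite tE lee_fin.
have tt : t <= tau by rewrite -lee_fin -tE.
have htc : 0 < t < calT by rewrite t0 (le_lt_trans tt).
have rt : reach F G t x by rewrite /reach /= tE.
have p0 : p != 0 by apply/eqP => e; move: p1; rewrite e /enorm /dot /= mulr0 addr0 sqrtr0 => /eqP; rewrite eq_sym oner_eq0.
have ab : abnormal F G t x p.
  split=> //; last exact: ham_abnormal.
  by have [sc _] := ha _ htc; exact: prox_normal_normal.
have [Y [arc Y0 Yt]] := abnormal_has_arc F G L hF hG calT ha x t p htc tE ab.
by exists t, Y.
Qed.

(** The piece to the left of [s] has a velocity orthogonal to the covector, so the inequality in
    [abnormal] becomes [ham = 0]. *)
Lemma arc_singular t Y (s : R) : abnormal_arc F G t Y -> t <= tau -> 0 < s <= t -> S (Y s).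
Proof.
move=> arc tt hs; have /andP[s0 st] := hs.
have Ts : minT F G (Y s) = s%:E by apply: (arc_time _ _ _ _ arc); rewrite ltW.
have [p ab] := arc_abnormal _ _ _ _ arc s hs.
have [v [h [C [v1 h0 C0 hs' fl]]]] := arc_left _ _ _ _ arc s hs.
have vle i : `|v i| <= 1 by rewrite v1.
apply: (abnormal_singular F G tau _ p v) => //.
- by rewrite /reach /= Ts lee_fin (le_trans st).
- by rewrite Ts.
- rewrite (arc_perp F G t Y v (s - h) s C s p arc) // ?subr_ge0 //.
  by rewrite gtrBl h0 lexx.
Qed.

(** The centre [z] is separate from [x] because at the origin an arc ending at another point of the
    set must be used. *)
Lemma singular_H1 x z : S x -> x <> (0, 0) ->
  exists delta : R, 0 < delta /\ (0 < H1 (S `&` eball z delta))%E.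
Proof.
move=> Sx x0; have [t [Y [t0 tt arc Y0 Yt]]] := singular_arc x Sx x0.
have [r [B [_ [r0 B0 _ _ [Yr lip]]]]] := arc_setup F G L hF hG t Y (ltW t0) arc.
(* So large that the ball contains the whole arc. Its second half, whose end points have different
   times-to-go, then yields the measure. *)
exists (n1 z + r + 1); split; first by rewrite ltr_wpDl // addr_ge0 // n1_ge0.
have t2 : 0 < t / 2 by rewrite divr_gt0.
have t2t : t / 2 <= t by rewrite ler_pdivrMr // ler_peMr ?ler1n // ltW.
have sub (s : R) : t / 2 <= s <= t -> 0 < s <= t by move=> /andP[h1 ->]; rewrite (lt_le_trans t2).
have subW (s : R) : t / 2 <= s <= t -> 0 <= s <= t by move=> /sub /andP[/ltW -> ->].
apply: (H1_path _ Y (t / 2) t B) => //.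
- have T := arc_time _ _ _ _ arc; move=> e; have := T (t / 2); rewrite e T ?(ltW t0) ?lexx //.
  rewrite (ltW t2) t2t => /(_ isT) [] /eqP; rewrite -subr_eq0.
  have -> : t - t / 2 = t / 2 by field.
  by rewrite (gt_eqF t2).
- by move=> s s' hs hs'; apply: lip; exact: subW.
- move=> s hs; split; first by apply: arc_singular arc tt _; exact: sub.
  apply: (le_lt_trans (edist_n1 _ _)); apply: (le_lt_trans (n1B _ _)).
  by apply: ltr_pwDr; rewrite ?ltr01 // lerD2l Yr ?subW.
Qed.

(** Indexed by a finite function, so that initial controls form a countable type that [pickle] can
    enumerate. *)
Definition sign_vector (b : {ffun 'I_M -> bool}) (i : 'I_M) : R := if b i then 1 else -1.

Definition starts_with (b : {ffun 'I_M -> bool}) (t : R) (Y : R -> R * R) : Prop :=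
  [/\ 0 < t, t <= tau, abnormal_arc F G t Y, Y 0 = (0, 0) &
   exists h C : R, [/\ 0 < h, h <= t & follows (fun x => - X (sign_vector b) x) Y 0 h C]].

Lemma sign_vectorE (v : 'I_M -> R) : (forall i, `|v i| = 1) ->
  v = sign_vector [ffun i => v i == 1].
Proof.
move=> v1; apply/funext => i; rewrite /sign_vector ffunE; case: eqVneq => // vn.
have : v i ^+ 2 == 1 by rewrite -(real_normK (num_real (v i))) v1 expr1n.
by rewrite sqrf_eq1 (negbTE vn) /= => /eqP.
Qed.

Lemma starts_agree b t Y t' Y' : starts_with b t Y -> starts_with b t' Y' -> t <= t' -> Y t = Y' t.
Proof.
move=> [t0 tt arc Y0 [h [C [h0 ht f]]]] [t0' tt' arc' Y0' [h' [C' [h0' ht' f']]]] le.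
have /andP[_ tc] := htau.
apply: (arc_unique F G L hF hG calT ha t t' Y Y' (sign_vector b) h h' C C') => //.
- by rewrite Y0.
- exact: le_lt_trans tc.
- by move=> i; rewrite /sign_vector; case: ifP; rewrite ?normrN normr1.
- by rewrite lexx ltW.
Qed.

(* A target [Some q] asks for an arc of length at least [q], and [None] for one of
   maximal length; countably many arcs then contain every arc with the same start. *)
Definition long_enough b (o : option rat) (t : R) : Prop :=
  if o is Some q then ratr q <= t else forall t' Y', starts_with b t' Y' -> t' <= t.

(** One arc [Y1] is picked in the class, if there is any, and prolonged by constants through
    clamping its parameter. By uniqueness it runs through the end point of each arc with the same
    start that is no longer than the members of the class. *)
Lemma class_curve (bo : {ffun 'I_M -> bool} * option rat) : exists c : R -> R * R,
  (exists K : R, forall s s', Defs.edist (c s) (c s') <= K * `|s - s'|) /\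
  forall t Y t' Y', starts_with bo.1 t Y -> starts_with bo.1 t' Y' -> long_enough bo.1 bo.2 t' ->
    (forall t'' Y'', starts_with bo.1 t'' Y'' -> long_enough bo.1 bo.2 t'' -> t <= t'') ->
    range c (Y t).
Proof.
case: bo => b o /=.
have [[t1 [Y1 [st1 l1]]]|none] := pselect (exists t' Y', starts_with b t' Y' /\ long_enough b o t'); last first.
  exists (fun=> (0, 0)); split.
    by exists 0 => s s'; rewrite mul0r (le_trans (edist_n1 _ _)) // subrr n10.
  by move=> t Y t' Y' _ s l; case: none; exists t', Y'.
have [t10 _ arc1 _ _] := st1.
have [r [B [_ [_ B0 _ _ [_ lip]]]]] := arc_setup F G L hF hG t1 Y1 (ltW t10) arc1.
pose cl (s : R) := Num.max 0 (Num.min s t1).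
have hcl (s : R) : 0 <= cl s <= t1.
  by rewrite /cl le_max lexx ge_max (ltW t10) ge_min lexx orbT.
have cll (s s' : R) : `|cl s - cl s'| <= `|s - s'|.
  exact: clamp_lip (ltW t10).
exists (Y1 \o cl); split.
  exists B => s s'; apply: (le_trans (edist_n1 _ _)); apply: (le_trans (lip _ _ (hcl s') (hcl s))).
  by rewrite ler_wpM2l.
move=> t Y t' Y' st _ _ H; have tt1 := H _ _ st1 l1.
exists t => //=; rewrite (starts_agree _ _ _ _ _ st st1 tt1); congr Y1.
by have [t0 _ _ _ _] := st; rewrite /cl min_l // max_r // ltW.
Qed.

Lemma singular_rectifiable : countably_H1_rectifiable S.
Proof.
have /choice[c hc] := class_curve.
pose f n := if n is n'.+1 then (if unpickle n' is Some bo then c bo else fun=> (0, 0)) else fun=> (0, 0).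
have l0 : exists K : R, forall s s' : R, Defs.edist ((0, 0) : R * R) (0, 0) <= K * `|s - s'|.
  by exists 0 => s s'; rewrite mul0r (le_trans (edist_n1 _ _)) // subrr n10.
exists set0, f; split; first exact: H1_set0.
split=> [[|n]|x Sx]; [exact: l0|rewrite /=; case: unpickle => [bo|]; [by have [] := hc bo|exact: l0]|].
(* Index 0 is reserved for a constant curve at the origin, which is not the end point of an arc of
   positive length. *)
right; have [->|/eqP x0] := eqVneq x (0, 0); first by exists 0%N => //; exists 0.
have [t [Y [t0 tt arc Y0 Yt]]] := singular_arc x Sx x0.
have h00 : 0 <= (0 : R) < t by rewrite lexx.
have [v [h [C [v1 h0 C0]]]] := arc_right _ _ _ _ arc 0 h00; rewrite add0r => ht fl.
pose b := [ffun i => v i == 1].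
have st : starts_with b t Y.
  by split=> //; exists h, C; split=> //; rewrite /b -(sign_vectorE v).
have covered o t' Y' : starts_with b t' Y' -> long_enough b o t' ->
    (forall t'' Y'', starts_with b t'' Y'' -> long_enough b o t'' -> t <= t'') ->
    (\bigcup_n range (f n)) x.
  move=> st' l H; exists (pickle (b, o)).+1 => //=; rewrite pickleK -Yt.
  by have [_ /(_ t Y t' Y' st st' l H)] := hc (b, o).
have [mx|] := pselect (forall t' Y', starts_with b t' Y' -> t' <= t).
  by apply: (covered None t Y st mx) => t'' Y'' _; apply; exact: st.
move=> /existsNP[t' /existsNP[Y' /not_implyP[st' /negP]]]; rewrite -ltNge => tt'.
(* A rational strictly between the two lengths: an arc of length at least [q] exists and every such
   arc is longer than [Y]. *)
have [q] := rat_in_itvoo tt'; rewrite in_itv /= => /andP[tq qt'].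
apply: (covered (Some q) t' Y' st' (ltW qt')) => t'' Y'' _ /=; apply: le_trans; exact: ltW.
Qed.

End SingularSet.

Theorem theorem5p2 (R : realType) (M : nat) (hM : M = 1%N \/ M = 2%N)
  (F : R * R -> R * R) (G : 'I_M -> R * R -> R * R) (L : R)
  (hF : C11_vec L F) (hG : forall i, C11_vec L (G i))
  (hF0 : F (0, 0) = (0, 0))
  (hrank : forall i, \rank (row_mx (colv (G i (0, 0)))
                                   (jac F (0, 0) *m colv (G i (0, 0)))) = 2%N)
  (hDG : forall i, jac (G i) (0, 0) = 0)
  (calT : R) (hcalT : 0 < calT)
  (habc : forall t, 0 < t < calT -> prop_a F G t /\ prop_b F G t /\ prop_c F G)
  (tau : R) (htau : 0 < tau < calT) :
  let S := [set x | reach F G tau x /\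
              exists zeta, enorm zeta = 1 /\
                prox_normal (reach F G (fine (minT F G x))) x zeta /\ ham F G x zeta = 0] in
  countably_H1_rectifiable S /\
  forall xbar, S xbar -> exists delta : R, 0 < delta /\ (0 < H1 (S `&` eball xbar delta))%E.
Proof.
have ha t : 0 < t < calT -> prop_a F G t by move=> /habc[].
move=> S; split; first exact: (singular_rectifiable F G L hF hG calT ha tau htau).
move=> x Sx; have [x0|/eqP x0] := eqVneq x (0, 0); last first.
  exact: (singular_H1 F G L hF hG calT ha tau htau x x Sx x0).
have M0 : (0 < M)%N by case: hM => ->.
have /andP[tau0 _] := htau.
have [_ [zeta [z1 [_ hz]]]] := Sx; rewrite x0 in hz.
(* The covector at the origin is used only through [ham F G (0, 0) zeta = 0]; one nonzero point of
   the set then reduces this case to the previous one. *)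
have [y y0 Sy] := singular_near_origin F G L hF hG tau zeta M0 hF0 hrank hDG tau0 z1 hz.
exact: (singular_H1 F G L hF hG calT ha tau htau y x Sy y0).
Qed.
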